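(* Let $k$ be a field and let $Q$ be a Dynkin quiver. Then there is a bijection between the following two sets: (1) the set of ICE-closed subcategories of $\mathsf{mod}\,kQ$; (2) the set of isomorphism classes of basic rigid $kQ$-modules. The mutually inverse bijections are given as follows. To an ICE-closed subcategory $\mathcal{C}$ corresponds its (existing and unique up to isomorphism) basic $\operatorname{Ext}$-progenerator $P(\mathcal{C})$, and to a basic rigid $kQ$-module $U$ corresponds the subcategory $\mathsf{cok}\,U$ consisting of the cokernels of maps in $\mathsf{add}\,U$. Moreover, a subcategory of $\mathsf{mod}\,kQ$ is ICE-closed if and only if it is a torsion class in some wide subcategory of $\mathsf{mod}\,kQ$.
   Context: A Dynkin quiver is a quiver whose underlying graph is a simply-laced Dynkin diagram $A_n$, $D_n$, $E_6$, $E_7$ or $E_8$ (any orientation). $kQ$ is its path algebra and $\mathsf{mod}\,kQ$ is the category of finitely generated right $kQ$-modules. All subcategories are assumed to be full and closed under isomorphisms, direct sums and direct summands (in particular they contain $0$). For a module $U$, $\mathsf{add}\,U$ is the subcategory of direct summands of finite direct sums of copies of $U$. A module is basic if it is a direct sum of pairwise non-isomorphic indecomposable modules (the zero module is basic). A module $U$ is rigid if $\operatorname{Ext}^1(U,U)=0$. A subcategory $\mathcal{C}$ of $\mathsf{mod}\,kQ$ is closed under extensions if for every short exact sequence $0\to L\to M\to N\to 0$ in $\mathsf{mod}\,kQ$ with $L,N\in\mathcal{C}$ one has $M\in\mathcal{C}$; it is closed under kernels (resp. cokernels, images) if for every map $f\colon M\to N$ with $M,N\in\mathcal{C}$ one has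 $\ker f\in\mathcal{C}$ (resp. $\operatorname{coker} f\in\mathcal{C}$, $\operatorname{im} f\in\mathcal{C}$). $\mathcal{C}$ is ICE-closed if it is closed under images, cokernels and extensions. $\mathcal{C}$ is wide if it is closed under kernels, cokernels and extensions; a wide subcategory is an abelian category. A torsion class in an abelian category $\mathcal{A}$ is a subcategory of $\mathcal{A}$ closed under quotients and extensions in $\mathcal{A}$. For an extension-closed subcategory $\mathcal{C}$, an object $X\in\mathcal{C}$ is $\operatorname{Ext}$-projective in $\mathcal{C}$ if $\operatorname{Ext}^1(X,C)=0$ for all $C\in\mathcal{C}$. $\mathcal{C}$ has enough $\operatorname{Ext}$-projectives if for every $X\in\mathcal{C}$ there is a short exact sequence $0\to Y\to P\to X\to 0$ with $P$ $\operatorname{Ext}$-projective in $\mathcal{C}$ and $Y\in\mathcal{C}$. An object $P\in\mathcal{C}$ is an $\operatorname{Ext}$-progenerator of $\mathcal{C}$ if $\mathsf{add}\,P$ is exactly the class of $\operatorname{Ext}$-projective objects in $\mathcal{C}$ and $\mathcal{C}$ has enough $\operatorname{Ext}$-projectives. *)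

(* Defs.v *)
From HB Require Import structures.
From mathcomp Require Import all_boot all_algebra finmap.
From mathcomp.multinomials Require Import monalg.

Set Implicit Arguments.
Unset Strict Implicit.
Unset Printing Implicit Defensive.

Import GRing.Theory.
Local Open Scope ring_scope.

Record quiver := Quiver {
  vertex : finType;
  arrow : finType;
  src : arrow -> vertex;
  tgt : arrow -> vertex }.

Arguments src {q} a.
Arguments tgt {q} a.

Inductive dynkin_type : Type :=
| DynA n of (0 < n)%N
| DynD n of (3 < n)%N
| DynE6
| DynE7
| DynE8.

Definition dynkin_rank (t : dynkin_type) : nat :=
  match t with
  | DynA n _ => n
  | DynD n _ => n
  | DynE6 => 6
  | DynE7 => 7
  | DynE8 => 8
  end.

(* The chain 0 - 1 - ... - (n-2), with the vertex n-1 attached to vertex b. *)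
Definition branched_chain (n b : nat) : rel nat := fun i j =>
  (j == i.+1) && (j < n.-1)%N || (i == b) && (j == n.-1).

(* Each edge is listed once, from its smaller to its larger endpoint. *)
Definition dynkin_edge (t : dynkin_type) : rel nat :=
  match t with
  | DynA n _ => fun i j => j == i.+1
  | DynD n _ => branched_chain n (n - 3)
  | DynE6 => branched_chain 6 2
  | DynE7 => branched_chain 7 2
  | DynE8 => branched_chain 8 2
  end.

Definition dynkin_adj (t : dynkin_type) (i j : nat) : bool :=
  dynkin_edge t i j || dynkin_edge t j i.

(* The number of arrows joining x and y, in either direction, is 1 or 0 as the
   vertices are adjacent or not in the diagram; x = y excludes loops. *)
Definition dynkin_quiver (Q : quiver) : Prop :=
  exists (t : dynkin_type) (phi : vertex Q -> 'I_(dynkin_rank t)),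
    bijective phi /\
    forall x y : vertex Q,
      #|[pred a : arrow Q | ((src a == x) && (tgt a == y))
                         || ((src a == y) && (tgt a == x))]|
      = dynkin_adj t (phi x) (phi y).

Section Paths.
Variable Q : quiver.

Fixpoint walk (x : vertex Q) (s : seq (arrow Q)) : bool :=
  if s is a :: s' then (src a == x) && walk (tgt a) s' else true.

(* A path is a source vertex with consecutive arrows, listed in the order in
   which they are travelled; (x, [::]) is the trivial path at x. *)
Record qpath := QPath { qpath_val : vertex Q * seq (arrow Q);
                        _ : walk qpath_val.1 qpath_val.2 }.

HB.instance Definition _ := [isSub for qpath_val].
HB.instance Definition _ := [Choice of qpath by <:].

Lemma qpath_valK (p : qpath) : insub (val p) = Some p.
Proof. exact: valK. Qed.

Definition walk_end (x : vertex Q) (s : seq (arrow Q)) : vertex Q :=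
  last x [seq tgt a | a <- s].

Definition psource (p : qpath) : vertex Q := (val p).1.
Definition ptarget (p : qpath) : vertex Q := walk_end (val p).1 (val p).2.

Definition trivial_path (x : vertex Q) : qpath := @QPath (x, [::]) isT.

Lemma walk_cat x s t : walk x (s ++ t) = walk x s && walk (walk_end x s) t.
Proof. by elim: s x => //= a s IHs x; rewrite IHs andbA. Qed.

(* Concatenation "first p, then q", when defined. *)
Definition pcomp (p q : qpath) : option qpath :=
  if ptarget p == psource q then insub ((val p).1, (val p).2 ++ (val q).2)
  else None.

Lemma walk_end_cat x s t :
  walk_end x (s ++ t) = walk_end (walk_end x s) t.
Proof. by rewrite /walk_end map_cat last_cat. Qed.

Variant pcomp_spec (p q : qpath) : option qpath -> Type :=
| PComp r of ptarget p = psource q & val r = ((val p).1, (val p).2 ++ (val q).2)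
  : pcomp_spec p q (Some r)
| NoPComp of ptarget p != psource q : pcomp_spec p q None.

Lemma pcompP p q : pcomp_spec p q (pcomp p q).
Proof.
rewrite /pcomp; case: eqP => [e|/eqP ne]; last exact: NoPComp.
have w : walk (val p).1 ((val p).2 ++ (val q).2).
  by rewrite walk_cat (valP p) /= -/(ptarget p) e (valP q).
by rewrite (insubT (fun u => walk u.1 u.2) (x := (_, _)) w); apply: PComp.
Qed.

Lemma pcompA p q r :
  obind (fun u => pcomp u r) (pcomp p q) = obind (pcomp p) (pcomp q r).
Proof.
case: (pcompP p q) => [u epq eu|npq]; case: (pcompP q r) => [v eqr ev|nqr] //=.
- have tu : ptarget u = ptarget q.
    by rewrite /ptarget eu /= walk_end_cat -/(ptarget p) epq.
  have sv : psource v = psource q by rewrite /psource ev.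
  rewrite /pcomp tu eqr eqxx sv epq eqxx eu ev /=.
  by rewrite catA.
- have tu : ptarget u = ptarget q.
    by rewrite /ptarget eu /= walk_end_cat -/(ptarget p) epq.
  by rewrite /pcomp tu (negbTE nqr).
- have sv : psource v = psource q by rewrite /psource ev.
  by rewrite /pcomp sv (negbTE npq).
Qed.

End Paths.

(* The linear extension of h to the free vector space on P. *)
HB.lock Definition linext (k : fieldType) (P : choiceType) (V : lmodType k)
  (h : P -> V) (g : {malg k[P]}) : V := \sum_(p <- msupp g) g@_p *: h p.

Section LinearExtension.
Variables (k : fieldType) (P : choiceType) (V : lmodType k).
Implicit Types (h : P -> V) (f g : {malg k[P]}).

Lemma linextEw h (d : {fset P}) g : (msupp g `<=` d)%fset ->
  linext h g = \sum_(p <- d) g@_p *: h p.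
Proof.
move=> le; rewrite linext.unlock (big_fset_incl _ le) // => p _.
by move/mcoeff_outdom=> ->; rewrite scale0r.
Qed.

Lemma linext_lin h c f g : linext h (c *: f + g) = c *: linext h f + linext h g.
Proof.
pose d := (msupp f `|` msupp g `|` msupp (c *: f + g))%fset.
have le3 : (msupp (c *: f + g)%R `<=` d)%fset by apply: fsubsetUr.
have le2 : (msupp g `<=` d)%fset by rewrite /d fsetUAC fsubsetUr.
have le1 : (msupp f `<=` d)%fset by rewrite /d -fsetUA fsubsetUl.
rewrite (linextEw h le1) (linextEw h le2) (linextEw h le3).
rewrite scaler_sumr -big_split /=; apply: eq_bigr => p _.
by rewrite mcoeffD mcoeffZ scalerDl scalerA.
Qed.

Lemma linext0 h : linext h 0 = 0.
Proof. by rewrite (@linextEw _ fset0) ?msupp0 // big_seq_fset0. Qed.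

Lemma linextD h f g : linext h (f + g) = linext h f + linext h g.
Proof. by rewrite -[f in LHS]scale1r linext_lin scale1r. Qed.

Lemma linextZ h c f : linext h (c *: f) = c *: linext h f.
Proof.
by rewrite -[X in linext h X](addr0 (c *: f)) linext_lin linext0 addr0.
Qed.

Lemma linext_sum h (I : Type) (r : seq I) (F : I -> {malg k[P]}) :
  linext h (\sum_(i <- r) F i) = \sum_(i <- r) linext h (F i).
Proof. exact: (big_morph _ (linextD h) (linext0 h)). Qed.

Lemma linextU h p : linext h << p >> = h p.
Proof.
rewrite (@linextEw _ [fset p]%fset) ?msuppU_le //.
by rewrite big_seq_fset1 mcoeffUU scale1r.
Qed.

Lemma eq_linext h h' g : h =1 h' -> linext h g = linext h' g.
Proof. by move=> e; rewrite linext.unlock; apply: eq_bigr => p _; rewrite e. Qed.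

Lemma linext_fun_lin (h h' : P -> V) c g :
  linext (fun p => c *: h p + h' p) g = c *: linext h g + linext h' g.
Proof.
rewrite linext.unlock scaler_sumr -big_split /=; apply: eq_bigr => p _.
by rewrite scalerDr !scalerA mulrC.
Qed.

Lemma linext_fun_sum (I : Type) (r : seq I) (h : I -> P -> V) g :
  linext (fun p => \sum_(i <- r) h i p) g = \sum_(i <- r) linext (h i) g.
Proof.
rewrite linext.unlock exchange_big /=; apply: eq_bigr => p _.
by rewrite scaler_sumr.
Qed.

Lemma linext_fun0 g : linext (fun=> 0 : V) g = 0.
Proof. by rewrite linext.unlock big1 // => p _; rewrite scaler0. Qed.

End LinearExtension.

Lemma linext_id (k : fieldType) (P : choiceType) (g : {malg k[P]}) :
  linext (fun p => << p >> : {malg k[P]}) g = g.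
Proof.
rewrite [RHS]monalgE linext.unlock; apply: eq_bigr => p _; apply/malgP => q.
by rewrite mcoeffZ 2!mcoeffU mulr_natr.
Qed.

Lemma linext_linext (k : fieldType) (P P' : choiceType) (V : lmodType k)
    (h : P -> V) (h' : P' -> {malg k[P]}) g :
  linext h (linext h' g) = linext (fun p => linext h (h' p)) g.
Proof.
rewrite !(linextEw _ (fsubset_refl (msupp g))) linext_sum.
by apply: eq_bigr => p _; rewrite linextZ.
Qed.

Section PathAlgebra.
Variables (k : fieldType) (Q : quiver).
Local Notation P := (qpath Q).
Local Notation V := {malg k[P]}.

Definition pbasis_mul (p q : P) : V :=
  if pcomp p q is Some r then << r >> else 0.

Definition path_one : V := \sum_(x : vertex Q) << trivial_path x >>.

Definition path_mul (f g : V) : V :=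
  linext (fun p => linext (pbasis_mul p) g) f.

Lemma path_mulUU p q : path_mul << p >> << q >> = pbasis_mul p q.
Proof. by rewrite /path_mul !linextU. Qed.

Lemma path_mul_linl c f1 f2 g :
  path_mul (c *: f1 + f2) g = c *: path_mul f1 g + path_mul f2 g.
Proof. exact: linext_lin. Qed.

Lemma path_mul_linr c f g1 g2 :
  path_mul f (c *: g1 + g2) = c *: path_mul f g1 + path_mul f g2.
Proof.
apply: etrans (linext_fun_lin _ _ c f); apply: eq_linext => p.
exact: linext_lin.
Qed.

Lemma path_mulZr c f g : path_mul f (c *: g) = c *: path_mul f g.
Proof.
rewrite -[X in path_mul f X](addr0 (c *: g)) path_mul_linr.
suff -> : path_mul f 0 = 0 by rewrite addr0.
apply: etrans (linext_fun0 _ f).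
by apply: eq_linext => p; apply: linext0.
Qed.

Lemma path_mulDl : left_distributive path_mul +%R.
Proof. by move=> f g h; apply: linextD. Qed.

Lemma path_mulDr : right_distributive path_mul +%R.
Proof.
move=> f g h; have := path_mul_linr 1 f g h.
by rewrite (scale1r g) (scale1r (path_mul f g)).
Qed.

Lemma pbasis_mulA p q r :
  linext (pbasis_mul p) (pbasis_mul q r) =
  linext (fun u => pbasis_mul u r) (pbasis_mul p q).
Proof.
have := pcompA p q r; rewrite /pbasis_mul.
case: (pcomp p q) (pcomp q r) => [u|] [v|] /=.
- by rewrite !linextU => ->.
- by rewrite linextU linext0 => ->.
- by rewrite linextU linext0 => <-.
- by rewrite !linext0.
Qed.

Lemma path_mulA : associative path_mul.
Proof.
move=> f g h; rewrite /path_mul linext_linext; apply: eq_linext => p.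
rewrite !linext_linext; apply: eq_linext => q.
rewrite linext_linext.
transitivity (linext (fun r => linext (fun u => pbasis_mul u r)
                                 (pbasis_mul p q)) h).
  by apply: eq_linext => r; apply: pbasis_mulA.
rewrite /(pbasis_mul p q); case: (pcomp p q) => [u|].
  by rewrite linextU; apply: eq_linext => r; rewrite linextU.
by rewrite linext0 -[RHS](linext_fun0 _ h); apply: eq_linext => r; rewrite linext0.
Qed.

Lemma pcomp1p (x : vertex Q) (p : P) :
  pcomp (trivial_path x) p = if x == psource p then Some p else None.
Proof.
rewrite /pcomp /ptarget /=; case: eqP => //; rewrite /walk_end /= => ->.
by rewrite /psource -surjective_pairing qpath_valK.
Qed.

Lemma pcompp1 (x : vertex Q) (p : P) :
  pcomp p (trivial_path x) = if ptarget p == x then Some p else None.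
Proof.
rewrite /pcomp /psource /=; case: eqP => // _.
by rewrite cats0 -surjective_pairing qpath_valK.
Qed.

Lemma path_mul1f : left_id path_one path_mul.
Proof.
move=> f; rewrite /path_mul linext_sum -[RHS]linext_id.
under eq_bigr do rewrite linextU.
rewrite -linext_fun_sum; apply: eq_linext => p.
rewrite (bigD1 (psource p)) //= /pbasis_mul pcomp1p eqxx big1 ?addr0 // => x nx.
by rewrite pcomp1p (negbTE nx).
Qed.

Lemma path_mulf1 : right_id path_one path_mul.
Proof.
move=> f; rewrite /path_mul -[RHS]linext_id; apply: eq_linext => p.
rewrite linext_sum; under eq_bigr do rewrite linextU.
rewrite (bigD1 (ptarget p)) //= /pbasis_mul pcompp1 eqxx big1 ?addr0 // => x nx.
by rewrite pcompp1 eq_sym (negbTE nx).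
Qed.

Definition path_algebra : Type := V.

HB.instance Definition _ := GRing.Lmodule.on path_algebra.
HB.instance Definition _ := GRing.Zmodule_isPzRing.Build path_algebra
  path_mulA path_mul1f path_mulf1 path_mulDl path_mulDr.

Lemma path_scalerAl (c : k) (f g : path_algebra) : c *: (f * g) = (c *: f) * g.
Proof. exact/esym/linextZ. Qed.

Lemma path_scalerAr (c : k) (f g : path_algebra) : c *: (f * g) = f * (c *: g).
Proof. exact/esym/path_mulZr. Qed.

Lemma path_basisM (p q : P) :
  (<< p >> : path_algebra) * (<< q >> : path_algebra) =
  if pcomp p q is Some r then << r >> else 0.
Proof. exact: path_mulUU. Qed.

End PathAlgebra.

(* Right R-modules are left modules over the converse ring R^c. *)
Notation rmodType R := (lmodType (R^c)).

Definition finitely_generated (R : pzRingType) (M : rmodType R) : Prop :=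
  exists (n : nat) (g : 'I_n -> M),
    forall x : M, exists c : 'I_n -> R^c, x = \sum_(i < n) c i *: g i.

Record fgmod (R : pzRingType) := FGMod {
  fgmod_sort :> rmodType R;
  fgmod_fg : finitely_generated fgmod_sort }.

Section ModuleCategory.
Variable R : pzRingType.
Local Notation modR := (fgmod R).
Implicit Types (C T W : modR -> Prop) (K L M N X Y U P : modR).

Definition mod_iso (M N : rmodType R) : Prop :=
  exists f : {linear M -> N}, bijective f.

Definition zero_mod (M : rmodType R) : Prop := forall x : M, x = 0.

Definition is_kernel (K M N : rmodType R)
    (f : {linear M -> N}) (i : {linear K -> M}) : Prop :=
  injective i /\ forall x, f x = 0 <-> exists z, i z = x.

Definition is_cokernel (M N L : rmodType R)
    (f : {linear M -> N}) (p : {linear N -> L}) : Prop :=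
  (forall z, exists y, p y = z) /\ forall y, p y = 0 <-> exists x, f x = y.

Definition is_image (M N L : rmodType R)
    (f : {linear M -> N}) (i : {linear L -> N}) : Prop :=
  injective i /\ forall y, (exists x, f x = y) <-> exists z, i z = y.

Definition short_exact (L M N : rmodType R)
    (f : {linear L -> M}) (g : {linear M -> N}) : Prop :=
  [/\ injective f,
      forall y, g y = 0 <-> exists x, f x = y
    & forall z, exists y, g y = z].

(* Ext^1(X, Y) as the set of extensions 0 -> Y -> E -> X -> 0 modulo
   equivalence, whose zero is the class of 0 -> Y -> Y (+) X -> X -> 0; an
   equivalence is automatically bijective. *)
Definition Ext1_zero X Y : Prop :=
  forall (E : modR) (i : {linear Y -> E}) (p : {linear E -> X}),
    short_exact i p ->
    exists phi : {linear E -> (Y * X)%type},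
      (forall y, phi (i y) = (y, 0)) /\ (forall e, (phi e).2 = p e).

(* Subcategories, being full, are given by their classes of objects. *)
Definition subcategory C : Prop :=
  [/\ forall M N, mod_iso M N -> C M -> C N,
      forall Z : modR, zero_mod Z -> C Z,
      forall M N S : modR, C M -> C N -> mod_iso S (M * N)%type -> C S
    & forall M N S : modR, C S -> mod_iso S (M * N)%type -> C M].

Definition extension_closed C : Prop :=
  forall L M N (f : {linear L -> M}) (g : {linear M -> N}),
    short_exact f g -> C L -> C N -> C M.

Definition kernel_closed C : Prop :=
  forall M N K (f : {linear M -> N}) (i : {linear K -> M}),
    C M -> C N -> is_kernel f i -> C K.

Definition cokernel_closed C : Prop :=
  forall M N L (f : {linear M -> N}) (p : {linear N -> L}),
    C M -> C N -> is_cokernel f p -> C L.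

Definition image_closed C : Prop :=
  forall M N L (f : {linear M -> N}) (i : {linear L -> N}),
    C M -> C N -> is_image f i -> C L.

Definition ice_closed C : Prop :=
  [/\ subcategory C, image_closed C, cokernel_closed C & extension_closed C].

Definition wide C : Prop :=
  [/\ subcategory C, kernel_closed C, cokernel_closed C & extension_closed C].

(* Epimorphisms and short exact sequences internal to the full subcategory W:
   only test objects belonging to W occur. *)
Definition epi_in W (M N : modR) (g : {linear M -> N}) : Prop :=
  forall Z, W Z -> forall u v : {linear N -> Z},
    (forall x, u (g x) = v (g x)) -> u =1 v.

Definition kernel_in W (K M N : modR)
    (f : {linear M -> N}) (i : {linear K -> M}) : Prop :=
  (forall z, f (i z) = 0) /\
  forall Z, W Z -> forall u : {linear Z -> M}, (forall z, f (u z) = 0) ->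
    exists v : {linear Z -> K}, (forall z, i (v z) = u z) /\
      forall v' : {linear Z -> K}, (forall z, i (v' z) = u z) -> v' =1 v.

Definition cokernel_in W (M N L : modR)
    (f : {linear M -> N}) (p : {linear N -> L}) : Prop :=
  (forall x, p (f x) = 0) /\
  forall Z, W Z -> forall u : {linear N -> Z}, (forall x, u (f x) = 0) ->
    exists v : {linear L -> Z}, (forall y, v (p y) = u y) /\
      forall v' : {linear L -> Z}, (forall y, v' (p y) = u y) -> v' =1 v.

Definition short_exact_in W (L M N : modR)
    (f : {linear L -> M}) (g : {linear M -> N}) : Prop :=
  kernel_in W g f /\ cokernel_in W f g.

Definition torsion_class_in W T : Prop :=
  [/\ subcategory T,
      forall M, T M -> W M,
      forall M N (g : {linear M -> N}), T M -> W N -> epi_in W g -> T N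
    & forall L M N (f : {linear L -> M}) (g : {linear M -> N}),
        T L -> W M -> T N -> short_exact_in W f g -> T M].

Definition ext_projective C X : Prop := C X /\ forall Y, C Y -> Ext1_zero X Y.

Definition enough_ext_projectives C : Prop :=
  forall X, C X -> exists (Y P : modR) (f : {linear Y -> P}) (g : {linear P -> X}),
    [/\ C Y, ext_projective C P & short_exact f g].

Definition add_of U : modR -> Prop := fun M =>
  exists (n : nat) (N : modR), mod_iso {ffun 'I_n -> U} (M * N)%type.

Definition ext_progenerator C P : Prop :=
  [/\ C P, forall M, add_of P M <-> ext_projective C M & enough_ext_projectives C].

Definition indecomposable X : Prop :=
  ~ zero_mod X /\
  forall A B : modR, mod_iso X (A * B)%type -> zero_mod A \/ zero_mod B.

Definition direct_sum_of (M : modR) (n : nat) (F : 'I_n -> modR) : Prop :=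
  exists inj : forall i, {linear F i -> M},
    (forall x : M, exists y : forall i, F i, x = \sum_(i < n) inj i (y i)) /\
    (forall y : forall i, F i,
       \sum_(i < n) inj i (y i) = 0 -> forall i, y i = 0).

Definition basic M : Prop :=
  exists (n : nat) (F : 'I_n -> modR),
    [/\ direct_sum_of M F,
        forall i, indecomposable (F i)
      & forall i j, mod_iso (F i) (F j) -> i = j].

Definition rigid U : Prop := Ext1_zero U U.

Definition cok U : modR -> Prop := fun L =>
  exists (M N : modR) (f : {linear M -> N}) (p : {linear N -> L}),
    [/\ add_of U M, add_of U N & is_cokernel f p].

Definition iso_class U : modR -> Prop := fun M => mod_iso M U.

Definition basic_rigid_class (X : modR -> Prop) : Prop :=
  exists U, [/\ basic U, rigid U & X = iso_class U].

Definition progen_class C : modR -> Prop := fun P =>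
  basic P /\ ext_progenerator C P.

Definition cok_class (X : modR -> Prop) : modR -> Prop := fun L =>
  exists U, X U /\ cok U L.

End ModuleCategory.

Definition mutually_inverse (S T : Type) (A : S -> Prop) (B : T -> Prop)
    (f : S -> T) (g : T -> S) : Prop :=
  [/\ forall x, A x -> B (f x),
      forall y, B y -> A (g y),
      forall x, A x -> g (f x) = x
    & forall y, B y -> f (g y) = y].

(* Main.v *)
(* Submodules of finitely generated kQ-modules are finitely generated, and because
   extensions are given by cocycles of linear maps indexed by the arrows, Ext^1 is right
   exact in both variables.

   For U rigid, the image I of a map V -> N in add U lies in add U: lifting the extension
   0 -> I -> N -> N/I -> 0 along V -> I yields a split sequence 0 -> V -> I + E -> N -> 0
   (Happel and Ringel).  So every X in cok U has a resolution 0 -> U1 -> U0 -> X -> 0 by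
   objects of add U, from which cok U is ICE-closed with Ext-progenerator U.

   If C is ICE-closed, the kernels of epimorphisms in C form a wide subcategory, in which
   C is a torsion class.

   The Dynkin hypothesis enters through the Tits form q, which satisfies x_i^2 <= N q(x).
   Since q(dim X) = dim Hom(X,X) - dim Ext^1(X,X), every indecomposable is a brick without
   self-extensions and is determined by its dimension vector, and there are finitely many
   indecomposables.  Finite type gives enough Ext-projectives in an ICE-closed C: among the
   epimorphisms E -> X in C with kernel in C there is one which factors through all the
   others, and if moreover dim E is minimal then E is Ext-projective. *)

From HB Require Import structures.
From mathcomp Require Import all_boot all_order all_algebra finmap.
From mathcomp Require Import generic_quotient ring_quotient zify ring lra.
From mathcomp.multinomials Require Import monalg.
From mathcomp.classical Require Import boolp.
Require Import Defs.

Set Implicit Arguments.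
Unset Strict Implicit.
Unset Printing Implicit Defensive.

Import Order.TTheory GRing.Theory Num.Theory VectorInternalTheory.
Local Open Scope ring_scope.

(** * Submodules and quotient modules *)

(** Ext^1 is never formed as a group: only its vanishing is defined, as splitting of extensions.
    Long exact sequences are therefore replaced by lifting and extending maps along pullbacks and
    pushouts, and right exactness by two statements about extensions, [extensions_lift] and
    [extensions_extend]. These two and [noetherian] are all that the study of cok U and of the wide
    hull needs to know about the ring.

    The single inequality x_i^2 <= N q(x) does three jobs. It excludes oriented cycles, so that
    modules are finite-dimensional; it makes q positive on nonzero dimension vectors, which produces
    nonzero maps and kills self-extensions of bricks; and it bounds the dimension vectors of
    indecomposables. Neither roots nor reflection functors nor a general Krull-Schmidt theorem
    enter: since indecomposables are bricks, two basic modules are compared summand by summand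
    through nonzero composites. *)

Definition mklin (A : pzRingType) (M N : lmodType A) (f : M -> N) (h : linear f)
  : {linear M -> N} := HB.pack f (GRing.isLinear.Build A M N *:%R f h).

Section SubQuotient.
Local Open Scope quotient_scope.
Variable A : pzRingType.
Implicit Type M : lmodType A.

Definition submodule M (S : M -> Prop) : Prop :=
  S 0 /\ forall c x y, S x -> S y -> S (c *: x + y).

Section Closed.
Variables (M : lmodType A) (S : M -> Prop) (hS : submodule S).

(** The closure proof is an argument so that the structures on the predicate, which depend on it,
    can be inferred. *)
Definition submod_pred of submodule S : {pred M} := fun x => `[<S x>].

Lemma submod_predP x : reflect (S x) (x \in submod_pred hS).
Proof. exact: asboolP. Qed.

Fact submod_pred_closed : submod_closed (submod_pred hS).
Proof.
case: hS => h0 h1; split; first exact/submod_predP.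
by move=> c x y /submod_predP sx /submod_predP sy; apply/submod_predP/h1.
Qed.
HB.instance Definition _ :=
  GRing.isSubmodClosed.Build A M (submod_pred hS) submod_pred_closed.

Record submod_type :=
  SubmodElt { submod_val : M; _ : submod_val \in submod_pred hS }.
HB.instance Definition _ := [isSub for submod_val].
HB.instance Definition _ := [Choice of submod_type by <:].
HB.instance Definition _ :=
  [SubChoice_isSubLmodule of submod_type by <:].

Lemma submodule_ex :
  exists (K : lmodType A) (i : {linear K -> M}),
    injective i /\ forall x, S x <-> exists z, i z = x.
Proof.
exists submod_type, (val : {linear submod_type -> M}); split; first exact: val_inj.
move=> x; split; last by case=> z <-; apply/submod_predP/(valP z).
by move/submod_predP=> h; exists (SubmodElt h).
Qed.

Definition quot_type := Quotient.quot (submod_pred hS).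
HB.instance Definition _ := GRing.Zmodule.on quot_type.

Lemma quot_eq (x y : M) :
  (\pi_(quot_type) x = \pi_(quot_type) y :> quot_type) <-> S (x - y).
Proof.
by split=> [/eqP|h]; [|apply/eqP]; rewrite -Quotient.idealrBE; 
  [move/submod_predP | apply/submod_predP].
Qed.

Definition quot_scale (a : A) (u : quot_type) : quot_type :=
  \pi_(quot_type) (a *: repr u).

Lemma quot_scale_pi a x :
  quot_scale a (\pi_(quot_type) x) = \pi_(quot_type) (a *: x).
Proof.
apply/quot_eq; rewrite -scalerBr -[_ *: _]addr0; apply hS.2; last exact: hS.1.
by apply/quot_eq; rewrite reprK.
Qed.

Lemma quot_pi_add x y :
  \pi_(quot_type) (x + y) = \pi_(quot_type) x + \pi_(quot_type) y :> quot_type.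
Proof. exact: (raddfD (\pi_(quot_type) : {additive M -> quot_type})). Qed.

Lemma quot_surj (u : quot_type) : exists x, \pi_(quot_type) x = u.
Proof. by exists (repr u); apply: reprK. Qed.

Fact quot_scaleA a b u : quot_scale a (quot_scale b u) = quot_scale (a * b) u.
Proof. by have [x <-] := quot_surj u; rewrite !quot_scale_pi scalerA. Qed.
Fact quot_scale1 : left_id 1 quot_scale.
Proof. by move=> u; have [x <-] := quot_surj u; rewrite quot_scale_pi scale1r. Qed.
Fact quot_scaleDr : right_distributive quot_scale +%R.
Proof.
move=> a u v; have [x <-] := quot_surj u; have [y <-] := quot_surj v.
by rewrite -quot_pi_add !quot_scale_pi scalerDr quot_pi_add.
Qed.
Fact quot_scaleDl u : {morph quot_scale^~ u : a b / a + b}.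
Proof.
by move=> a b; have [x <-] := quot_surj u; rewrite !quot_scale_pi scalerDl quot_pi_add.
Qed.
HB.instance Definition _ := GRing.Zmodule_isLmodule.Build A quot_type
  quot_scaleA quot_scale1 quot_scaleDr quot_scaleDl.

Fact quot_pi_linear : linear (fun x : M => \pi_(quot_type) x : quot_type).
Proof. by move=> c x y; rewrite quot_pi_add -quot_scale_pi. Qed.

Lemma quotient_ex :
  exists (L : lmodType A) (p : {linear M -> L}),
    (forall z, exists y, p y = z) /\ forall y, p y = 0 <-> S y.
Proof.
exists quot_type, (mklin quot_pi_linear); split; first exact: quot_surj.
move=> y; rewrite -[X in S X]subr0 -quot_eq -[\pi_(quot_type) 0]/(mklin quot_pi_linear 0).
by rewrite linear0.
Qed.
End Closed.
End SubQuotient.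

Section Objects.
Variable R : pzRingType.
Local Notation modR := (fgmod R).
Implicit Types (M N K L : modR).

Lemma fg_quotient (M : modR) (L : rmodType R) (p : {linear M -> L}) :
  (forall z, exists y, p y = z) -> finitely_generated L.
Proof.
move=> sp; case: M p sp => M [n [g hg]] p sp; exists n, (p \o g) => z.
have [y <-] := sp z; have [c ->] := hg y; exists c.
by rewrite linear_sum; apply: eq_bigr => i _; rewrite linearZ.
Qed.

Lemma quot_ex M (S : M -> Prop) : submodule S ->
  exists (L : modR) (p : {linear M -> L}),
    (forall z, exists y, p y = z) /\ forall y, p y = 0 <-> S y.
Proof.
move=> hS; have [L [p [sp kp]]] := quotient_ex hS.
by exists (FGMod (fg_quotient sp)), p.
Qed.

Lemma fg_prod M N : finitely_generated (M * N)%type.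
Proof.
case: M N => M [m [g hg]] [N [n [h hh]]].
exists (m + n)%N, (fun i => match split i with inl i => (g i, 0) | inr j => (0, h j) end).
case=> x y; have [c ->] := hg x; have [d ->] := hh y.
exists (fun i => match split i with inl i => c i | inr j => d j end).
have e1 i : split (lshift n i) = inl i :> 'I_m + 'I_n := unsplitK (inl i).
have e2 i : split (rshift m i) = inr i :> 'I_m + 'I_n := unsplitK (inr i).
rewrite big_split_ord /=.
transitivity (\sum_i c i *: ((g i, 0) : (M * N)%type)
              + \sum_i d i *: ((0, h i) : (M * N)%type)); last first.
  by congr (_ + _); apply: eq_bigr => i _; rewrite ?e1 ?e2.
have sum1 (I : finType) (a : I -> R^c) (u : I -> (M * N)%type) :
  \sum_i a i *: u i = (\sum_i a i *: (u i).1, \sum_i a i *: (u i).2).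
  by apply: (big_rec3 (fun x y z => z = (x, y))) => // i x1 x2 x3 _ ->.
rewrite !sum1 /=; congr pair => /=.
  by under [X in _ = _ + X]eq_bigr do rewrite scaler0; rewrite big1_eq addr0.
by under [X in _ = X + _]eq_bigr do rewrite scaler0; rewrite big1_eq add0r.
Qed.
Definition prodm M N : modR := FGMod (fg_prod M N).

Lemma fg_ffun n M : finitely_generated {ffun 'I_n -> M}.
Proof.
case: M => M [m [g hg]].
exists #|{: 'I_n * 'I_m}|, (fun t => [ffun i => if i == (enum_val t).1 then g (enum_val t).2 else 0]).
move=> x; have /choice[c hc] := fun i => hg (x i).
exists (fun t => c (enum_val t).1 (enum_val t).2).
rewrite -(big_enum_val (fun t => c t.1 t.2 *: [ffun i => if i == t.1 then g t.2 else 0])) /=.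
apply/ffunP => i; rewrite hc sum_ffunE.
rewrite -(pair_bigA _ (fun p q => (c p q *: [ffun i => if i == p then g q else 0]) i)) /=.
rewrite (bigD1 i) //= [X in _ + X]big1 ?addr0.
  by apply: eq_bigr => j _; rewrite !ffunE eqxx.
by move=> j nj; rewrite big1 // => l _; rewrite !ffunE eq_sym (negbTE nj) scaler0.
Qed.
Definition ffunm n M : modR := FGMod (fg_ffun n M).

Lemma zero_mod_ex : exists Z : modR, zero_mod Z.
Proof.
have h : finitely_generated ('rV[R^c]_0).
  by exists 0, (fun=> 0) => x; exists (fun=> 0); rewrite big_ord0; apply/matrixP => i [].
by exists (FGMod h) => x /=; apply/matrixP => i [].
Qed.
End Objects.

(** * Linear maps and extensions *)

Section Maps.
Variable R : pzRingType.
Local Notation modR := (fgmod R).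
Implicit Types (M N K L X Y Z E : modR).

(** Preimages chosen pointwise form a linear map because [i] is injective; the dual lemma below
    works in the same way. Together they stand in for universal properties throughout. *)
Lemma factor_mono (A : pzRingType) (K M Z : lmodType A) (i : {linear K -> M}) (f : {linear Z -> M}) :
  injective i -> (forall z, exists k, i k = f z) ->
  exists g : {linear Z -> K}, forall z, i (g z) = f z.
Proof.
move=> inj /choice[g hg]; suff lg : linear g by exists (mklin lg).
by move=> c x y; apply: inj; rewrite linearP !hg linearP.
Qed.

Lemma factor_epi (A : pzRingType) (M L Z : lmodType A) (p : {linear M -> L}) (f : {linear M -> Z}) :
  (forall z, exists y, p y = z) -> (forall x, p x = 0 -> f x = 0) ->
  exists g : {linear L -> Z}, forall x, g (p x) = f x.
Proof.
move=> /choice[s hs] h.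
have e x : f (s (p x)) = f x.
  by apply/eqP; rewrite -subr_eq0 -linearB; apply/eqP/h; rewrite linearB /= hs subrr.
suff lg : linear (f \o s) by exists (mklin lg) => x; apply: e.
move=> c x y /=; rewrite -linearP -[in RHS]e; congr (f (s _)).
by rewrite linearP !hs.
Qed.

Lemma linear_eq0_inj (A : pzRingType) (M N : lmodType A) (f : {linear M -> N}) :
  (forall x, f x = 0 -> x = 0) -> injective f.
Proof.
move=> h x y e; apply/eqP; rewrite -subr_eq0; apply/eqP/h.
by rewrite linearB /= e subrr.
Qed.

Lemma bij_linear_inv (A : pzRingType) (M N : lmodType A) (f : {linear M -> N}) :
  bijective f -> exists g : {linear N -> M}, cancel f g /\ cancel g f.
Proof.
case=> g fK gK; suff lg : linear g by exists (mklin lg).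
by move=> c x y; apply: (can_inj fK); rewrite linearP !gK.
Qed.

Lemma inj_surj_bij (M N : Type) (f : M -> N) :
  injective f -> (forall y, exists x, f x = y) -> bijective f.
Proof. by move=> inj /choice[g hg]; exists g => // x; apply: inj; rewrite hg. Qed.

Lemma mod_isoE (M N : rmodType R) : mod_iso M N <->
  exists (f : {linear M -> N}) (g : {linear N -> M}), cancel f g /\ cancel g f.
Proof.
split=> [[f /bij_linear_inv[g ?]]|[f [g [? ?]]]]; first by exists f, g.
by exists f; exists g.
Qed.

Lemma mod_iso_refl (M : rmodType R) : mod_iso M M.
Proof. by exists idfun; exists idfun. Qed.

Lemma mod_iso_sym (M N : rmodType R) : mod_iso M N -> mod_iso N M.
Proof. by move=> /mod_isoE[f [g [? ?]]]; apply/mod_isoE; exists g, f. Qed.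

Lemma mod_iso_trans (M N K : rmodType R) : mod_iso M N -> mod_iso N K -> mod_iso M K.
Proof. by move=> [f hf] [g hg]; exists (g \o f); apply: bij_comp. Qed.

Lemma pair_linear (A : pzRingType) (Z M N : lmodType A) (f : {linear Z -> M}) (g : {linear Z -> N}) :
  linear (fun z => (f z, g z)).
Proof. by move=> c x y; rewrite !linearP. Qed.
Definition pairm (A : pzRingType) (Z M N : lmodType A) (f : {linear Z -> M}) (g : {linear Z -> N})
  : {linear Z -> (M * N)%type} := mklin (pair_linear f g).

Lemma copair_linear (A : pzRingType) (Z M N : lmodType A) (f : {linear M -> Z}) (g : {linear N -> Z}) :
  linear (fun u : (M * N)%type => f u.1 + g u.2).
Proof. by move=> c x y; rewrite /= !linearP addrACA scalerDr. Qed.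
Definition copairm (A : pzRingType) (Z M N : lmodType A) (f : {linear M -> Z}) (g : {linear N -> Z})
  : {linear (M * N)%type -> Z} := mklin (copair_linear f g).

Definition retract (X M : rmodType R) : Prop :=
  exists (s : {linear X -> M}) (r : {linear M -> X}), forall x, r (s x) = x.

Lemma iso_retract (M N : rmodType R) : mod_iso M N -> retract M N.
Proof. by move=> /mod_isoE[f [g [h _]]]; exists f, g. Qed.

Lemma retract_trans (X Y Z : rmodType R) : retract X Y -> retract Y Z -> retract X Z.
Proof.
move=> [s [r h]] [s' [r' h']]; exists (s' \o s), (r \o r') => x /=.
by rewrite h' h.
Qed.

Lemma retract_fst (X Y : rmodType R) : retract X (X * Y)%type.
Proof. by exists (pairm idfun \0), fst. Qed.

Lemma submodule_ker (M N : rmodType R) (f : {linear M -> N}) :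
  submodule (fun x => f x = 0).
Proof.
by split=> [|c x y e e']; rewrite ?linear0 // linearP e e' scaler0 addr0.
Qed.

Lemma submodule_im (M N : rmodType R) (f : {linear M -> N}) :
  submodule (fun y => exists x, f x = y).
Proof.
split=> [|c _ _ [x <-] [y <-]]; first by exists 0; rewrite linear0.
by exists (c *: x + y); rewrite linearP.
Qed.

Lemma coker_ex M N (f : {linear M -> N}) :
  exists (L : modR) (p : {linear N -> L}), is_cokernel f p.
Proof. by have [L [p [? ?]]] := quot_ex (submodule_im f); exists L, p. Qed.

Lemma ses_pi (L M N : rmodType R) (f : {linear L -> M}) (g : {linear M -> N}) :
  short_exact f g -> forall x, g (f x) = 0.
Proof. by case=> _ h _ x; apply/h; exists x. Qed.

Lemma ses_prod (M N : rmodType R) :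
  short_exact (pairm idfun \0 : {linear M -> (M * N)%type}) snd.
Proof.
split=> [x y [] //| [x y] /= | z].
  by split=> [->|[z [_ <-]] //]; exists x.
by exists (0, z).
Qed.

Lemma ses_retraction (L M N : rmodType R) (f : {linear L -> M}) (g : {linear M -> N}) :
  short_exact f g -> (exists s : {linear N -> M}, forall z, g (s z) = z) ->
  exists r : {linear M -> L}, forall y, r (f y) = y.
Proof.
move=> ses [s hs]; have [inj h _] := ses.
have [r hr] : exists r : {linear M -> L}, forall x, f (r x) = (idfun \- (s \o g)) x.
  by apply: factor_mono => // x; apply/h; rewrite /= linearB /= hs subrr.
by exists r => y; apply: inj; rewrite hr /= (ses_pi ses) linear0 subr0.
Qed.

Lemma ses_section (L M N : rmodType R) (f : {linear L -> M}) (g : {linear M -> N}) :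
  short_exact f g -> (exists r : {linear M -> L}, forall y, r (f y) = y) ->
  exists s : {linear N -> M}, forall z, g (s z) = z.
Proof.
move=> ses [r hr]; have [inj h sg] := ses.
have [s hs] : exists s : {linear N -> M}, forall x, s (g x) = (idfun \- (f \o r)) x.
  by apply: factor_epi => // x /h[y <-] /=; rewrite hr subrr.
exists s => z; have [x <-] := sg z; rewrite hs /= linearB /=.
by rewrite (ses_pi ses) subr0.
Qed.

Lemma ses_split_iso (L M N : rmodType R) (f : {linear L -> M}) (g : {linear M -> N}) :
  short_exact f g -> (exists r : {linear M -> L}, forall y, r (f y) = y) ->
  mod_iso M (L * N)%type.
Proof.
move=> ses [r hr]; have [inj h sg] := ses; exists (pairm r g); apply: inj_surj_bij.
  apply: linear_eq0_inj => x [rx /h[y yx]].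
  by move: rx; rewrite -yx hr => ->; rewrite linear0.
case=> y z; have [s hs] := ses_section ses (ex_intro _ r hr).
exists (f y + (s z - f (r (s z)))) => /=.
by rewrite !linearD !linearN /= !hr subrr addr0 !(ses_pi ses) hs add0r subr0.
Qed.
End Maps.

(** Phrased through embeddings so that kernels, images and pullbacks can be taken inside [fgmod]. *)
Definition noetherian (R : pzRingType) : Prop :=
  forall (M : fgmod R) (S : M -> Prop), submodule S ->
  exists (K : fgmod R) (i : {linear K -> M}),
    injective i /\ forall x, S x <-> exists z, i z = x.

(** * Pullbacks, pushouts and vanishing of Ext^1 *)

Section Ext.
Variable R : pzRingType.
Local Notation modR := (fgmod R).
Implicit Types (M N K L X Y Z E : modR).
Hypothesis noeth : noetherian R.

Lemma ker_ex M N (f : {linear M -> N}) :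
  exists (K : modR) (i : {linear K -> M}), is_kernel f i.
Proof. by have [K [i ?]] := noeth (submodule_ker f); exists K, i. Qed.

Lemma im_ex M N (f : {linear M -> N}) :
  exists (I : modR) (i : {linear I -> N}) (p : {linear M -> I}),
    [/\ is_image f i, forall x, i (p x) = f x & forall z, exists x, p x = z].
Proof.
have [I [i [inj h]]] := noeth (submodule_im f).
have [x|p hp] := factor_mono inj (_ : forall x, exists z, i z = f x).
  by apply/h; exists x.
exists I, i, p; split=> // z.
have [x e] : exists x, f x = i z by apply/h; exists z.
by exists x; apply: inj; rewrite hp.
Qed.

Lemma epi_ses M N (p : {linear M -> N}) : (forall z, exists x, p x = z) ->
  exists (K : modR) (i : {linear K -> M}), short_exact i p.
Proof. by move=> sp; have [K [i [? ?]]] := ker_ex p; exists K, i. Qed.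

Lemma mono_ses M N (i : {linear M -> N}) : injective i ->
  exists (L : modR) (p : {linear N -> L}), short_exact i p.
Proof. by move=> inj; have [L [p [? ?]]] := coker_ex i; exists L, p. Qed.

Lemma retract_split X M : retract X M -> exists Y, mod_iso M (X * Y)%type.
Proof.
move=> [s [r rs]]; have inj : injective s by apply: can_inj rs.
have [Y [p ses]] := mono_ses inj; exists Y; apply: ses_split_iso ses _.
by exists r.
Qed.

Lemma Ext1_zeroP X Y : Ext1_zero X Y <->
  forall E (i : {linear Y -> E}) (p : {linear E -> X}),
    short_exact i p -> exists r : {linear E -> Y}, forall y, r (i y) = y.
Proof.
split=> h E i p ses; last first.
  have [r hr] := h E i p ses.
  by exists (pairm r p); split=> // y /=; rewrite hr (ses_pi ses).
by have [phi [h1 h2]] := h E i p ses; exists (fst \o phi) => y /=; rewrite h1.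
Qed.

(** The pullback of [p] along [g] is an extension of X by K. It splits, and a section followed by
    the projection to E is the lift. *)
Lemma Ext1_lift X K E Z (i : {linear K -> E}) (p : {linear E -> Z}) (g : {linear X -> Z}) :
  Ext1_zero X K -> short_exact i p ->
  exists h : {linear X -> E}, forall x, p (h x) = g x.
Proof.
move=> /Ext1_zeroP ext ses; have [inj hp sp] := ses.
have [P [j [ji hj]]] := noeth (submodule_ker (copairm p (\- g) : {linear prodm E X -> Z})).
have hP u : p (j u).1 = g (j u).2.
  by apply/eqP; rewrite -subr_eq0; apply/eqP/(hj (j u)); exists u.
have [k hk] : exists k : {linear K -> P}, forall y, j (k y) = (pairm i \0 : {linear K -> prodm E X}) y.
  by apply: factor_mono => // y; apply/hj; rewrite /= (ses_pi ses) linear0 oppr0 addr0.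
have sesP : short_exact k (snd \o j).
  split=> [y y' e|u|x].
  - by apply: inj; have := congr1 (fst \o j) e; rewrite /= !hk.
  - split=> [e|[y <-]]; last by rewrite /= hk.
    have /hp[y hy] : p (j u).1 = 0 by rewrite hP (e : (j u).2 = 0) linear0.
    exists y; apply: ji; rewrite hk /= hy [RHS]surjective_pairing.
    by rewrite (e : (j u).2 = 0).
  - have [e he] := sp (g x).
    have [u hu] : exists u, j u = (e, x) by apply/hj; rewrite /= he subrr.
    by exists u; rewrite /= hu.
have [s hs] := ses_section sesP (ext _ _ _ sesP).
by exists (fst \o (j \o s)) => x; rewrite /= hP (hs x : (j (s x)).2 = x).
Qed.

(** E is the quotient of B (+) A by the elements (g x, - i x). The last two clauses, on generation
    of E and on the kernel of [l], serve the wide hull. *)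
Lemma pushout_ex (X A Z B : modR) (i : {linear X -> A}) (p : {linear A -> Z}) (g : {linear X -> B}) :
  short_exact i p -> exists (E : modR) (k : {linear B -> E}) (l : {linear A -> E})
    (r : {linear E -> Z}),
  [/\ short_exact k r, forall a, r (l a) = p a, forall x, l (i x) = k (g x),
      forall e, exists b a, e = k b + l a
    & forall a, l a = 0 -> exists x, i x = a /\ g x = 0].
Proof.
move=> ses; have [inj hp sp] := ses.
have [Q [q [sq hq]]] := quot_ex (submodule_im (pairm g (\- i) : {linear X -> prodm B A})).
have [r hr] : exists r : {linear Q -> Z}, forall u, r (q u) = (p \o snd : {linear prodm B A -> Z}) u.
  by apply: factor_epi => // u /hq[x <-] /=; rewrite linearN /= (ses_pi ses) oppr0.
have qi x : q (0, i x) = q (g x, 0).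
  apply/esym/eqP; rewrite -subr_eq0 -linearB; apply/eqP/hq; exists x => /=.
  by congr pair; rewrite ?subr0 ?sub0r.
have qD b a : q (b, a) = q (b, 0) + q (0, a).
  by rewrite -linearD; congr (q (_, _)); rewrite ?addr0 ?add0r.
exists Q, (q \o (pairm idfun \0 : {linear B -> prodm B A})),
  (q \o (pairm \0 idfun : {linear A -> prodm B A})), r; split=> [|a /=|x /=|e|a]; rewrite ?hr ?qi //.
- split=> [|u|z].
  + apply: linear_eq0_inj => y /hq[x [e1 e2]]; rewrite -e1.
    have -> : x = 0; last by rewrite linear0.
    by apply: inj; apply/eqP; rewrite linear0 -oppr_eq0; apply/eqP.
  + have [[y e] <-] := sq u; split=> [|[y' <-]]; last by rewrite /= hr /= linear0.
    rewrite hr /= => /hp[x <-]; exists (y + g x); rewrite [RHS]qD qi -linearD.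
    by congr (q (_, _)); rewrite addr0.
  + by have [e <-] := sp z; exists (q (0, e)); rewrite hr.
- by have [[b a] <-] := sq e; exists b, a; apply: qD.
- by move=> /hq[x [gx ix]]; exists (- x); rewrite !linearN gx oppr0.
Qed.

Lemma Ext1_extend Z Y X E (i : {linear X -> E}) (p : {linear E -> Z}) (g : {linear X -> Y}) :
  Ext1_zero Z Y -> short_exact i p ->
  exists h : {linear E -> Y}, forall x, h (i x) = g x.
Proof.
move=> /Ext1_zeroP ext /(pushout_ex g)[Q [k [l [r [ses _ li _ _]]]]].
by have [h hh] := ext _ _ _ ses; exists (h \o l) => x; rewrite /= li hh.
Qed.

Lemma Ext1_zero_retractl X X' Y : retract X' X -> Ext1_zero X Y -> Ext1_zero X' Y.
Proof.
move=> [s [r rs]] ext; apply/Ext1_zeroP => E i p ses; apply: (ses_retraction ses).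
have [h hh] := Ext1_lift r ext ses; exists (h \o s) => x; by rewrite /= hh rs.
Qed.

(** Extend each [s j] across the extension and add up. Only a decomposition of the identity is asked
    for, so this lemma and its dual serve both biproducts and summands of powers. *)
Lemma Ext1_zero_sumr X Y n (F : 'I_n -> modR)
    (s : forall i, {linear Y -> F i}) (r : forall i, {linear F i -> Y}) :
  (forall y, \sum_i r i (s i y) = y) ->
  (forall i, Ext1_zero X (F i)) -> Ext1_zero X Y.
Proof.
move=> rs ext; apply/Ext1_zeroP => E i p ses.
have /choice[h hh] : forall j, exists h : {linear E -> Y}, forall y, h (i y) = r j (s j y).
  move=> j; have [h hh] := Ext1_extend (s j) (ext j) ses.
  by exists (r j \o h) => y /=; rewrite hh.
have lh : linear (fun e => \sum_j h j e).
  move=> c x y; rewrite scaler_sumr -big_split; apply: eq_bigr => j _.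
  by rewrite linearP.
by exists (mklin lh) => y /=; rewrite -[RHS]rs; apply: eq_bigr => j _; apply: hh.
Qed.

Lemma Ext1_zero_suml X Y n (F : 'I_n -> modR)
    (s : forall i, {linear X -> F i}) (r : forall i, {linear F i -> X}) :
  (forall y, \sum_i r i (s i y) = y) ->
  (forall i, Ext1_zero (F i) Y) -> Ext1_zero X Y.
Proof.
move=> rs ext; apply/Ext1_zeroP => E i p ses; apply: (ses_retraction ses).
have /choice[h hh] : forall j, exists h : {linear X -> E}, forall y, p (h y) = r j (s j y).
  move=> j; have [h hh] := Ext1_lift (r j) (ext j) ses.
  by exists (h \o s j) => y /=; rewrite hh.
have lh : linear (fun e => \sum_j h j e).
  move=> c x y; rewrite scaler_sumr -big_split; apply: eq_bigr => j _.
  by rewrite linearP.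
by exists (mklin lh) => y /=; rewrite linear_sum -[RHS]rs; apply: eq_bigr => j _; apply: hh.
Qed.

End Ext.

(** * Additive closures and cokernels over hereditary rings *)

(** Surjectivity of Ext^1(C, V) -> Ext^1(C, J) for V -> J onto: the given extension of C by J is the
    pushforward of one by V. *)
Definition extensions_lift (R : pzRingType) : Prop :=
  forall (V J N C : fgmod R) (i : {linear J -> N}) (p : {linear N -> C})
    (f : {linear V -> J}),
  short_exact i p -> (forall z, exists x, f x = z) ->
  exists (E : fgmod R) (j : {linear V -> E}) (q : {linear E -> N}),
    short_exact j (p \o q) /\ forall v, q (j v) = i (f v).

(** Surjectivity of Ext^1(X, Y) -> Ext^1(X', Y) for X' inside X: the given extension of X' is the
    restriction of one of X. *)
Definition extensions_extend (R : pzRingType) : Prop :=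
  forall (Y E' X' X : fgmod R) (i : {linear Y -> E'}) (p' : {linear E' -> X'})
    (m : {linear X' -> X}),
  short_exact i p' -> injective m ->
  exists (E : fgmod R) (j : {linear Y -> E}) (p : {linear E -> X}) (u : {linear E' -> E}),
    [/\ short_exact j p, forall y, u (i y) = j y & forall e, p (u e) = m (p' e)].

Section Add.
Variable R : pzRingType.
Local Notation modR := (fgmod R).
Implicit Types (M N K L X Y Z E U V : modR).
Hypothesis noeth : noetherian R.

Lemma eval_linear n U (i : 'I_n) : linear (fun f : ffunm n U => f i).
Proof. by move=> c f g; rewrite !ffunE. Qed.

Lemma tuple_linear n M U (s : 'I_n -> {linear M -> U}) :
  linear (fun x => [ffun i => s i x] : ffunm n U).
Proof. by move=> c x y; apply/ffunP => i; rewrite !ffunE linearP. Qed.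

Lemma cotuple_linear n M U (r : 'I_n -> {linear U -> M}) :
  linear (fun f : ffunm n U => \sum_i r i (f i)).
Proof.
move=> c x y; rewrite scaler_sumr -big_split /=; apply: eq_bigr => i _.
by rewrite !ffunE linearP.
Qed.

Lemma delta_linear n U (i : 'I_n) :
  linear (fun u => [ffun j => if j == i then u else 0] : ffunm n U).
Proof.
by move=> c x y; apply/ffunP => j; rewrite !ffunE; case: eqP; rewrite ?scaler0 ?addr0.
Qed.

(** The complement in [add_of] is traded for a decomposition of the identity; conversely the
    complement is recovered as the cokernel of a split injection. *)
Lemma add_ofP U M : add_of U M <->
  exists n (s : 'I_n -> {linear M -> U}) (r : 'I_n -> {linear U -> M}),
    forall x, \sum_i r i (s i x) = x.
Proof.
split=> [[n [N /mod_isoE[f [g [fK gK]]]]]|[n [s [r rs]]]].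
  exists n, (fun i => mklin (@eval_linear n U i) \o (g \o pairm idfun \0)).
  exists (fun i => fst \o (f \o mklin (@delta_linear n U i))) => x /=.
  rewrite -[RHS]/((x, 0 : N).1) -[in RHS](gK (x, 0)) /=.
  rewrite [in RHS](_ : g (x, 0) =
    \sum_i [ffun j => if j == i then g (x, 0) i else 0]).
    by rewrite !linear_sum.
  apply/ffunP => j; rewrite sum_ffunE (bigD1 j) //= ffunE eqxx big1 ?addr0 //.
  by move=> i nij; rewrite ffunE eq_sym (negbTE nij).
have [|N h] := @retract_split _ M (ffunm n U); last by exists n, N.
exists (mklin (tuple_linear s)), (mklin (cotuple_linear r)) => x /=.
by rewrite -[RHS]rs; apply: eq_bigr => i _; rewrite ffunE.
Qed.

Lemma add_of_retract U M M' : retract M' M -> add_of U M -> add_of U M'.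
Proof.
move=> [t [q qt]] /add_ofP[n [s [r rs]]]; apply/add_ofP.
exists n, (fun i => s i \o t), (fun i => q \o r i) => x /=.
by rewrite -linear_sum rs qt.
Qed.

Lemma add_of_trans U M N : add_of U M -> add_of M N -> add_of U N.
Proof.
move=> /add_ofP[n [s [r rs]]] /add_ofP[m [t [q qt]]]; apply/add_ofP.
exists #|{: 'I_m * 'I_n}|, (fun i => s (enum_val i).2 \o t (enum_val i).1),
  (fun i => q (enum_val i).1 \o r (enum_val i).2) => x /=.
rewrite -(big_enum_val (fun i => q i.1 (r i.2 (s i.2 (t i.1 x))))) /=.
rewrite -(pair_bigA _ (fun i j => q i (r j (s j (t i x))))) /= -[RHS]qt.
by apply: eq_bigr => i _; rewrite -linear_sum rs.
Qed.

Lemma add_of_self U : add_of U U.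
Proof.
by apply/add_ofP; exists 1, (fun=> idfun), (fun=> idfun) => x; rewrite big_ord1.
Qed.

Lemma add_of_prod U M N : add_of U M -> add_of U N -> add_of U (prodm M N).
Proof.
move=> /add_ofP[n [s [r rs]]] /add_ofP[m [t [q qt]]]; apply/add_ofP.
pose s' (i : 'I_n + 'I_m) : {linear prodm M N -> U} :=
  match i with inl i => s i \o fst | inr j => t j \o snd end.
pose r' (i : 'I_n + 'I_m) : {linear U -> prodm M N} :=
  match i with inl i => pairm (r i) \0 | inr j => pairm \0 (q j) end.
exists (n + m)%N, (s' \o split), (r' \o split) => u /=.
have e1 i : split (lshift m i) = inl i :> 'I_n + 'I_m := unsplitK (inl i).
have e2 i : split (rshift n i) = inr i :> 'I_n + 'I_m := unsplitK (inr i).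
rewrite big_split_ord /=.
have -> : u = (pairm idfun \0 : {linear M -> prodm M N}) u.1
   + (pairm \0 idfun : {linear N -> prodm M N}) u.2.
  by case: u => a b /=; congr pair; rewrite /= ?addr0 ?add0r.
rewrite -[in RHS](rs u.1) -[in RHS](qt u.2) !linear_sum.
by congr (_ + _); apply: eq_bigr => i _; rewrite ?e1 ?e2 /= ?addr0 ?add0r.
Qed.

Lemma add_of_zero U Z : zero_mod Z -> add_of U Z.
Proof.
move=> z; apply/add_ofP; exists 0, (fun=> \0), (fun=> \0) => x.
by rewrite [RHS]z; apply: z.
Qed.

Lemma add_of_iso U U' M : mod_iso U U' -> add_of U M -> add_of U' M.
Proof.
by move=> h; apply: add_of_trans; apply: add_of_retract (iso_retract h) (add_of_self _).
Qed.

Lemma add_of_subcategory (C : modR -> Prop) U M : subcategory C ->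
  C U -> add_of U M -> C M.
Proof.
move=> [ciso c0 csum csub] cU [n [N h]]; apply: (csub _ N (ffunm n U)) h.
elim: n => [|n IH]; first by apply: c0 => f; apply/ffunP => -[].
apply: csum cU IH _; exists (pairm (mklin (@eval_linear n.+1 U ord0))
  (mklin (@tuple_linear n _ U (fun i => mklin (@eval_linear n.+1 U (lift ord0 i)))))).
apply: (@Bijective _ _ _ (fun u : prodm U (ffunm n U) =>
    [ffun i => if unlift ord0 i is Some j then u.2 j else u.1] : ffunm n.+1 U)) => [f|[u f]].
  apply/ffunP => i; rewrite !ffunE; case: unliftP => [j|] -> //=.
  by rewrite ffunE.
by rewrite /= ffunE unlift_none; congr pair; apply/ffunP => i; rewrite !ffunE liftK.
Qed.

Lemma Ext1_zero_add U V M N :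
  Ext1_zero U V -> add_of U M -> add_of V N -> Ext1_zero M N.
Proof.
move=> ext /add_ofP[n [s [r rs]]] /add_ofP[m [t [q qt]]].
by apply: (Ext1_zero_suml noeth rs) => i; apply: (Ext1_zero_sumr qt) => j.
Qed.
End Add.

Section Hereditary.
Variable R : pzRingType.
Local Notation modR := (fgmod R).
Implicit Types (M N K L X Y Z E U V I : modR).
Hypothesis noeth : noetherian R.
Hypothesis ext_lift : extensions_lift R.
Hypothesis ext_extend : extensions_extend R.

Lemma Ext1_zero_epi X Y Y' (f : {linear Y -> Y'}) :
  (forall z, exists y, f y = z) -> Ext1_zero X Y -> Ext1_zero X Y'.
Proof.
move=> sf /Ext1_zeroP ext; apply/Ext1_zeroP => E i p ses; apply: (ses_retraction ses).
have [F [j [q [sesF _]]]] := ext_lift ses sf.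
have [s hs] := ses_section sesF (ext _ _ _ sesF).
by exists (q \o s).
Qed.

Lemma Ext1_zero_mono X X' Y (m : {linear X' -> X}) :
  injective m -> Ext1_zero X Y -> Ext1_zero X' Y.
Proof.
move=> im /Ext1_zeroP ext; apply/Ext1_zeroP => E i p ses.
have [F [j [q [u [sesF h1 h2]]]]] := ext_extend ses im.
have [r hr] := ext _ _ _ sesF.
by exists (r \o u) => y /=; rewrite h1 hr.
Qed.

(* The sequence 0 -> V -> I + E -> N -> 0 obtained by lifting the extension 0 -> I -> N -> N/I -> 0
   along f splits, since Ext^1(N, V) = 0. *)
Lemma image_add U V N I (f : {linear V -> I}) (i : {linear I -> N}) :
  rigid U -> add_of U V -> add_of U N -> injective i ->
  (forall z, exists x, f x = z) -> add_of U I.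
Proof.
move=> rU aV aN inj sf; have [C [p ses]] := mono_ses inj.
have [E [j [q [[injj hq sq] qj]]]] := ext_lift ses sf.
have sesIE : short_exact (pairm f j : {linear V -> prodm I E}) (copairm i (\- q)).
  split=> [||z].
  - by apply: linear_eq0_inj => x [_ jx]; apply: injj; rewrite jx linear0.
  - case=> x e; split=> [/=|[v [<- <-]]]; last by rewrite /= qj subrr.
    move/eqP; rewrite subr_eq0 => /eqP ixe.
    have /hq[v ve] : (p \o q) e = 0 by rewrite /= -ixe (ses_pi ses).
    exists v; rewrite ve; congr pair; apply: inj.
    by rewrite ixe -ve qj.
  - have [e he] := sq (p z); have [_ hp _] := ses.
    have /hp[x hx] : p (z - q e) = 0 by rewrite linearB /= -he subrr.
    by exists (x, - e); rewrite /= linearN opprK hx subrK.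
have ext : Ext1_zero N V by apply: Ext1_zero_add aN aV.
have h := ses_split_iso sesIE ((Ext1_zeroP _ _).1 ext _ _ _ sesIE).
apply: add_of_retract (add_of_prod aV aN) => //.
apply: retract_trans (iso_retract h).
exact: retract_fst.
Qed.

(** * Cokernels of maps between summands of powers of a rigid module *)

Section Cok.
Variable U : modR.
Hypothesis rU : rigid U.

Lemma cok_Ext1_zero X Y : cok U Y -> add_of U X -> Ext1_zero X Y.
Proof.
move=> [M [N [f [p [aM aN [sp _]]]]]] aX; apply: (Ext1_zero_epi sp).
exact: Ext1_zero_add aX aN.
Qed.

(** The kernel of [p] is a quotient of M, so right exactness gives Ext^1(V, ker p) = 0. Objects of
    add U thus behave like projectives relative to such presentations. *)
Lemma add_lift_cokernel V M N L (f : {linear M -> N}) (p : {linear N -> L})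
    (g : {linear V -> L}) :
  add_of U V -> add_of U M -> is_cokernel f p ->
  exists h : {linear V -> N}, forall x, p (h x) = g x.
Proof.
move=> aV aM [sp kp]; have [K [i sesK]] := epi_ses noeth sp.
have [injK hK _] := sesK.
have [t ht] : exists t : {linear M -> K}, forall x, i (t x) = f x.
  by apply: factor_mono => // x; apply/hK/kp; exists x.
apply: (fun e => Ext1_lift noeth g e sesK).
apply: (@Ext1_zero_epi _ _ _ t) (Ext1_zero_add noeth rU aV aM) => z.
have /kp[x hx] : p (i z) = 0 by rewrite (ses_pi sesK).
by exists x; apply: injK; rewrite ht.
Qed.

Lemma cok_ses X : cok U X <-> exists (V N : modR) (a : {linear V -> N}) (b : {linear N -> X}),
  [/\ add_of U V, add_of U N & short_exact a b].
Proof.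
split=> [[M [N [f [p [aM aN [sp kp]]]]]]|[V [N [a [b [aV aN [_ kb sb]]]]]]]; last first.
  by exists V, N, a, b; split.
have [I [i [q [[inj hi] iq sq]]]] := im_ex noeth f.
exists I, N, i, p; split=> //; first exact: image_add inj sq.
split=> // y; split=> [/kp/hi //|h]; by apply/kp/hi.
Qed.

Lemma cok_self_add X : add_of U X -> cok U X.
Proof.
move=> aX; have [Z z] := zero_mod_ex R.
exists Z, X, \0, idfun; split=> //; first exact: add_of_zero.
split=> [x|x]; first by exists x.
by split=> [e|[_ <-] //]; exists 0; apply: esym e.
Qed.

Lemma cok_iso X X' : mod_iso X X' -> cok U X -> cok U X'.
Proof.
move=> /mod_isoE[g [g' [gK g'K]]] [M [N [f [p [aM aN [sp kp]]]]]].
exists M, N, f, (g \o p); split=> //; split=> [z|y /=].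
  by have [y hy] := sp (g' z); exists y; rewrite /= hy g'K.
split=> [e|/kp ->]; last by rewrite linear0.
by apply/kp; rewrite -[LHS]gK e linear0.
Qed.

(** The horseshoe lemma. First [q] lifts to [q' : N0 -> E] since Ext^1(N0, X) = 0; the defect
    [q' \o g] lands in X and lifts to [h : N1 -> M0], the off-diagonal entry of the presentation of
    E. *)
Lemma cok_extension_closed : extension_closed (cok U).
Proof.
move=> X E Y a b ses cX; have := cX.
move=> [M1 [M0 [f [p [aM1 aM0 cp]]]]] [N1 [N0 [g [q [aN1 aN0 cq]]]]].
have [injA hb sb] := ses.
have [q' hq'] := Ext1_lift noeth q (cok_Ext1_zero cX aN0) ses.
have [t ht] : exists t : {linear N1 -> X}, forall x, a (t x) = (q' \o g) x.
  apply: factor_mono => // x; apply/hb; rewrite /= hq'.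
  by apply/(cq.2); exists x.
have [h hh] := add_lift_cokernel t aN1 aM1 cp.
exists (prodm M1 N1), (prodm M0 N0), (pairm (copairm f (\- h)) (g \o snd)),
  (copairm (a \o p) q'); split; [exact: add_of_prod | exact: add_of_prod |split].
  move=> e; have [n hn] := cq.1 (b e).
  have /hb[x hx] : b (e - q' n) = 0 by rewrite linearB /= hq' hn subrr.
  have [m hm] := cp.1 x; exists (m, n); rewrite /= hm hx subrK //.
case=> m n; split=> [/= e|[[m1 n1] [<- <-]]] /=.
  have /(cq.2)[n1 hn1] : q n = 0.
    by have := congr1 b e; rewrite linearD /= (ses_pi ses) add0r hq' linear0.
  have /(cp.2)[m1 hm1] : p (m + h n1) = 0.
    by apply: injA; rewrite linearD /= hh linearD ht /= hn1 e linear0.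
  by exists (m1, n1); rewrite /= hm1 addrK hn1.
rewrite linearB /= hh linearB /= ht /= subrK.
suff -> : p (f m1) = 0 by rewrite linear0.
by apply/(cp.2); exists m1.
Qed.

Lemma cok_map X Y (f : {linear X -> Y}) : cok U X -> cok U Y ->
  exists (M0 N1 N0 : modR) (p : {linear M0 -> X}) (g : {linear N1 -> N0})
    (q : {linear N0 -> Y}) (h : {linear M0 -> N0}),
  [/\ [/\ add_of U M0, add_of U N1 & add_of U N0], forall z, exists x, p x = z,
      is_cokernel g q & forall x, q (h x) = f (p x)].
Proof.
move=> [M1 [M0 [e [p [aM1 aM0 cp]]]]] [N1 [N0 [g [q [aN1 aN0 cq]]]]].
have [h hh] := add_lift_cokernel (f \o p) aM0 aN1 cq.
by exists M0, N1, N0, p, g, q, h; split=> //; apply: cp.1.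
Qed.

(** Lift [f] to [h : M0 -> N0]. The image J of M0 (+) N1 in N0 lies in add U by [image_add] and maps
    onto I; the kernel of J -> I is the image of N1, which yields the presentation. *)
Lemma cok_image_closed : image_closed (cok U).
Proof.
move=> X Y I f i cX cY [inj hi].
have [M0 [N1 [N0 [p [g [q [h [[aM0 aN1 aN0] sp cq hh]]]]]]]] := cok_map f cX cY.
have [J [j [r [[injj hj] jr sr]]]] := im_ex noeth (copairm h g : {linear prodm M0 N1 -> N0}).
have aJ : add_of U J by apply: image_add injj sr => //; apply: add_of_prod.
have qg n : q (g n) = 0 by apply/(cq.2); exists n.
have [k hk] : exists k : {linear J -> I}, forall x, i (k x) = (q \o j) x.
  apply: factor_mono => // x; apply/hi; have [[m n] <-] := sr x.
  by exists (p m); rewrite /= jr /= linearD /= qg addr0 hh.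
have [g' hg'] : exists g' : {linear N1 -> J}, forall x, j (g' x) = g x.
  by apply: factor_mono => // x; apply/hj; exists (0, x); rewrite /= linear0 add0r.
exists N1, J, g', k; split=> //; split=> [z|x].
  have [x hx] := (hi (i z)).2 (ex_intro _ z erefl).
  have [m hm] := sp x.
  have /hj[x' hx'] : exists u, copairm h g u = h m.
    by exists (m, 0); rewrite /= linear0 addr0.
  by exists x'; apply: inj; rewrite hk /= hx' hh hm.
split=> [e|[n <-]].
  have /(cq.2)[n hn] : q (j x) = 0 by rewrite -[LHS]hk e linear0.
  by exists n; apply: injj; rewrite hg'.
by apply: inj; rewrite hk /= hg' qg linear0.
Qed.

Lemma cok_cokernel_closed : cokernel_closed (cok U).
Proof.
move=> X Y L f c cX cY [sc kc].
have [M0 [N1 [N0 [p [g [q [h [[aM0 aN1 aN0] sp cq hh]]]]]]]] := cok_map f cX cY.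
exists (prodm M0 N1), N0, (copairm h g), (c \o q); split=> //; first exact: add_of_prod.
split=> [z|y /=].
  by have [y <-] := sc z; have [x <-] := cq.1 y; exists x.
split=> [/kc[x]|[[m n] <-]] /=.
  have [m <-] := sp x; rewrite -hh => e.
  have /(cq.2)[n hn] : q (y - h m) = 0 by rewrite linearB /= e subrr.
  by exists (m, n); rewrite /= hn addrC subrK.
apply/kc; exists (p m); rewrite linearD hh.
suff -> : q (g n) = 0 by rewrite addr0.
by apply/(cq.2); exists n.
Qed.

(** Sums are split extensions. Up to isomorphism, a direct summand is the kernel of one idempotent
    of M (+) N and the image of the complementary one, so either closure property gives summands. *)
Lemma subcategory_intro (C : modR -> Prop) :
  (forall M N, mod_iso M N -> C M -> C N) -> (forall Z : modR, zero_mod Z -> C Z) ->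
  extension_closed C -> (kernel_closed C \/ image_closed C) -> subcategory C.
Proof.
move=> ciso c0 cext cker; split=> // M N S.
  move=> cM cN h; apply: (ciso (prodm M N) S (mod_iso_sym h)).
  exact: (@cext _ (prodm M N) _ _ _ (@ses_prod _ M N)).
move=> cS /mod_isoE[f [g [fK gK]]].
case: cker => cker.
- apply: (cker _ _ _ (pairm \0 idfun \o (snd \o f) : {linear S -> prodm M N}) (g \o pairm idfun \0)) => //.
    by apply: ciso cS; apply/mod_isoE; exists f, g.
  split=> [x y /(can_inj gK)[] //|x /=].
  split=> [[e]|[m <-]]; last by rewrite gK.
  exists (f x).1; apply: (can_inj fK); rewrite gK [RHS]surjective_pairing; congr pair.
  by rewrite e.
- apply: (cker _ _ _ (g \o (pairm idfun \0 \o (fst \o f))) (g \o pairm idfun \0) cS cS).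
  split=> [x y /(can_inj gK)[] //|y]; split=> [[x <-]|[m <-]].
    by exists (f x).1.
  by exists (g (m, 0)); rewrite /= gK.
Qed.

Lemma cok_ice_closed : ice_closed (cok U).
Proof.
split; [|exact: cok_image_closed|exact: cok_cokernel_closed|exact: cok_extension_closed].
apply: subcategory_intro; [exact: cok_iso| |exact: cok_extension_closed|right; exact: cok_image_closed].
by move=> Z z; apply/cok_self_add/add_of_zero.
Qed.

(** An Ext-projective object of cok U splits its own resolution 0 -> V -> N -> M -> 0, because V is
    in cok U; hence it is a summand of N. *)
Lemma cok_progenerator : ext_progenerator (cok U) U.
Proof.
have proj M : add_of U M -> ext_projective (cok U) M.
  move=> aM; split=> [|Y cY]; first exact: cok_self_add.
  exact: cok_Ext1_zero.
split=> [|M|X /cok_ses[V [N [a [b [aV aN ses]]]]]].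
- exact/cok_self_add/add_of_self.
- split=> [/proj //|[/cok_ses[V [N [a [b [aV aN ses]]]]] ext]].
  have [s hs] := ses_section ses ((Ext1_zeroP _ _).1 (ext _ (cok_self_add aV)) _ _ _ ses).
  by apply: add_of_retract aN; exists s, b.
- by exists V, N, a, b; split; [exact: cok_self_add|exact: proj|].
Qed.
End Cok.

Lemma progenerator_rigid (C : modR -> Prop) P : ext_progenerator C P -> rigid P.
Proof.
by move=> [cP h _]; have [_ ext] := (h P).1 (add_of_self P); apply: ext.
Qed.

(** Resolving X, and then the kernel of that resolution, presents X as a cokernel between two
    Ext-projectives. *)
Lemma progenerator_cok (C : modR -> Prop) P : ice_closed C -> ext_progenerator C P ->
  forall X, C X <-> cok P X.
Proof.
move=> [sC _ ccok _] [cP h enough] X; split.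
  move=> cX; have [Y [M [f [g [cY pM [_ hg sg]]]]]] := enough _ cX.
  have [Y' [M' [f' [g' [cY' pM' [_ hg' sg']]]]]] := enough _ cY.
  exists M', M, (f \o g'), g; split; [exact/h|exact/h|split=> // y].
  split=> [/hg[z <-]|[x <-]]; last by apply/hg; exists (g' x).
  by have [x <-] := sg' z; exists x.
move=> [M [N [f [p [aM aN cp]]]]].
by apply: ccok cp; apply: add_of_subcategory sC cP _.
Qed.
End Hereditary.

(** * ICE-closed subcategories and wide subcategories *)

Section Wide.
Variable R : pzRingType.
Local Notation modR := (fgmod R).
Implicit Types (M N K L X Y Z E U V I : modR).
Hypothesis noeth : noetherian R.

Lemma wide_image_closed (W : modR -> Prop) : wide W -> image_closed W.
Proof.
move=> [sW kW cW eW] M N I f i WM WN im; have [L [p cp]] := coker_ex f.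
have [inj hi] := im; have [sp kp] := cp.
apply: (kW _ _ _ p i WN (cW _ _ _ _ _ WM WN cp)); split=> // y.
by split=> [/kp/hi|/hi/kp].
Qed.

Lemma epi_in_surj (W : modR -> Prop) M N (g : {linear M -> N}) :
  wide W -> W M -> W N -> epi_in W g -> forall z, exists y, g y = z.
Proof.
move=> [_ _ cW _] WM WN epi; have [L [p cp]] := coker_ex g.
move=> z; apply/(cp.2); apply: (epi _ (cW _ _ _ _ _ WM WN cp) p \0) => x.
by apply/(cp.2); exists x.
Qed.

(** The actual kernels and cokernels of maps in W belong to W and may serve as test objects, so
    internal exactness agrees with exactness of modules. *)
Lemma short_exact_inP (W : modR -> Prop) L M N (f : {linear L -> M}) (g : {linear M -> N}) :
  wide W -> W L -> W M -> W N -> short_exact_in W f g -> short_exact f g.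
Proof.
move=> [sW kW cW _] WL WM WN [[gf uk] [_ uc]].
have hk y : g y = 0 <-> exists x, f x = y.
  split=> [e|[x <-] //].
  have [K [i ki]] := ker_ex noeth g; have [inji hi] := ki.
  have [|v [hv _]] := uk K (kW _ _ _ _ _ WM WN ki) i.
    by move=> z; apply/hi; exists z.
  by have /hi[z <-] := e; exists (v z).
split=> //.
  have [K [i ki]] := ker_ex noeth f; have [inji hi] := ki.
  have [|v [_ hv]] := uk K (kW _ _ _ _ _ WL WM ki) \0; first by move=> z /=; rewrite linear0.
  apply: linear_eq0_inj => x /hi[z <-].
  have -> : i z = v z by apply: hv => t /=; apply/hi; exists t.
  by rewrite -[LHS]/(v z) -[RHS]/((\0 : {linear K -> L}) z) (hv \0) // => t /=; rewrite linear0.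
have [L' [p cp]] := coker_ex g.
have [|v [_ hv]] := uc L' (cW _ _ _ _ _ WM WN cp) \0; first by [].
move=> z; apply/(cp.2); rewrite (hv p) => [|y]; last by apply/(cp.2); exists y.
by rewrite -(hv \0).
Qed.

Lemma short_exact_short_exact_in (W : modR -> Prop) L M N
    (f : {linear L -> M}) (g : {linear M -> N}) :
  short_exact f g -> short_exact_in W f g.
Proof.
move=> ses; have [inj h sg] := ses; split; split; do ?exact: ses_pi.
- move=> Z _ u gu; have [|v hv] := factor_mono (f := u) inj; first by move=> z; apply/h.
  by exists v; split=> // v' hv' z; apply: inj; rewrite hv.
- move=> Z _ u uf; have [|v hv] := factor_epi (f := u) sg; first by move=> x /h[y <-].
  by exists v; split=> // v' hv' z; have [y <-] := sg z; rewrite hv.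
Qed.

(** The image of [f] lies in W, being the kernel of a cokernel, and it is a quotient of M, so it
    belongs to T. *)
Lemma torsion_class_ice_closed (W T : modR -> Prop) :
  wide W -> torsion_class_in W T -> ice_closed T.
Proof.
move=> wW [sT TW Tq Text]; have [sW kW cW eW] := wW.
have Tquot M N (g : {linear M -> N}) : T M -> W N -> (forall z, exists y, g y = z) -> T N.
  move=> TM WN sg; apply: (Tq _ _ g) => // Z _ u v e z.
  by have [y <-] := sg z.
split=> //.
- move=> M N I f i TM TN im; have [inj hi] := im.
  have [g hg] : exists g : {linear M -> I}, forall x, i (g x) = f x.
    by apply: factor_mono => // x; apply/hi; exists x.
  apply: (Tquot _ _ g TM (wide_image_closed wW (TW _ TM) (TW _ TN) im)) => z.
  have [x hx] := (hi (i z)).2 (ex_intro _ z erefl).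
  by exists x; apply: inj; rewrite hg.
- move=> M N L f p TM TN cp.
  exact: (Tquot _ _ p TN (cW _ _ _ _ _ (TW _ TM) (TW _ TN) cp) cp.1).
- move=> L M N f g ses TL TN.
  apply: (Text _ _ _ f g TL _ TN); last exact: short_exact_short_exact_in.
  exact: eW ses (TW _ TL) (TW _ TN).
Qed.

(** * The wide subcategory generated by an ICE-closed subcategory *)

Section WideHull.
Hypothesis ext_extend : extensions_extend R.
Variable C : modR -> Prop.
Hypothesis iceC : ice_closed C.

(** Every wide subcategory containing C contains these kernels. Kernels of arbitrary maps in C are
    among them, since C contains the image of the map. *)
Definition wide_hull X : Prop :=
  exists (C0 C1 : modR) (a : {linear X -> C0}) (b : {linear C0 -> C1}),
    [/\ C C0, C C1 & short_exact a b].

Let sC : subcategory C. Proof. by case: iceC. Qed.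
Let imC : image_closed C. Proof. by case: iceC. Qed.
Let cokC : cokernel_closed C. Proof. by case: iceC. Qed.
Let extC : extension_closed C. Proof. by case: iceC. Qed.

Lemma wide_hull_sub X : C X -> wide_hull X.
Proof.
move=> cX; have [Z z] := zero_mod_ex R; exists X, Z, idfun, \0.
split=> //; first by case: sC => _ c0 _ _; apply: c0.
split=> // [y|y]; first by split=> [_|_ //]; exists y.
by exists 0; rewrite [RHS]z.
Qed.

Lemma wide_hull_ker M N K (f : {linear M -> N}) (i : {linear K -> M}) :
  C M -> C N -> is_kernel f i -> wide_hull K.
Proof.
move=> cM cN [inj hi]; have [I [j [p [im jp sp]]]] := im_ex noeth f.
exists M, I, i, p; split=> //; first exact: imC im.
split=> // y; rewrite -(hi y) -jp; split=> [->|e]; first by rewrite linear0.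
by apply: im.1; rewrite e linear0.
Qed.

(** Pushing X -> C0 out along X -> Y -> D0 gives E, an extension of C1 by D0 and hence in C. The
    kernel of C0 -> E is the image of ker f, so ker f is the kernel of a map in C. *)
Lemma wide_hull_kernel_closed : kernel_closed wide_hull.
Proof.
move=> X Y K f i [C0 [C1 [a [b [cC0 cC1 sesX]]]]] [D0 [D1 [a' [b' [cD0 cD1 sesY]]]]] [inj hi].
have [E [k [l [r [sesE rl li _ lk]]]]] := pushout_ex (a' \o f) sesX.
have cE : C E by apply: extC sesE _ _.
apply: (wide_hull_ker (f := l) (i := a \o i)) => //.
have [inja _ _] := sesX; have [inja' _ _] := sesY.
split=> [x y /inja/inj //|x]; split=> [/lk[y [<- e]]|[z <-]].
  have /hi[z <-] : f y = 0 by apply: inja'; rewrite linear0.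
  by exists z.
have e : f (i z) = 0 by apply/hi; exists z.
by rewrite /= li /= e !linear0.
Qed.

(** With the same pushout E, the cokernel Q of C0 -> E is in C, and coker f embeds in Q with
    quotient D1. *)
Lemma wide_hull_cokernel_closed : cokernel_closed wide_hull.
Proof.
move=> X Y L f c [C0 [C1 [a [b [cC0 cC1 sesX]]]]] [D0 [D1 [a' [b' [cD0 cD1 sesY]]]]] [sc kc].
have [E [k [l [r [sesE rl li ekl lk]]]]] := pushout_ex (a' \o f) sesX.
have cE : C E by apply: extC sesE _ _.
have [Q [q cq]] := coker_ex l.
have cQ : C Q by apply: cokC cq.
have [inja ha sb] := sesX; have [inja' ha' sb'] := sesY; have [injk hk sr] := sesE.
have ql x : q (l x) = 0 by apply/(cq.2); exists x.
pose d : {linear D0 -> Q} := q \o k.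
have sd z : exists x, d x = z.
  have [e <-] := cq.1 z; have [x [y ->]] := ekl e.
  by exists x; rewrite linearD /= ql addr0.
have hd z : d z = 0 <-> exists x, a' (f x) = z.
  split=> [/(cq.2)[y ly]|[x <-]]; last by rewrite /d /= -[k _]li ql.
  have /ha[x hx] : b y = 0 by rewrite -rl ly (ses_pi sesE).
  by exists x; apply: injk; rewrite -ly -hx li.
have [t ht] : exists t : {linear L -> Q}, forall y, t (c y) = (d \o a') y.
  by apply: factor_epi => // y /kc[x <-]; apply/hd; exists x.
have [v hv] : exists v : {linear Q -> D1}, forall y, v (d y) = b' y.
  by apply: factor_epi => // y /hd[x <-]; apply: (ses_pi sesY).
exists Q, D1, t, v; split=> //; split.
- apply: linear_eq0_inj => z; have [y <-] := sc z; rewrite ht => /hd[x /inja' <-].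
  by apply/kc; exists x.
- move=> z; have [x <-] := sd z; rewrite hv ha'; split=> [[y <-]|[w]].
    by exists (c y); rewrite ht.
  have [y <-] := sc w; rewrite ht => /eqP; rewrite /= eq_sym -subr_eq0 -linearB -linearB.
  move=> /eqP/hd[u]; move/eqP; rewrite eq_sym subr_eq -linearD => /eqP ->.
  by exists (f u + y).
- by move=> z; have [y <-] := sb' z; exists (d y); rewrite hv.
Qed.

(** Heredity enters here: E extends along Y -> D0 to an extension E' of D0 by X. Pushing E' out
    along X -> C0 gives an extension F of D0 by C0; E embeds in F, and the cokernel is an extension
    of D1 by C1. *)
Lemma wide_hull_extension_closed : extension_closed wide_hull.
Proof.
move=> X E Y al be ses [C0 [C1 [a [b [cC0 cC1 sesX]]]]] [D0 [D1 [a' [b' [cD0 cD1 sesY]]]]].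
have [inja ha sb] := sesX; have [inja' ha' sb'] := sesY; have [injal hal sbe] := ses.
have [E' [j [p [u [sesE' ual pu]]]]] := ext_extend ses inja'.
have [injj hj sp] := sesE'.
have [F [k [l [r [sesF rl lj _ lk]]]]] := pushout_ex a sesE'.
have [injk hk sr] := sesF.
have cF : C F by apply: extC sesF _ _.
have rlu e : r (l (u e)) = a' (be e) by rewrite rl pu.
have luk e z : l (u e) = k z -> exists x, e = al x /\ z = a x.
  move=> lkz; have /hal[x hx] : be e = 0.
    by apply: inja'; rewrite -rlu lkz (ses_pi sesF) linear0.
  by exists x; split=> //; apply: injk; rewrite -lkz -hx ual lj.
have [L [c [sc kc]]] := coker_ex (l \o u).
have [s hs] : exists s : {linear C1 -> L}, forall z, s (b z) = (c \o k) z.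
  apply: factor_epi => // z /ha[x <-] /=.
  by apply/kc; exists (al x); rewrite /= ual lj.
have [t ht] : exists t : {linear L -> D1}, forall z, t (c z) = (b' \o r) z.
  by apply: factor_epi => // z /kc[x <-] /=; rewrite rlu (ses_pi sesY).
have cL : C L.
  apply: (extC (f := s) (g := t)) cC1 cD1; split.
  - apply: linear_eq0_inj => w; have [z <-] := sb w; rewrite hs => /kc[e /luk[x [_ ->]]].
    exact: ses_pi sesX _.
  - move=> w; split=> [|[w' <-]]; last first.
      by have [z <-] := sb w'; rewrite hs ht /= (ses_pi sesF) linear0.
    have [z <-] := sc w; rewrite ht /= => /ha'[y]; have [e <-] := sbe y.
    rewrite -rlu => /eqP; rewrite eq_sym -subr_eq0 -linearB => /eqP/hk[x hx].
    exists (b x); rewrite hs /= hx linearB /=.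
    suff -> : c (l (u e)) = 0 by rewrite subr0.
    by apply/kc; exists e.
  - move=> w; have [z <-] := sb' w; have [y <-] := sr z; exists (c y); by rewrite ht.
exists F, L, (l \o u), c; split=> //; split=> //.
apply: linear_eq0_inj => e /= h; have [|x [-> e0]] := luk e 0; first by rewrite linear0.
by rewrite (inja x 0) ?linear0.
Qed.

Lemma wide_hull_wide : wide wide_hull.
Proof.
split; [|exact: wide_hull_kernel_closed|exact: wide_hull_cokernel_closed
        |exact: wide_hull_extension_closed].
apply: subcategory_intro; [| |exact: wide_hull_extension_closed|left; exact: wide_hull_kernel_closed].
  move=> M N /mod_isoE[f [g [fK gK]]] [C0 [C1 [a [b [cC0 cC1 [inja ha sb]]]]]].
  exists C0, C1, (a \o g), b; split=> //; split=> // [x y /inja/(can_inj gK) //|y].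
  rewrite ha; split=> [[x <-]|[x <-]]; last by exists (g x).
  by exists (f x); rewrite /= fK.
by move=> Z z; apply: wide_hull_sub; case: sC => _ c0 _ _; apply: c0.
Qed.

(** A quotient N in the hull of an object M of C embeds in some C0 of C, so N is the image of a map
    M -> C0 in C. *)
Lemma ice_closed_torsion_class : torsion_class_in wide_hull C.
Proof.
split=> //; first exact: wide_hull_sub.
  move=> M N g cM wN epi.
  have sg := epi_in_surj wide_hull_wide (wide_hull_sub cM) wN epi.
  have [C0 [C1 [a [b [cC0 cC1 [inja ha sb]]]]]] := wN.
  apply: (imC (f := a \o g) (i := a)) cM cC0 _; split=> // y; split=> [[x <-]|[z <-]].
    by exists (g x).
  by have [x <-] := sg z; exists x.
move=> L M N f g cL wM cN h.
have ses := short_exact_inP wide_hull_wide (wide_hull_sub cL) wM (wide_hull_sub cN) h.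
exact: extC ses cL cN.
Qed.
End WideHull.
End Wide.

(** * The Tits form of a Dynkin quiver *)

Section Forms.
Implicit Types (y : nat -> rat) (n b : nat).

Definition edge_sum (e : rel nat) n y : rat :=
  \sum_(i < n) \sum_(j < n | e i j) y i * y j.

Definition norm2 n y : rat := \sum_(i < n) y i ^+ 2.

(** Twice the Tits form of a chain, without its last square [y m ^+ 2]; in type D that square is
    spent on the two leaves at the end. *)
Definition chain_sq m y : rat := y 0 ^+ 2 + \sum_(i < m) (y i - y i.+1) ^+ 2.

Lemma chain_sqE m y :
  (norm2 m.+1 y - \sum_(i < m) y i * y i.+1) *+ 2 = chain_sq m y + y m ^+ 2.
Proof.
rewrite /norm2 /chain_sq; elim: m => [|m IH].
  by rewrite !big_ord0 big_ord1 /=; lra.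
move: IH; rewrite !big_ord_recr /=.
by set a := \sum_(i < _) _; set b := \sum_(i < _) _; set c := \sum_(i < _) _; lra.
Qed.

(** Cauchy-Schwarz: [y j] telescopes into j + 1 terms whose squares add up to [chain_sq j y]. *)
Lemma chain_sq_bound m y j : (j <= m)%N -> y j ^+ 2 <= m.+1%:R * chain_sq m y.
Proof.
have key i : y i ^+ 2 <= i.+1%:R * chain_sq i y.
  elim: i => [|i IH]; first by rewrite /chain_sq big_ord0 addr0 mul1r.
  rewrite /chain_sq big_ord_recr /= addrA -/(chain_sq i y).
  set c := chain_sq i y in IH *.
  have i0 : 0 < i.+1%:R :> rat by rewrite ltr0n.
  have -> : i.+2%:R = i.+1%:R + 1 :> rat by rewrite -natr1.
  move: i.+1%:R i0 IH => r r0; set u := y i; set v := y i.+1 => IH.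
  rewrite -(ler_pM2l r0).
  (* With d = v - u, the inequality r (u + d)^2 <= (r + 1) u^2 + r (r + 1) d^2 is exactly (u - r
     d)^2 >= 0. *)
  have h1 : (r + 1) * u ^+ 2 <= (r + 1) * (r * c) by rewrite ler_pM2l //; lra.
  have h2 : 0 <= (u - r * (v - u)) ^+ 2 by apply: sqr_ge0.
  by lra.
have mono i l : (i <= l)%N -> chain_sq i y <= chain_sq l y.
  elim: l => [|l IH]; first by rewrite leqn0 => /eqP->.
  rewrite leq_eqVlt => /orP[/eqP-> //|]; rewrite ltnS => /IH h.
  by rewrite (le_trans h) // /chain_sq big_ord_recr /= addrA lerDl sqr_ge0.
have pos i : 0 <= chain_sq i y.
  by rewrite /chain_sq addr_ge0 ?sqr_ge0 // sumr_ge0 // => l _; rewrite sqr_ge0.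
move=> jm; apply: le_trans (key j) _; apply: ler_pM => //.
  by rewrite ler_nat ltnS.
exact: mono.
Qed.

Lemma edge_sum_chain n y :
  edge_sum (fun i j => j == i.+1) n.+1 y = \sum_(i < n) y i * y i.+1.
Proof.
rewrite /edge_sum; under eq_bigr do rewrite (big_ord1_eq _ (fun j => y _ * y j)).
rewrite big_ord_recr /= ltnn addr0; apply: eq_bigr => i _.
by rewrite ltnS ltn_ord.
Qed.

Lemma edge_sum_branched n b y : (b < n.+1)%N ->
  edge_sum (branched_chain n.+2 b) n.+2 y = \sum_(i < n) y i * y i.+1 + y b * y n.+1.
Proof.
move=> bn; rewrite -edge_sum_chain /edge_sum big_ord_recr /=.
rewrite [X in _ + X]big_pred0 => [|j]; last first.
  rewrite /branched_chain /= [n.+1 == b]eq_sym (ltn_eqF bn) orbF.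
  by case: eqP => // ->; rewrite ltnNge leqnSn.
rewrite addr0 [RHS]addrC.
transitivity (\sum_(i < n.+1) (\sum_(j < n.+1 | j == i.+1 :> nat) y i * y j
   + (if i == b :> nat then y b * y n.+1 else 0))).
  apply: eq_bigr => i _; rewrite big_mkcond big_ord_recr /= -big_mkcond /=.
  congr (_ + _).
    apply: eq_bigl => j; rewrite /branched_chain /= ltn_ord andbT.
    by rewrite (ltn_eqF (ltn_ord j)) andbF orbF.
  rewrite /branched_chain /= ltnn andbF eqxx andbT /=.
  by case: eqP => // ->.
rewrite big_split /= addrC; congr (_ + _).
by rewrite -big_mkcond (big_ord1_eq _ (fun=> _)) bn.
Qed.

(* The squares below come from completing the square from the leaves towards the branching
   vertex 2, where 1 - 1/4 - 1/3 - 2/5 = 1/60 of [a2 ^+ 2] remains. *)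
Lemma E8_bound (a0 a1 a2 a3 a4 a5 a6 a7 q : rat) :
  q = a0 ^+ 2 + a1 ^+ 2 + a2 ^+ 2 + a3 ^+ 2 + a4 ^+ 2 + a5 ^+ 2 + a6 ^+ 2 + a7 ^+ 2
   - (a0 * a1 + a1 * a2 + a2 * a3 + a3 * a4 + a4 * a5 + a5 * a6 + a2 * a7) ->
  [/\ [/\ a0 ^+ 2 <= 100 * q, a1 ^+ 2 <= 100 * q, a2 ^+ 2 <= 100 * q & a3 ^+ 2 <= 100 * q]
    & [/\ a4 ^+ 2 <= 100 * q, a5 ^+ 2 <= 100 * q, a6 ^+ 2 <= 100 * q & a7 ^+ 2 <= 100 * q]].
Proof.
move=> e.
(* This carries a bound from one vertex to the next one away from the branching vertex. The constant
   60 is the inverse of the remaining 1/60; 80 and 100 are rounded up. *)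
have sq (l u c : rat) : (l + c * u) ^+ 2 <= 2 * l ^+ 2 + 2 * c ^+ 2 * u ^+ 2.
  by have := sqr_ge0 (l - c * u); lra.
have := (sqr_ge0 (a7 - a2 / 2), sqr_ge0 (a0 - a1 / 2), sqr_ge0 (a1 - a2 * 2 / 3),
  sqr_ge0 (a6 - a5 / 2), sqr_ge0 (a5 - a4 * 2 / 3), sqr_ge0 (a4 - a3 * 3 / 4),
  sqr_ge0 (a3 - a2 * 4 / 5), sqr_ge0 a2).
move=> [[[[[[[s7 s0] s1] s6] s5] s4] s3] s2].
have h2 : a2 ^+ 2 <= 60 * q by rewrite e; lra.
have h3 : a3 ^+ 2 <= 80 * q by have := sq (a3 - a2 * 4 / 5) a2 (4 / 5); lra.
have h4 : a4 ^+ 2 <= 100 * q by have := sq (a4 - a3 * 3 / 4) a3 (3 / 4); lra.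
have h5 : a5 ^+ 2 <= 100 * q by have := sq (a5 - a4 * 2 / 3) a4 (2 / 3); lra.
have h6 : a6 ^+ 2 <= 100 * q by have := sq (a6 - a5 / 2) a5 (1 / 2); lra.
have h1 : a1 ^+ 2 <= 100 * q by have := sq (a1 - a2 * 2 / 3) a2 (2 / 3); lra.
have h0 : a0 ^+ 2 <= 100 * q by have := sq (a0 - a1 / 2) a1 (1 / 2); lra.
have h7 : a7 ^+ 2 <= 100 * q by have := sq (a7 - a2 / 2) a2 (1 / 2); lra.
have q0 : 0 <= q by rewrite e; lra.
by split; split; lra.
Qed.

Lemma dynkin_form_bound (t : dynkin_type) : exists N : nat, forall y j,
  (j < dynkin_rank t)%N ->
  y j ^+ 2 <= N%:R * (norm2 (dynkin_rank t) y - edge_sum (dynkin_edge t) (dynkin_rank t) y).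
Proof.
case: t => [[//|n] _|n hn| | |] /=.
- exists n.+1.*2 => y j; rewrite ltnS => jn; rewrite edge_sum_chain.
  have := chain_sqE n y; have := chain_sq_bound y jn; have := sqr_ge0 (y n).
  have : 0 < n.+1%:R :> rat by rewrite ltr0n.
  rewrite -mul2n natrM; move: (n.+1%:R) (norm2 _ _ - _) => r q r0.
  move=> h1 h2 h3; apply: le_trans h2 _.
  have -> : 2 * r * q = r * (q *+ 2) by ring.
  by rewrite ler_pM2l // h3; lra.
- case: n hn => [|[|[|[|n]]]] // _; exists n.+4.*2 => y j jn.
  rewrite edge_sum_branched; last by rewrite !subSS subn0.
  rewrite !subSS subn0 /norm2 2!big_ord_recr [X in _ - (X + _)]big_ord_recr /=.
  have := chain_sqE n.+1 y; rewrite /norm2.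
  have hb i := @chain_sq_bound n.+1 y i.
  set c := chain_sq _ _ in hb *.
  have c0 : 0 <= c.
    by rewrite /c /chain_sq addr_ge0 ?sqr_ge0 // sumr_ge0 // => l _; rewrite sqr_ge0.
  set s := \sum_(i < _) _; set s' := \sum_(i < _) _.
  set x := y n.+1 in hb *; set z := y n.+2 in hb *; set w := y n.+3 in hb *.
  move=> h.
  have r0 : 4 <= n.+4%:R :> rat by rewrite ler_nat.
  have hr : n.+2%:R <= n.+4%:R :> rat by rewrite ler_nat ltnW.
  rewrite -mul2n natrM; set q := (X in _ <= _ * X).
  (* The x^2 / 2 left over by the chain is used up exactly by completing the squares of the two
     leaves. *)
  have qE : q = c / 2 + (z - x / 2) ^+ 2 + (w - x / 2) ^+ 2 by rewrite /q; lra.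
  have hz : z ^+ 2 <= 2 * (z - x / 2) ^+ 2 + x ^+ 2 / 2 by have := sqr_ge0 (z - x); lra.
  have hw : w ^+ 2 <= 2 * (w - x / 2) ^+ 2 + x ^+ 2 / 2 by have := sqr_ge0 (w - x); lra.
  have sz := sqr_ge0 (z - x / 2); have sw := sqr_ge0 (w - x / 2).
  move: qE sz sw hz hw; move: ((z - x / 2) ^+ 2) ((w - x / 2) ^+ 2) => u v qE sz sw hz hw.
  have hb' i : (i <= n.+1)%N -> y i ^+ 2 <= n.+4%:R * c.
    by move=> /hb h1; apply: le_trans h1 _; apply: ler_wpM2r.
  have := hb' n.+1 (leqnn _); rewrite -/x => hx.
  move: {h} (n.+4%:R) r0 {hr hb} hb' hx => r r0 hb' hx.
  have p1 : 0 <= (r - 4) * u by rewrite mulr_ge0 ?subr_ge0.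
  have p2 : 0 <= (r - 4) * v by rewrite mulr_ge0 ?subr_ge0.
  have p3 : 0 <= r * c by rewrite mulr_ge0 // (le_trans _ r0).
  have -> : 2 * r * q = r * c + 2 * r * u + 2 * r * v by rewrite qE; lra.
  move: jn; rewrite ltnS leq_eqVlt => /orP[/eqP ->|]; first by rewrite -/w; lra.
  rewrite ltnS leq_eqVlt => /orP[/eqP ->|]; first by rewrite -/z; lra.
  by rewrite ltnS => /hb' h1; lra.
(* E6 and E7 are full subdiagrams of E8: the coordinates at the end of the long arm are set to 0. *)
- exists 100%N => y j; have := @E8_bound (y 0) (y 1) (y 2) (y 3) (y 4) 0 0 (y 5) _ erefl.
  rewrite (@edge_sum_branched 4 2); last by [].
  rewrite /norm2 !big_ord_recr !big_ord0 /= => -[[h0 h1 h2 h3] [h4 _ _ h5]].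
  case: j => [|[|[|[|[|[|j]]]]]];
    [..|by rewrite !ltnS ltn0; discriminate]; by move=> _; lra.
- exists 100%N => y j; have := @E8_bound (y 0) (y 1) (y 2) (y 3) (y 4) (y 5) 0 (y 6) _ erefl.
  rewrite (@edge_sum_branched 5 2); last by [].
  rewrite /norm2 !big_ord_recr !big_ord0 /= => -[[h0 h1 h2 h3] [h4 h5 _ h6]].
  case: j => [|[|[|[|[|[|[|j]]]]]]];
    [..|by rewrite !ltnS ltn0; discriminate]; by move=> _; lra.
- exists 100%N => y j; have := @E8_bound (y 0) (y 1) (y 2) (y 3) (y 4) (y 5) (y 6) (y 7) _ erefl.
  rewrite (@edge_sum_branched 6 2); last by [].
  rewrite /norm2 !big_ord_recr !big_ord0 /= => -[[h0 h1 h2 h3] [h4 h5 h6 h7]].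
  case: j => [|[|[|[|[|[|[|[|j]]]]]]]];
    [..|by rewrite !ltnS ltn0; discriminate]; by move=> _; lra.
Qed.
End Forms.

Lemma dynkin_edge_ltn t i j : (i < dynkin_rank t)%N -> (j < dynkin_rank t)%N ->
  dynkin_edge t i j -> (i < j)%N.
Proof.
case: t => [n n0|n n3| | |] /=; rewrite /branched_chain; first by move=> _ _ /eqP->.
all: move=> hi hj /orP[/andP[/eqP-> //]|/andP[/eqP-> /eqP->]] //.
by case: n n3 hi hj => [|[|[|n]]] //= _ _ _; rewrite !subSS subn0 ltnW.
Qed.

Lemma dynkin_edge_sum t (y : nat -> rat) :
  \sum_(i < dynkin_rank t) \sum_(j < dynkin_rank t) (dynkin_adj t i j)%:R * (y i * y j)
  = edge_sum (dynkin_edge t) (dynkin_rank t) y *+ 2.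
Proof.
have -> : edge_sum (dynkin_edge t) (dynkin_rank t) y =
    \sum_(i < dynkin_rank t) \sum_(j < dynkin_rank t) if dynkin_edge t i j then y i * y j else 0.
  by apply: eq_bigr => i _; rewrite big_mkcond.
rewrite mulr2n [X in _ = _ + X]exchange_big /= -big_split; apply: eq_bigr => i _.
rewrite -big_split; apply: eq_bigr => j _ /=; rewrite /dynkin_adj.
have h1 := @dynkin_edge_ltn t i j (ltn_ord i) (ltn_ord j).
have h2 := @dynkin_edge_ltn t j i (ltn_ord j) (ltn_ord i).
case: (dynkin_edge t i j) h1 => [/(_ isT) h1|_];
  case: (dynkin_edge t j i) h2 => [/(_ isT) h2|_] //=;
  rewrite ?mul1r ?mul0r ?addr0 ?add0r //; last by rewrite mulrC.
by have := ltn_trans h1 h2; rewrite ltnn.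
Qed.

(** The bound x_i^2 <= N q(x), rearranged so that no subtraction of natural numbers occurs. All
    later uses of the Dynkin hypothesis go through it. *)
Definition tits_bounded (Q : quiver) : Prop := exists N : nat, forall (x : vertex Q -> nat) i,
  (x i ^ 2 + N * \sum_(a : arrow Q) x (src a) * x (tgt a) <= N * \sum_i x i ^ 2)%N.

Lemma dynkin_tits_bounded (Q : quiver) : dynkin_quiver Q -> tits_bounded Q.
Proof.
move=> [t [phi [[psi phiK psiK] adj]]]; have [N hN] := dynkin_form_bound t.
exists N => x i; pose y j : rat := if insub j is Some j' then (x (psi j'))%:R else 0.
have yE (j : 'I_(dynkin_rank t)) : y j = (x (psi j))%:R by rewrite /y valK.
have bphi : bijective phi by exists psi.
have nE : norm2 (dynkin_rank t) y = (\sum_i x i ^ 2)%N%:R.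
  rewrite /norm2 natr_sum [RHS](reindex psi) /=; last by apply: onW_bij; exists phi.
  by apply: eq_bigr => j _; rewrite yE natrX.
(* The sum over ordered pairs of vertices counts an arrow twice only if its ends differ. *)
have noloop (a : arrow Q) : src a != tgt a.
  apply/eqP => e; have := adj (src a) (src a); rewrite /dynkin_adj.
  have hs := ltn_ord (phi (src a)).
  have := @dynkin_edge_ltn t _ _ hs hs; rewrite ltnn => /contraNF -> //.
  by move/eqP/pred0P => /(_ a); rewrite /= -e !eqxx.
have eE : edge_sum (dynkin_edge t) (dynkin_rank t) y =
    (\sum_(a : arrow Q) x (src a) * x (tgt a))%N%:R.
  have : edge_sum (dynkin_edge t) (dynkin_rank t) y *+ 2 =
    (\sum_(a : arrow Q) x (src a) * x (tgt a))%N%:R *+ 2; last by lra.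
  rewrite -dynkin_edge_sum -mulrnA.
  transitivity ((\sum_u \sum_v dynkin_adj t (phi u) (phi v) * (x u * x v))%N%:R : rat).
    rewrite natr_sum [RHS](reindex psi) /=; last by apply: onW_bij; exists phi.
    apply: eq_bigr => u _; rewrite natr_sum [RHS](reindex psi) /=; last by apply: onW_bij; exists phi.
    by apply: eq_bigr => v _; rewrite !yE !natrM !psiK.
  congr (_%:R); transitivity (\sum_u \sum_v \sum_(a : arrow Q | ((src a == u) && (tgt a == v))
      || ((src a == v) && (tgt a == u))) (x u * x v))%N.
    apply: eq_bigr => u _; apply: eq_bigr => v _.
    by rewrite sum_nat_const -adj; congr (_ * _)%N; apply: eq_card.
  transitivity (\sum_(a : arrow Q) \sum_u \sum_(v | ((src a == u) && (tgt a == v))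
      || ((src a == v) && (tgt a == u))) (x u * x v))%N.
    rewrite [RHS]exchange_big; apply: eq_bigr => u _.
    by rewrite [RHS](exchange_big_dep xpredT).
  rewrite big_distrl /=; apply: eq_bigr => a _.
  have ne := noloop a.
  rewrite (bigD1 (src a)) //= [X in (_ + X)%N](bigD1 (tgt a)) /=; last by rewrite eq_sym.
  rewrite muln2 -addnn; congr (_ + _)%N.
    rewrite (big_pred1 (tgt a)) // => v /=.
    by rewrite eqxx /= [tgt a == src a]eq_sym (negbTE ne) andbF orbF eq_sym.
  rewrite [X in (_ + X)%N]big1 ?addn0 => [|u /andP[nu1 nu2]].
    rewrite (big_pred1 (src a)) 1?mulnC // => v /=.
    by rewrite (negbTE ne) /= eqxx andbT eq_sym.
  by rewrite big_pred0 // => v; rewrite eq_sym (negbTE nu1) /= [tgt a == u]eq_sym (negbTE nu2) andbF.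
have := hN y (phi i) (ltn_ord _); rewrite yE phiK nE eE mulrBr lerBrDr.
by rewrite -natrX -!natrM -natrD ler_nat.
Qed.

(** * Finiteness of the set of paths *)

Section FinitePaths.
Local Open Scope nat_scope.
Variable Q : quiver.
Hypothesis tits : tits_bounded Q.

(* The Tits form is nonpositive on the indicator of a nonempty set of vertices each of
   which has an arrow into the set. *)
Lemma no_recurrent_set (A : {set vertex Q}) :
  (forall x, x \in A -> exists2 a, src a = x & tgt a \in A) -> A = set0.
Proof.
move=> hA; apply/eqP/negPn/negP => /set0Pn[z zA].
have [N hN] := tits; have := hN (fun x => (x \in A) : nat) z.
have -> : \sum_i (i \in A) ^ 2 = #|A|.
  by rewrite -sum1_card [RHS]big_mkcond; apply: eq_bigr => i _; case: (i \in A).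
pose B := [set a : arrow Q | (src a \in A) && (tgt a \in A)].
have -> : \sum_(a : arrow Q) (src a \in A) * (tgt a \in A) = #|B|.
  rewrite -sum1_card [RHS]big_mkcond; apply: eq_bigr => a _; rewrite inE.
  by case: (_ \in A); case: (_ \in A).
have le : #|A| <= #|B|.
  apply: leq_trans (leq_imset_card (@src Q) _); apply/subset_leq_card/subsetP => x xA.
  by have [a ax ta] := hA x xA; rewrite -ax imset_f // inE ax xA.
by rewrite zA leqNgt ltnS leq_mul.
Qed.

Fixpoint walk_starts n : {set vertex Q} :=
  if n is n'.+1 then [set x | [exists a, (src a == x) && (tgt a \in walk_starts n')]]
  else setT.

Lemma walk_startsP x (s : seq (arrow Q)) : walk x s -> x \in walk_starts (size s).
Proof.
elim: s x => [|a s IH] x /=; first by rewrite inE.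
by case/andP=> ax /IH h; rewrite inE; apply/existsP; exists a; rewrite ax.
Qed.

Lemma walk_starts_decr n : walk_starts n.+1 \subset walk_starts n.
Proof.
elim: n => [|n IH]; first exact: subsetT.
apply/subsetP => x; rewrite !inE => /existsP[a /andP[ax ta]].
by apply/existsP; exists a; rewrite ax (subsetP IH).
Qed.

(** The sets decrease strictly until they are empty, because a nonempty set that repeats would
    contradict [no_recurrent_set]. *)
Lemma walk_starts_card n : walk_starts n != set0 -> n + #|walk_starts n| <= #|vertex Q|.
Proof.
elim: n => [|n IH] h; first by rewrite max_card.
have h' : walk_starts n != set0.
  by apply: contraNneq h => e; rewrite -subset0 -e walk_starts_decr.
apply: leq_trans (IH h'); rewrite addSnnS leq_add2l; apply: proper_card.
rewrite properEneq walk_starts_decr andbT; apply: contraNneq h' => e.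
apply/eqP/no_recurrent_set => x; rewrite -{1}e inE => /existsP[a /andP[/eqP ax ta]].
by exists a.
Qed.

Lemma walk_size x (s : seq (arrow Q)) : walk x s -> size s <= #|vertex Q|.
Proof.
move/walk_startsP => h; have /walk_starts_card : walk_starts (size s) != set0.
  by apply/set0Pn; exists x.
exact/leq_trans/leq_addr.
Qed.

Lemma finite_paths : exists s : seq (qpath Q), forall p, p \in s.
Proof.
pose W := flatten [seq [seq val t | t <- enum {: n.-tuple (arrow Q)}] | n <- iota 0 #|vertex Q|.+1].
exists (pmap insub [seq (x, w) | x <- enum (vertex Q), w <- W]) => p.
rewrite mem_pmap_sub; case: p => -[x w] /= h.
apply/allpairsP; exists (x, w); split=> //=; first by rewrite mem_enum.
apply/flatten_mapP; exists (size w); first by rewrite mem_iota ltnS (walk_size h).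
by apply/mapP; exists (in_tuple w); rewrite ?mem_enum.
Qed.
End FinitePaths.

(** * Modules over the path algebra as representations *)

Lemma linear_linext (k : fieldType) (P : choiceType) (V W : lmodType k)
    (phi : V -> W) (h : P -> V) (g : {malg k[P]}) :
  linear phi -> phi (linext h g) = linext (phi \o h) g.
Proof.
move=> lphi; rewrite -[phi _]/(mklin lphi _) linext.unlock linear_sum.
by apply: eq_bigr => p _; rewrite linearZ.
Qed.

Definition kQ (k : fieldType) (Q : quiver) : pzRingType := path_algebra k Q.

HB.lock Definition path_elt (k : fieldType) (Q : quiver) (p : qpath Q) : (kQ k Q)^c :=
  (<< p >> : {malg k[qpath Q]}).

(** Scalars as central elements of the algebra: through them a module over the bare ring becomes a
    k-vector space on which the ring acts k-linearly. *)
HB.lock Definition cst (k : fieldType) (Q : quiver) (c : k) : (kQ k Q)^c :=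
  (c *: (1 : path_algebra k Q)).

Section Path.
Variables (k : fieldType) (Q : quiver).
Local Notation R := (kQ k Q).
Local Notation A := (path_algebra k Q).
Local Notation P := (qpath Q).

Local Notation path_elt := (@path_elt k Q).
Definition vertex_elt (x : vertex Q) : R^c := path_elt (trivial_path x).

Fact arrow_walk (a : arrow Q) : walk (src a) [:: a].
Proof. by rewrite /= eqxx. Qed.
Definition arrow_path (a : arrow Q) : P := @QPath Q (src a, [:: a]) (arrow_walk a).
Definition arrow_elt (a : arrow Q) : R^c := path_elt (arrow_path a).

Local Notation cst := (@cst k Q).

Lemma convM (a b : A) : (a : R^c) * (b : R^c) = (b * a : A).
Proof. by []. Qed.
Lemma cst1 : cst 1 = 1. Proof. rewrite cst.unlock; exact: (scale1r (1 : A)). Qed.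
Lemma cstD c d : cst (c + d) = cst c + cst d. Proof. rewrite cst.unlock; exact: (scalerDl (1 : A)). Qed.
Lemma cstM c d : cst c * cst d = cst (c * d).
Proof.
rewrite cst.unlock convM -(path_scalerAl d (1 : A) (c *: (1 : A) : A)) (mul1r (c *: (1 : A) : A)).
by rewrite (scalerA d c (1 : A)) mulrC.
Qed.
Lemma cst_mull c (r : R^c) : cst c * r = (c *: (r : A)).
Proof. by rewrite cst.unlock convM -(path_scalerAr c (r : A) 1) mulr1. Qed.
Lemma cst_mulr c (r : R^c) : r * cst c = (c *: (r : A)).
Proof. by rewrite cst.unlock convM -(path_scalerAl c 1 (r : A)) mul1r. Qed.

Lemma vertex_elt_sum : \sum_x vertex_elt x = 1.
Proof. by rewrite /vertex_elt path_elt.unlock. Qed.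

(** Products are reversed in the converse ring, so acting by [p] and then by [q] is acting by the
    path [p] followed by [q]. *)
Lemma path_eltM (p q : P) : path_elt q * path_elt p =
  if pcomp p q is Some r then path_elt r else 0.
Proof. by rewrite path_elt.unlock convM (path_basisM k p q). Qed.

(* The underlying k-vector space of a module. *)
Definition kv (M : rmodType R) : Type := M.

Section Restriction.
Variable M : rmodType R.
HB.instance Definition _ := GRing.Zmodule.on (kv M).
Definition kv_scale (c : k) (m : kv M) : kv M := cst c *: (m : M).
Fact kv_scaleA a b v : kv_scale a (kv_scale b v) = kv_scale (a * b) v.
Proof. by rewrite /kv_scale scalerA cstM. Qed.
Fact kv_scale1 : left_id 1 kv_scale.
Proof. by move=> v; rewrite /kv_scale cst1 scale1r. Qed.
Fact kv_scaleDr : right_distributive kv_scale +%R.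
Proof. by move=> c u v; apply: scalerDr. Qed.
Fact kv_scaleDl v : {morph kv_scale^~ v : a b / a + b}.
Proof. by move=> a b; rewrite /kv_scale cstD scalerDl. Qed.
HB.instance Definition _ := GRing.Zmodule_isLmodule.Build k (kv M)
  kv_scaleA kv_scale1 kv_scaleDr kv_scaleDl.

Lemma kv_scaleE c (m : kv M) : c *: m = cst c *: (m : M).
Proof. by []. Qed.

Fact elt_linear (r : R^c) : linear (fun m : kv M => (r *: (m : M)) : kv M).
Proof.
move=> c x y; rewrite scalerDr !kv_scaleE !scalerA.
by rewrite cst_mull cst_mulr.
Qed.
Definition elt (r : R^c) : {linear kv M -> kv M} := mklin (elt_linear r).
Definition vact x := locked (elt (vertex_elt x)).
Definition aact a := locked (elt (arrow_elt a)).

Lemma vactE x (m : kv M) : vact x m = vertex_elt x *: (m : M).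
Proof. by rewrite /vact -lock. Qed.

Lemma aactE a (m : kv M) : aact a m = arrow_elt a *: (m : M).
Proof. by rewrite /aact -lock. Qed.

Lemma elt_linext (r : R^c) (m : kv M) :
  elt r m = linext (fun p => elt (path_elt p) m) r.
Proof.
rewrite -[in LHS](linext_id r).
rewrite (linear_linext (phi := fun r : {malg k[P]} => elt (r : R^c) m)).
  by apply: eq_linext => p; rewrite path_elt.unlock.
move=> c x y.
rewrite /= kv_scaleE scalerA cst_mull.
exact: (scalerDl (m : M) (c *: (x : A) : R^c) (y : R^c)).
Qed.

Lemma vact_vact x y m : vact y (vact x m) = if x == y then vact x m else 0.
Proof.
rewrite !vactE scalerA path_eltM pcomp1p /psource /= eq_sym.
by case: eqP => [->|] //; rewrite ?vactE // scale0r.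
Qed.

Lemma vact_sum m : \sum_x vact x m = m.
Proof.
under eq_bigr do rewrite vactE.
by rewrite -[LHS](scaler_suml (m : M)) vertex_elt_sum scale1r.
Qed.

Lemma vact_aact x a m : vact x (aact a m) = if tgt a == x then aact a m else 0.
Proof.
rewrite vactE aactE scalerA path_eltM pcompp1 /ptarget /=.
by rewrite (_ : walk_end (src a) [:: a] = tgt a) //; case: eqP => // _; rewrite scale0r.
Qed.

Lemma aact_vact x a m : aact a (vact x m) = if x == src a then aact a m else 0.
Proof.
rewrite vactE !aactE scalerA path_eltM pcomp1p /psource /=.
by case: eqP => // _; rewrite scale0r.
Qed.

Lemma path_elt_act (p : P) m :
  elt (path_elt p) m = foldl (fun v a => aact a v) (vact (val p).1 m) (val p).2.
Proof.
move ex: (val p).1 => x; move es: (val p).2 => s.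
elim/last_ind: s p ex es => [|s a IH] p ex es.
  rewrite /= vactE; congr (path_elt _ *: _); apply: val_inj; by rewrite [LHS]surjective_pairing ex es.
have := valP p; rewrite /= ex es -cats1 walk_cat => /andP[w1 /= /andP[/eqP w2 _]].
rewrite foldl_cat /= -[foldl _ _ _](IH (@QPath Q (x, s) w1)) //= aactE scalerA path_eltM.
case: pcompP => [r e er|]; last by rewrite /ptarget /psource /= -w2 eqxx.
congr (path_elt _ *: _); apply: val_inj.
by rewrite er /= cats1 -es -ex -surjective_pairing.
Qed.
End Restriction.

Lemma linear_vact (M N : rmodType R) (f : {linear M -> N}) x m :
  f (vact M x m) = vact N x (f m).
Proof. by rewrite !vactE linearZ. Qed.

Lemma linear_aact (M N : rmodType R) (f : {linear M -> N}) a m :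
  f (aact M a m) = aact N a (f m).
Proof. by rewrite !aactE linearZ. Qed.

(** Paths span the algebra, and each acts as a vertex idempotent followed by arrows. *)
Lemma klinear_linear (M N : rmodType R) (f : kv M -> kv N) :
  linear f -> (forall x m, f (vact M x m) = vact N x (f m)) ->
  (forall a m, f (aact M a m) = aact N a (f m)) ->
  linear (f : M -> N).
Proof.
move=> lf fv fa; pose F := mklin lf.
have Fv x m : F (vact M x m) = vact N x (F m) by apply: fv.
have Fa a m : F (aact M a m) = aact N a (F m) by apply: fa.
have main r m : F (elt M r m) = elt N r (F m).
  rewrite !elt_linext (linear_linext (phi := F)); last exact: linearP.
  apply: (@eq_linext k P (kv N) _ _ r).
  move=> p.
  change (F (elt M (path_elt p) m) = elt N (path_elt p) (F m)).
  rewrite (path_elt_act p m).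
  rewrite (path_elt_act p (F m)).
  rewrite -Fv.
  elim: (val p).2 (vact M _ m) => //= a s IH v.
  by rewrite IH; congr (foldl _ _ _); apply: Fa.
move=> r x y; have := main r x; rewrite /= => <-.
exact: (linearD F).
Qed.

Lemma linear_klinear (M N : rmodType R) (f : {linear M -> N}) : linear (f : kv M -> kv N).
Proof. by move=> c x y; rewrite kv_scaleE linearP. Qed.

Definition klin (M N : rmodType R) (f : {linear M -> N}) : {linear kv M -> kv N} :=
  mklin (linear_klinear f).

(** * The module of a representation, given by one space with idempotents and arrow maps *)

Section RepModule.
Variables (V : lmodType k) (e : vertex Q -> {linear V -> V}) (al : arrow Q -> {linear V -> V}).
Hypothesis ee : forall x y v, e y (e x v) = if x == y then e x v else 0.
Hypothesis esum : forall v, \sum_x e x v = v.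
Hypothesis eal : forall x a v, e x (al a v) = if tgt a == x then al a v else 0.
Hypothesis ale : forall x a v, al a (e x v) = if x == src a then al a v else 0.

Definition walk_act (s : seq (arrow Q)) (v : V) := foldl (fun v a => al a v) v s.
Definition path_act (p : P) (v : V) := walk_act (val p).2 (e (val p).1 v).

Lemma walk_act_linear s : linear (walk_act s).
Proof. by elim: s => [|a s IH] c u v //=; rewrite linearP IH. Qed.

Lemma path_act_linear p : linear (path_act p).
Proof. by move=> c u v; rewrite /path_act linearP walk_act_linear. Qed.

Lemma walk_act0 s : walk_act s 0 = 0.
Proof. exact: (linear0 (mklin (walk_act_linear s))). Qed.

Lemma vertex_path_act x p v :
  e x (path_act p v) = if ptarget p == x then path_act p v else 0.
Proof.
rewrite /path_act /ptarget /walk_end; case: p => -[y s] /= _.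
elim/last_ind: s => [|s a _] /=; first exact: ee.
by rewrite -cats1 /walk_act foldl_cat /= eal map_cat last_cat.
Qed.

Lemma path_act_comp p q v : path_act q (path_act p v) =
  if pcomp p q is Some r then path_act r v else 0.
Proof.
rewrite {1}/path_act vertex_path_act; case: pcompP => [r epq er|].
  by rewrite epq eqxx /path_act er /= /walk_act foldl_cat.
by move/negbTE; rewrite /psource => ->; apply: walk_act0.
Qed.

Definition alg_act (f : A) (v : V) : V := linext (fun p => path_act p v) f.

Lemma alg_act_linear f : linear (alg_act f).
Proof.
move=> c u v; rewrite -linext_fun_lin; apply: eq_linext => p.
exact: path_act_linear.
Qed.

Lemma alg_actM (f g : A) v : alg_act g (alg_act f v) = alg_act (f * g) v.
Proof.
rewrite {2}/alg_act (linear_linext (phi := alg_act g)); last exact: alg_act_linear.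
rewrite /alg_act [RHS]linext_linext.
apply: eq_linext => p; rewrite /= linext_linext; apply: eq_linext => q.
rewrite path_act_comp /pbasis_mul; case: pcomp => [r|]; last by rewrite linext0.
by rewrite linextU.
Qed.

(* The [let] makes the type depend on the representation, so that its module structure can be
   inferred from it. *)
Definition rep_type : Type := let _ := (ee, esum, eal, ale) in V.
HB.instance Definition _ := GRing.Zmodule.on rep_type.
Definition rep_scale (r : R^c) (v : rep_type) : rep_type := alg_act r v.
Fact rep_scaleA a b u : rep_scale a (rep_scale b u) = rep_scale (a * b) u.
Proof. exact: alg_actM. Qed.
Fact rep_scale1 : left_id 1 rep_scale.
Proof.
move=> u; rewrite /rep_scale /alg_act linext_sum -[RHS]esum.
by apply: eq_bigr => x _; rewrite linextU.
Qed.
Fact rep_scaleDr : right_distributive rep_scale +%R.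
Proof. by move=> a u v; apply: (raddfD (mklin (alg_act_linear a))). Qed.
Fact rep_scaleDl u : {morph rep_scale^~ u : a b / a + b}.
Proof. by move=> a b; apply: linextD. Qed.
HB.instance Definition _ := GRing.Zmodule_isLmodule.Build R^c rep_type
  rep_scaleA rep_scale1 rep_scaleDr rep_scaleDl.

Lemma rep_vact x v : vact rep_type x v = e x v.
Proof. by rewrite ?vactE ?aactE -[LHS]/(rep_scale _ _) /rep_scale /alg_act /vertex_elt /arrow_elt path_elt.unlock linextU. Qed.

Lemma rep_aact a v : aact rep_type a v = al a v.
Proof.
rewrite ?vactE ?aactE -[LHS]/(rep_scale _ _) /rep_scale /alg_act /vertex_elt /arrow_elt path_elt.unlock linextU /path_act /=.
by rewrite ale eqxx.
Qed.

Lemma rep_kscale (c : k) (v : rep_type) : (c *: (v : kv rep_type)) = c *: (v : V).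
Proof.
rewrite kv_scaleE -[LHS]/(rep_scale _ _) /rep_scale /alg_act cst.unlock linextZ.
exact: (congr1 (fun u : V => c *: u) (rep_scale1 v)).
Qed.

(** The map [f] is the identity; the existential form hides the construction of the action. *)
Lemma rep_module_ex : exists (E : rmodType R) (f : {linear V -> kv E}),
  [/\ bijective f, forall x v, f (e x v) = vact E x (f v)
    & forall a v, f (al a v) = aact E a (f v)].
Proof.
have lf : linear (fun v : V => v : kv rep_type).
  by move=> c u v; rewrite (rep_kscale c u).
exists rep_type, (mklin lf); split=> [|x v|a v]; first by exists id.
  by rewrite [RHS]rep_vact.
by rewrite [RHS]rep_aact.
Qed.
End RepModule.
End Path.

(** * Finite-dimensional modules *)

Section LinearAlgebra.
Variable k : fieldType.

(** A subspace of largest dimension inside S is all of S, since adding the line through a missing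
    vector would enlarge it. *)
Lemma submodule_vspace (V : vectType k) (S : V -> Prop) : submodule S ->
  exists U : {vspace V}, forall x, x \in U <-> S x.
Proof.
move=> [S0 SD].
pose good n := `[< exists U : {vspace V}, \dim U = n /\ forall x, x \in U -> S x >].
have ex_good : exists n, good n.
  by exists 0; apply/asboolP; exists 0%VS; rewrite dimv0; split=> // x /[!memv0]/eqP ->.
have bound n : good n -> (n <= \dim {:V})%N.
  by move=> /asboolP[U [<- _]]; apply/dimvS/subvf.
case: (ex_maxnP ex_good bound) => n /asboolP[U [dU US]] max.
exists U => x; split=> [/US //|Sx]; apply: contrapT => xU.
have : good (\dim (U + <[x]>)).
  apply/asboolP; exists (U + <[x]>)%VS; split=> // _ /memv_addP[u uU [_ /vlineP[c ->] ->]].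
  by rewrite addrC; apply: SD => //; apply: US.
move/max; rewrite -dU => le.
have /eqP e : U == (U + <[x]>)%VS by rewrite eqEdim addvSl.
by apply: xU; rewrite e; apply: subvP (addvSr _ _) _ (memv_line x).
Qed.

Definition findim (V : lmodType k) : Prop :=
  exists n (f : {linear V -> 'rV[k]_n}), bijective f.

(** The map from k^T to V given by [g] is an isomorphism on a complement of its kernel. *)
Lemma spanned_findim (V : lmodType k) (T : finType) (g : T -> V) :
  (forall v, exists c : T -> k, v = \sum_t c t *: g t) -> findim V.
Proof.
move=> hg.
have lpi : linear (fun f : {ffun T -> k^o} => \sum_t f t *: g t).
  move=> c u v; rewrite scaler_sumr -big_split; apply: eq_bigr => t _.
  by rewrite !ffunE scalerDl scalerA.
have [|U hU] := @submodule_vspace {ffun T -> k^o} (fun f => mklin lpi f = 0).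
  by split=> [|c x y hx hy]; rewrite ?linear0 // linearP hx hy scaler0 addr0.
pose W := subvs_of (U^C)%VS.
pose f : {linear W -> V} := mklin lpi \o (vsval : {linear W -> {ffun T -> k^o}}).
have bf : bijective f.
  apply: inj_surj_bij => [|v].
    apply: linear_eq0_inj => w /hU wU; apply: val_inj; apply/eqP; rewrite -memv0.
    by rewrite -(capv_compl U) memv_cap wU subvsP.
  have [c ->] := hg v.
  pose fc : {ffun T -> k^o} := finfun c.
  have : fc \in (U + U^C)%VS by rewrite addv_complf memvf.
  case/memv_addP => u uU [w wW e].
  exists (vsproj _ w); rewrite /= vsprojK //.
  rewrite -[LHS]/(mklin lpi w) (_ : w = fc - u); last by rewrite e addrC addKr.
  rewrite linearB (hU u).1 // subr0 /=.
  by apply: eq_bigr => t _; rewrite ffunE.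
have [h [fh hf]] := bij_linear_inv bf.
exists (dim W), ((v2r : {linear W -> 'rV_(dim W)}) \o h).
apply: bij_comp; first by exists r2v; [exact: v2rK | exact: r2vK].
by exists f.
Qed.

Lemma findim_axiom (V : lmodType k) : findim V -> {n & Vector.axiom n V}.
Proof. by move/cid=> [n /cid[f bf]]; exists n, f => //; apply: linearP. Qed.

Lemma vect_section (V W : vectType k) (f : {linear V -> W}) :
  (forall w, exists v, f v = w) -> exists s : {linear W -> V}, forall w, f (s w) = w.
Proof.
move=> sf; exists ((linfun f)^-1)%VF => w; rewrite /= -[f _]lfunE limg_lfunVK //.
by have [v <-] := sf w; rewrite -[f v]lfunE memv_img // memvf.
Qed.

Lemma vect_retraction (V W : vectType k) (f : {linear V -> W}) :
  injective f -> exists r : {linear W -> V}, forall v, r (f v) = v.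
Proof.
move=> inj; exists ((linfun f)^-1)%VF => v; rewrite /= -[f v](lfunE f) lker0_lfunK //.
by apply/lker0P => x y; rewrite !lfunE => /inj.
Qed.
End LinearAlgebra.

Definition findim_modules (k : fieldType) (Q : quiver) : Prop :=
  forall M : fgmod (kQ k Q), findim (kv M).

Lemma finite_paths_findim (k : fieldType) (Q : quiver) (s : seq (qpath Q)) :
  (forall p, p \in s) -> findim_modules k Q.
Proof.
move=> hs M; have [n [g hg]] := fgmod_fg M.
pose d := [fset p in s]%fset.
apply: (@spanned_findim _ _ {: 'I_n * d} (fun t => elt M (path_elt k (val t.2)) (g t.1))) => v.
have [c ->] := hg v; exists (fun t => mcoeff (val t.2) (c t.1 : {malg k[qpath Q]})).
rewrite -(pair_bigA _ (fun i p => mcoeff (val p) (c i : {malg k[qpath Q]}) *: elt M (path_elt k (val p)) (g i))) /=.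
apply: eq_bigr => i _; rewrite -[LHS]/(elt M (c i) (g i)) elt_linext.
rewrite (@linextEw _ _ _ _ d); last by apply/fsubsetP => p _; rewrite inE /= hs.
by rewrite big_seq_fsetE.
Qed.

Section FinDim.
Variables (k : fieldType) (Q : quiver).
Local Notation R := (kQ k Q).
Local Notation modR := (fgmod R).

(* [fin] is an argument so that the [vectType] structure can be inferred. *)
Definition kf (fin : findim_modules k Q) (M : modR) : Type := kv M.

Section Instances.
Variables (fin : findim_modules k Q) (M : modR).
HB.instance Definition _ := GRing.Lmodule.on (kf fin M).
Definition kf_axiom : {n & Vector.axiom n (kf fin M)} := findim_axiom (fin M).
HB.instance Definition _ := Lmodule_hasFinDim.Build k (kf fin M) (projT2 kf_axiom).
End Instances.

Hypothesis fin : findim_modules k Q.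
Local Notation kF := (kf fin).

Lemma kQ_noetherian : noetherian R.
Proof.
move=> M S hS; have [K [i [inj hi]]] := submodule_ex hS.
have [|U hU] := @submodule_vspace k (kF M) S.
  by case: hS => S0 SD; split=> // c x y; apply: SD.
pose b := vbasis U.
have /choice[z hz] : forall j : 'I_(\dim U), exists z, i z = b`_j.
  move=> j; apply/hi/hU; rewrite vbasis_mem // mem_nth // size_tuple.
  exact: ltn_ord.
have fgK : finitely_generated K.
  exists (\dim U), z => x; have /hU xU : S (i x) by apply/hi; exists x.
  exists (fun j => cst Q (coord b j (i x : kF M))); apply: inj; rewrite linear_sum.
  rewrite [LHS](coord_vbasis xU); apply: eq_bigr => j _.
  by rewrite linearZ hz.
by exists (FGMod fgK), i.
Qed.

Section Extensions.
Implicit Types (X Y : modR).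

Lemma grade_map (M N : modR) (h : {linear kv N -> kv M}) :
  exists g : {linear kv N -> kv M}, forall y, g y = \sum_x vact M x (h (vact N x y)).
Proof.
have lg : linear (fun y : kv N => \sum_x vact M x (h (vact N x y)) : kv M).
  move=> c u v; rewrite scaler_sumr -big_split; apply: eq_bigr => x _.
  by rewrite !linearP.
by exists (mklin lg).
Qed.

Lemma grade_map_vact (M N : modR) (h : {linear kv N -> kv M}) x y :
  vact M x (\sum_z vact M z (h (vact N z y))) =
  \sum_z vact M z (h (vact N z (vact N x y))).
Proof.
rewrite linear_sum; apply: eq_bigr => z _; rewrite !vact_vact.
by case: (eqVneq z x) => [->|nzx] //; rewrite !linear0.
Qed.

(** Replace a k-linear section s by the sum of e_x s e_x over the vertex idempotents; it is still a
    section because [f] commutes with every e_x. *)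
Lemma graded_section (M N : modR) (f : {linear M -> N}) :
  (forall y, exists x, f x = y) ->
  exists s : {linear kv N -> kv M}, (forall y, f (s y) = y) /\
    forall x y, vact M x (s y) = s (vact N x y).
Proof.
move=> sf; have [s0 hs0] := @vect_section k (kF M) (kF N) (klin f) sf.
have [s hs] := grade_map s0; exists s; split=> [y|x y]; rewrite !hs.
  rewrite -[LHS]/(klin f _) linear_sum -[RHS](vact_sum y); apply: eq_bigr => x _.
  by rewrite [LHS]linear_vact [f _]hs0 vact_vact eqxx.
exact: grade_map_vact.
Qed.

Lemma graded_retraction (M N : modR) (f : {linear M -> N}) : injective f ->
  exists r : {linear kv N -> kv M}, (forall y, r (f y) = y) /\
    forall x y, vact M x (r y) = r (vact N x y).
Proof.
move=> inj; have [r0 hr0] := @vect_retraction k (kF M) (kF N) (klin f) inj.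
have [r hr] := grade_map r0; exists r; split=> [y|x y]; rewrite !hr.
  rewrite -[RHS](vact_sum y); apply: eq_bigr => x _.
  by rewrite -[vact N x _]linear_vact [r0 _]hr0 vact_vact eqxx.
exact: grade_map_vact.
Qed.
End Extensions.
End FinDim.

(** * Extensions as cocycles *)

Lemma fg_spanned (R : pzRingType) (M : rmodType R) (T : finType) (g : T -> M) :
  (forall x, exists c : T -> R^c, x = \sum_t c t *: g t) -> finitely_generated M.
Proof.
move=> h; exists #|T|, (g \o enum_val) => x; have [c ->] := h x.
by exists (c \o enum_val); rewrite (reindex _ (onW_bij _ (@enum_val_bij T))).
Qed.

Lemma fg_ses (R : pzRingType) (Y X : fgmod R) (E : rmodType R)
    (i : {linear Y -> E}) (p : {linear E -> X}) :
  short_exact i p -> finitely_generated E.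
Proof.
move=> [_ hp sp]; have [n [g hg]] := fgmod_fg Y; have [m [h hh]] := fgmod_fg X.
have /choice[e he] := fun j => sp (h j).
apply: (@fg_spanned _ _ ('I_n + 'I_m)%type
  (fun t => match t with inl l => i (g l) | inr j => e j end)) => x.
have [d hd] := hh (p x).
have /hp[y hy] : p (x - \sum_j d j *: e j) = 0.
  rewrite linearB hd linear_sum -sumrB big1 // => j _.
  by rewrite linearZ he subrr.
have [c hc] := hg y.
exists (fun t => match t with inl l => c l | inr j => d j end).
rewrite big_sumType /=; apply/eqP; rewrite -subr_eq -hy hc linear_sum; apply/eqP.
by apply: eq_bigr => l _; rewrite linearZ.
Qed.

Section Twist.
Variables (k : fieldType) (Q : quiver).
Local Notation R := (kQ k Q).
Local Notation modR := (fgmod R).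
Implicit Types X Y E : rmodType R.

(* [g] lists the off-diagonal blocks of the arrows of an extension of X by Y *)
Definition cochain X Y (g : arrow Q -> {linear kv X -> kv Y}) : Prop :=
  (forall x a m, vact Y x (g a m) = if tgt a == x then g a m else 0) /\
  (forall x a m, g a (vact X x m) = if x == src a then g a m else 0).

(** E is Y (+) s(X) with arrows acting by upper triangular block matrices: [g] measures the failure
    of the graded section [s] to commute with the arrows. *)
Definition presents X Y E (i : {linear Y -> E}) (p : {linear E -> X})
    (s : {linear kv X -> kv E}) (g : arrow Q -> {linear kv X -> kv Y}) : Prop :=
  [/\ short_exact i p, forall m, p (s m) = m, forall x m, vact E x (s m) = s (vact X x m)
    & forall a m, aact E a (s m) = i (g a m) + s (aact X a m)].

(** There is no cocycle condition to check: a path algebra has no relations, so any blocks for the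
    arrows define a module. This is the source of heredity. *)
Lemma twist_ex X Y g : cochain g ->
  exists E (i : {linear Y -> E}) (p : {linear E -> X}) (s : {linear kv X -> kv E}),
    presents i p s g.
Proof.
move=> [g1 g2]; pose V : lmodType k := (kv Y * kv X)%type.
pose e x : {linear V -> V} := pairm (vact Y x \o fst) (vact X x \o snd).
pose al a : {linear V -> V} := pairm (copairm (aact Y a) (g a)) (aact X a \o snd).
have [|||| E [f [bf fe fa]]] := @rep_module_ex k Q V e al.
- move=> x y [v w]; rewrite /= !vact_vact; by case: eqP.
- move=> v; transitivity (\sum_x vact Y x v.1, \sum_x vact X x v.2); last first.
    by rewrite !vact_sum -surjective_pairing.
  by apply: (big_rec3 (fun x y z => z = (x, y))) => // x y1 y2 y3 _ ->.
- move=> x a [v w]; rewrite /=; rewrite linearD !vact_aact g1 /=.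
  by case: eqP => //; rewrite addr0.
- move=> x a [v w]; rewrite /= !aact_vact g2 /=.
  by case: eqP => //; rewrite addr0.
have [h [fK hK]] := bij_linear_inv bf.
have hv x m : h (vact E x m) = e x (h m) by apply: (can_inj fK); rewrite fe !hK.
have ha a m : h (aact E a m) = al a (h m) by apply: (can_inj fK); rewrite fa !hK.
have li : linear (fun y : Y => f (y, 0) : E).
  apply: (@klinear_linear _ _ Y E (f \o (pairm idfun \0 : {linear kv Y -> V}))).
  - exact: linearP.
  - by move=> x m; rewrite /= -fe /e /= linear0.
  - by move=> a m; rewrite /= -fa /al /= !linear0 addr0.
have lp : linear (fun m : E => (h m).2 : X).
  apply: (@klinear_linear _ _ E X (snd \o h)).
  - exact: linearP.
  - by move=> x m; rewrite /= hv.
  - by move=> a m; rewrite /= ha.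
exists E, (mklin li), (mklin lp), (f \o (pairm \0 idfun : {linear kv X -> V})).
split=> [|m|x m|a m].
- split=> [y y' /(can_inj fK)[] //|m /=|z]; last by exists (f (0, z)); rewrite /= fK.
  split=> [e0|[y <-]]; last by rewrite fK.
  by exists (h m).1; rewrite -[RHS]hK [in RHS](surjective_pairing (h m)) e0.
- by rewrite /= fK.
- by rewrite /= -fe /e /= linear0.
- rewrite /= -fa -[RHS](linearD f); congr (f _); congr pair => /=.
    by rewrite linear0 add0r addr0.
  by rewrite add0r.
Qed.

(** In block form F is diagonal with entries [phi] and [psi]; the hypothesis on [g1] and [g2] says
    that F commutes with the arrows. *)
Lemma presents_map X1 Y1 E1 (i1 : {linear Y1 -> E1}) (p1 : {linear E1 -> X1}) s1 g1
    X2 Y2 E2 (i2 : {linear Y2 -> E2}) (p2 : {linear E2 -> X2}) s2 g2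
    (phi : {linear Y1 -> Y2}) (psi : {linear X1 -> X2}) :
  presents i1 p1 s1 g1 -> presents i2 p2 s2 g2 ->
  (forall a m, phi (g1 a m) = g2 a (psi m)) ->
  exists F : {linear E1 -> E2}, (forall y, F (i1 y) = i2 (phi y)) /\
    forall m, p2 (F m) = psi (p1 m).
Proof.
move=> [ses1 ps1 vs1 as1] [ses2 ps2 vs2 as2] hg; have [inj1 hp1 sp1] := ses1.
have [r hr] : exists r : {linear kv E1 -> kv Y1}, forall m, klin i1 (r m) = (idfun \- (s1 \o klin p1)) m.
  apply: (@factor_mono _ (kv Y1) (kv E1) (kv E1) (klin i1)) => // m; apply/hp1.
  by rewrite [LHS](linearB p1) /= ps1 subrr.
have hr' m : i1 (r m) = m - s1 (p1 m) by apply: hr.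
have rv x m : r (vact E1 x m) = vact Y1 x (r m).
  apply: inj1; rewrite hr' linear_vact linear_vact hr' -vs1.
  by rewrite [RHS](linearB (vact E1 x)).
have ra a m : r (aact E1 a m) = aact Y1 a (r m) + g1 a (p1 m).
  apply: inj1; rewrite hr' (linearD i1) linear_aact linear_aact hr'.
  by rewrite (linearB (aact E1 a)) as1 opprD -!addrA [X in _ = _ + (_ + X)]addrC addKr.
pose F0 : {linear kv E1 -> kv E2} := (klin i2 \o klin phi \o r) \+ (s2 \o klin psi \o klin p1).
have F0E m : F0 m = i2 (phi (r m)) + s2 (psi (p1 m)) by [].
have lF : linear (F0 : E1 -> E2).
  apply: (@klinear_linear _ _ E1 E2 F0); first exact: linearP.
    move=> x m; rewrite !F0E rv (linearD (vact E2 x)) vs2.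
    by rewrite !(linear_vact phi, linear_vact i2, linear_vact p1, linear_vact psi).
  move=> a m; rewrite !F0E ra (linearD (aact E2 a)) as2 (linearD phi) (linearD i2).
  rewrite hg !(linear_aact phi, linear_aact i2, linear_aact p1, linear_aact psi).
  by rewrite -addrA; congr (_ + _).
exists (mklin lF); split=> [y|m].
  rewrite [LHS]F0E (ses_pi ses1) !linear0 addr0; congr (i2 (phi _)).
  by apply: inj1; rewrite hr' (ses_pi ses1) linear0 subr0.
by rewrite [F in p2 F]F0E linearD (ses_pi ses2) add0r ps2.
Qed.

Hypothesis fin : findim_modules k Q.

Lemma ses_presents (X Y E : modR) (i : {linear Y -> E}) (p : {linear E -> X}) :
  short_exact i p -> exists s g, cochain g /\ presents i p s g.
Proof.
move=> ses; have [inj hp sp] := ses; have [s [ps vs]] := graded_section fin sp.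
have /choice[g hg] : forall a, exists g : {linear kv X -> kv Y}, forall m,
    klin i (g m) = ((aact E a \o s) \- (s \o aact X a)) m.
  move=> a; apply: (@factor_mono _ (kv Y) (kv E) (kv X) (klin i)) => // m; apply/hp.
  by rewrite [LHS](linearB p) /= linear_aact !ps subrr.
have hg' a m : i (g a m) = aact E a (s m) - s (aact X a m) by apply: hg.
exists s, g; split; split=> //.
- move=> x a m; apply: inj; rewrite linear_vact hg' (linearB (vact E x)) vs !vact_aact.
  by case: eqP => _; rewrite ?hg' // (linear0 s) (linear0 i) subrr.
- move=> x a m; apply: inj; rewrite hg' -vs !aact_vact.
  by case: eqP => _; rewrite ?hg' // (linear0 s) (linear0 i) subrr.
- by move=> a m; rewrite hg' subrK.
Qed.

(** The blocks are lifted through a graded section of [f]; dually, the next lemma extends them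
    through a graded retraction of [m]. *)
Lemma kQ_extensions_lift : extensions_lift R.
Proof.
move=> V J N C i p f ses sf; have [s [g [[g1 g2] pg]]] := ses_presents ses.
have [t [ft vt]] := graded_section fin sf.
pose g' a : {linear kv C -> kv V} := t \o g a.
have cg' : cochain g'.
  split=> x a m; rewrite /g' /= ?vt ?g1 ?g2; by case: eqP; rewrite ?linear0.
have [E0 [j0 [q0 [s0 pr]]]] := twist_ex cg'; have [ses0 _ _ _] := pr.
pose E : modR := FGMod (fg_ses ses0).
have [|F [Fi pF]] := presents_map (phi := f) (psi := idfun) pr pg.
  by move=> a m; rewrite /g' /= ft.
exists E, j0, F; split=> //; have [inj0 h0 surj0] := ses0; split=> //.
  by move=> y; rewrite -h0 -[q0 y]pF.
by move=> z; have [y <-] := surj0 z; exists y; apply: pF.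
Qed.

Lemma kQ_extensions_extend : extensions_extend R.
Proof.
move=> Y E' X' X i p m ses inj; have [s [g [[g1 g2] pg]]] := ses_presents ses.
have [r [rm vr]] := graded_retraction fin inj.
pose g' a : {linear kv X -> kv Y} := g a \o r.
have cg' : cochain g' by split=> x a u; rewrite /g' /= -?vr ?g1 ?g2.
have [E0 [j0 [q0 [s0 pr]]]] := twist_ex cg'; have [ses0 _ _ _] := pr.
pose E : modR := FGMod (fg_ses ses0).
have [|F [Fi pF]] := presents_map (phi := idfun) (psi := m) pg pr.
  by move=> a u; rewrite /g' /= rm.
by exists E, j0, q0, F.
Qed.
End Twist.

(** * The Euler form *)

Section FamilyDim.
Variables (k : fieldType) (V W : vectType k) (T : finType).
Variables (p : T -> {linear V -> V}) (r : T -> {linear W -> W}).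
Hypothesis pp : forall t v, p t (p t v) = p t v.
Hypothesis rr : forall t v, r t (r t v) = r t v.
Local Notation Z := {ffun T -> 'Hom(V, W)}.
Local Notation P t := (limg (linfun (p t))).
Local Notation S t := (limg (linfun (r t))).

Lemma memv_limg (U : vectType k) (f : {linear U -> U}) v :
  (forall v, f (f v) = f v) -> reflect (f v = v) (v \in limg (linfun f)).
Proof.
move=> ff; apply: (iffP memv_imgP) => [[w _ ->]|<-]; first by rewrite lfunE /= ff.
by exists v; rewrite ?memvf // lfunE.
Qed.

Let I : finType := {t : T & 'I_(\dim (P t)) * 'I_(\dim (S t))}%type.

Let emb_fun (c : {ffun I -> k^o}) t (v : V) : W :=
  \sum_(i < \dim (P t)) \sum_(j < \dim (S t))
    (c (Tagged _ (i, j)) * coord (vbasis (P t)) i (p t v)) *: (vbasis (S t))`_j.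

Let emb_lin c t : linear (emb_fun c t).
Proof.
move=> a u v; rewrite /emb_fun scaler_sumr -big_split; apply: eq_bigr => i _.
rewrite scaler_sumr -big_split; apply: eq_bigr => j _ /=.
by rewrite !linearP mulrDr scalerDl scalerA mulrCA.
Qed.

Let emb (c : {ffun I -> k^o}) : Z := [ffun t => linfun (mklin (@emb_lin c t))].

Let embE c t v : emb c t v = emb_fun c t v.
Proof. by rewrite ffunE lfunE. Qed.

Let emb_linear : linear emb.
Proof.
move=> a c d; apply/ffunP => t; apply/lfunP => v.
rewrite embE !ffunE add_lfunE scale_lfunE -!embE !ffunE -/(emb _ _).
rewrite !lfunE /= /emb_fun scaler_sumr -big_split; apply: eq_bigr => i _.
rewrite scaler_sumr -big_split; apply: eq_bigr => j _ /=.
by rewrite !ffunE mulrDl scalerDl scalerA mulrA.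
Qed.

Let basisP t (i : 'I_(\dim (P t))) : p t (vbasis (P t))`_i = (vbasis (P t))`_i.
Proof. by apply/(memv_limg _ (pp t))/vbasis_mem/mem_nth; rewrite size_tuple. Qed.

Let coord_basis (U : {vspace V}) (i i' : 'I_(\dim U)) :
  coord (vbasis U) i (vbasis U)`_i' = (i' == i)%:R.
Proof. by apply: coord_free; apply: basis_free (vbasisP U). Qed.

Let coord_basisW (U : {vspace W}) (i i' : 'I_(\dim U)) :
  coord (vbasis U) i (vbasis U)`_i' = (i' == i)%:R.
Proof. by apply: coord_free; apply: basis_free (vbasisP U). Qed.

Let emb_coord c t (i : 'I_(\dim (P t))) (j : 'I_(\dim (S t))) :
  coord (vbasis (S t)) j (emb c t (vbasis (P t))`_i) = c (Tagged _ (i, j)).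
Proof.
rewrite embE /emb_fun linear_sum (bigD1 i) //= linear_sum (bigD1 j) //=.
rewrite linearZ /= basisP !coord_basisW coord_basis !eqxx !mulr1.
rewrite big1 ?addr0 => [|l nl]; last first.
  by rewrite linearZ /= coord_basisW (negbTE nl) mulr0.
rewrite big1 ?addr0 // => l nl; rewrite linear_sum big1 // => m _.
by rewrite coord_basis eq_sym (negbTE nl) mulr0 scale0r linear0.
Qed.

(** A family is one matrix for each t, in bases of the images of [p t] and [r t]; [emb] turns
    matrices into families. It is applied with t a vertex for [C0] and t an arrow for [C1]. *)
Lemma family_dim (U : {vspace Z}) :
  (forall g, g \in U <-> forall t v, r t (g t (p t v)) = g t v) ->
  \dim U = (\sum_t \dim (P t) * \dim (S t))%N.
Proof.
move=> hU; pose E : {linear {ffun I -> k^o} -> Z} := mklin emb_linear.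
have injE : injective E.
  by move=> c d e; apply/ffunP => -[t [i j]]; rewrite -[LHS]emb_coord -[emb c]/(E c) e emb_coord.
have -> : U = limg (linfun E).
  apply/vspaceP => g; apply/idP/memv_imgP => [/hU gU|[c _ ->]]; last first.
    apply/hU => t v; rewrite lfunE /= !embE /emb_fun linear_sum; apply: eq_bigr => i _.
    rewrite linear_sum; apply: eq_bigr => j _; rewrite linearZ /= pp; congr (_ *: _).
    by apply/(memv_limg _ (rr t))/vbasis_mem/mem_nth; rewrite size_tuple.
  exists [ffun u : I => let: existT t (i, j) := u in
    coord (vbasis (S t)) j (g t (vbasis (P t))`_i)]; first exact: memvf.
  apply/ffunP => t; apply/lfunP => v; rewrite lfunE /= embE /emb_fun.
  have -> : g t v = g t (p t v) by rewrite -gU -[RHS]gU pp.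
  have pvP : p t v \in P t by apply/(memv_limg _ (pp t))/pp.
  rewrite [in LHS](coord_vbasis pvP) linear_sum; apply: eq_bigr => i _.
  rewrite linearZ /=.
  have gS : g t (vbasis (P t))`_i \in S t by apply/(memv_limg _ (rr t)); rewrite -[in RHS]gU basisP.
  rewrite [in LHS](coord_vbasis gS) scaler_sumr; apply: eq_bigr => j _.
  by rewrite ffunE scalerA mulrC.
have /lker0P k0 : injective (linfun E) by move=> c d; rewrite !lfunE => /injE.
rewrite limg_dim_eq; last by rewrite (eqP k0) capv0.
rewrite dimvf /dim /= muln1 card_tagged sumnE big_map big_enum /=.
by apply: eq_bigr => t _; rewrite card_prod !card_ord.
Qed.
End FamilyDim.

Lemma ffun_lfunP (k : fieldType) (V W : vectType k) (T : finType)
    (c : k) (f g : {ffun T -> 'Hom(V, W)}) t v :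
  (c *: f + g) t v = c *: f t v + g t v.
Proof. by rewrite !ffunE add_lfunE scale_lfunE. Qed.

Section Euler.
Variables (k : fieldType) (Q : quiver) (fin : findim_modules k Q).
Local Notation R := (kQ k Q).
Local Notation modR := (fgmod R).
Local Notation kF := (kf fin).
Implicit Types (X Y M N : modR).

Definition mdim M : nat := \dim {: kF M}.

Definition vactf M x : {linear kF M -> kF M} := vact M x.
Definition aactf M a : {linear kF M -> kF M} := aact M a.
Definition dimvec M x : nat := \dim (limg (linfun (vactf M x))).

Lemma vactfK M x m : vactf M x (vactf M x m) = vactf M x m.
Proof. by rewrite [LHS]vact_vact eqxx. Qed.

Definition linf M N (f : {linear M -> N}) : {linear kF M -> kF N} := klin f.

Lemma linf_ker0 M N (f : {linear M -> N}) : injective f -> lker (linfun (linf f)) == 0%VS.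
Proof. by move=> inj; apply/lker0P => x y; rewrite !lfunE => /inj. Qed.

Lemma mdim_inj M N (f : {linear M -> N}) : injective f -> (mdim M <= mdim N)%N.
Proof.
move/linf_ker0 => k0; rewrite /mdim -(limg_dim_eq (f := linfun (linf f))) ?dimvS ?subvf //.
by rewrite (eqP k0) capv0.
Qed.

Lemma inj_mdim_surj M N (f : {linear M -> N}) :
  injective f -> (mdim N <= mdim M)%N -> forall y, exists x, f x = y.
Proof.
move=> /linf_ker0 k0; rewrite /mdim -(limg_dim_eq (f := linfun (linf f))) => [le|].
  have /eqP e : limg (linfun (linf f)) == fullv by rewrite eqEdim subvf.
  move=> y; have /memv_imgP[x _ ->] : (y : kF N) \in limg (linfun (linf f)) by rewrite e memvf.
  by exists x; rewrite lfunE.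
by rewrite (eqP k0) capv0.
Qed.

Lemma mdim_surj M N (f : {linear M -> N}) :
  (forall y, exists x, f x = y) ->
  (mdim N <= mdim M)%N /\ ((mdim M <= mdim N)%N -> injective f).
Proof.
move=> sf; have e : limg (linfun (linf f)) = fullv.
  apply/vspaceP => y; rewrite memvf; apply/memv_imgP; have [x <-] := sf y.
  by exists x; rewrite ?memvf ?lfunE.
have := limg_ker_dim (linfun (linf f)) fullv; rewrite e capfv -/(mdim N) -/(mdim M) => h.
split=> [|le]; first by rewrite -h leq_addl.
have : \dim (lker (linfun (linf f))) == 0.
  by rewrite -leqn0 -(leq_add2r (mdim N)) h.
by rewrite dimv_eq0 => /lker0P inj x y e'; apply: inj; rewrite !lfunE.
Qed.

Lemma mdim0 M : mdim M = 0 <-> zero_mod M.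
Proof.
split=> [/eqP|z]; last first.
  by apply/eqP; rewrite /mdim dimv_eq0 -subv0; apply/subvP => x _; rewrite [x]z mem0v.
by rewrite /mdim dimv_eq0 => /eqP e x; have := memvf (x : kF M); rewrite e memv0 => /eqP.
Qed.

Lemma dimvec_inj M N (f : {linear M -> N}) x : injective f -> (dimvec M x <= dimvec N x)%N.
Proof.
move=> /linf_ker0 k0; rewrite /dimvec.
rewrite -(limg_dim_eq (f := linfun (linf f))); last by rewrite (eqP k0) capv0.
apply/dimvS/subvP => _ /memv_imgP[_ /memv_imgP[m _ ->] ->].
by rewrite !lfunE [X in X \in _]linear_vact; apply/memv_limg; rewrite ?[LHS]vact_vact ?eqxx //;
  move=> v; apply: vactfK.
Qed.

Lemma dimvec_iso M N x : mod_iso M N -> dimvec M x = dimvec N x.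
Proof.
move=> /mod_isoE[f [g [fK gK]]]; apply/eqP; rewrite eqn_leq.
by rewrite (dimvec_inj x (can_inj fK)) (dimvec_inj x (can_inj gK)).
Qed.

Lemma mdim_sum M : mdim M = (\sum_x dimvec M x)%N.
Proof.
have d : directv (\sum_x limg (linfun (vactf M x))).
  apply/directv_sum_independent => u uP su x _.
  have ux y : vactf M y (u y) = u y.
    by have := uP y isT; case/memv_imgP => m _ ->; rewrite lfunE /= vactfK.
  have := congr1 (vactf M x) su; rewrite linear0 linear_sum (bigD1 x) //= ux big1 ?addr0 //.
  by move=> y nyx; rewrite -(ux y) [LHS]vact_vact (negbTE nyx).
rewrite /dimvec -(directvP d) /=; congr (\dim _); apply/esym/vspaceP => m; rewrite memvf.
rewrite -[m](vact_sum (M := M)); apply: memv_suml => x _.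
by rewrite (subvP (sumv_sup x _ (subvv _))) //; apply/memv_imgP; exists m; rewrite ?memvf ?lfunE.
Qed.

(* [C0 -> C1] computes Hom(X, Y) as its kernel and Ext^1(X, Y) as its cokernel; [C0] consists of
   the maps respecting the vertex grading, and [C1] of families of maps X_(src a) -> Y_(tgt a). *)
Section Complex.
Variables X Y : modR.
Local Notation H := 'Hom(kF X, kF Y).

Lemma homk_linear (f : H) : linear (f : kv X -> kv Y).
Proof. exact: (linearP f). Qed.
Definition homk (f : H) : {linear kv X -> kv Y} := mklin (homk_linear f).

Lemma vertex_maps_ex : exists U : {vspace H},
  forall f, f \in U <-> forall x m, f (vactf X x m) = vactf Y x (f m).
Proof.
apply: submodule_vspace; split=> [x m|c f g hf hg x m].
  by rewrite !zero_lfunE linear0.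
by rewrite !add_lfunE !scale_lfunE hf hg linearP.
Qed.
Definition C0 : {vspace H} := sval (cid vertex_maps_ex).
Lemma C0P f : f \in C0 <-> forall x m, f (vactf X x m) = vactf Y x (f m).
Proof. exact: svalP (cid vertex_maps_ex) f. Qed.

Lemma cochains_ex : exists U : {vspace {ffun arrow Q -> H}}, forall g, g \in U <->
  forall a m, vactf Y (tgt a) (g a (vactf X (src a) m)) = g a m.
Proof.
apply: submodule_vspace; split=> [x m|c f g hf hg x m].
  by rewrite !ffunE !zero_lfunE linear0.
by rewrite !ffunE !add_lfunE !scale_lfunE linearP hf hg.
Qed.
Definition C1 : {vspace {ffun arrow Q -> H}} := sval (cid cochains_ex).
Lemma C1P (g : {ffun arrow Q -> H}) :
  g \in C1 <-> forall a m, vactf Y (tgt a) (g a (vactf X (src a) m)) = g a m.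
Proof. exact: svalP (cid cochains_ex) g. Qed.

Lemma dim_C1 : \dim C1 = (\sum_a dimvec X (src a) * dimvec Y (tgt a))%N.
Proof.
apply: (family_dim (p := fun a => vactf X (src a)) (r := fun a => vactf Y (tgt a))) C1P.
  by move=> a v; apply: vactfK.
by move=> a v; apply: vactfK.
Qed.

(** An element of [C0] is a single map; it is identified with the family of its vertex components,
    from which it is recovered by summation. *)
Lemma dim_C0 : \dim C0 = (\sum_x dimvec X x * dimvec Y x)%N.
Proof.
pose Z := {ffun vertex Q -> H}.
have [|U hU] := @submodule_vspace _ Z (fun g =>
    forall x m, vactf Y x (g x (vactf X x m)) = g x m).
  split=> [x m|c f g hf hg x m]; first by rewrite !ffunE !zero_lfunE linear0.
  by rewrite !ffunE !add_lfunE !scale_lfunE linearP hf hg.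
rewrite /dimvec -(family_dim (p := vactf X) (r := vactf Y) _ _ hU); try by move=> *; apply: vactfK.
pose s (f : H) : Z := [ffun x => (linfun (vactf Y x) \o f \o linfun (vactf X x))%VF].
have sE f x m : s f x m = vactf Y x (f (vactf X x m)).
  by rewrite ffunE !comp_lfunE !lfunE.
have ls : linear s.
  move=> c f g; apply/ffunP => x; apply/lfunP => m.
  by rewrite ffun_lfunP !sE add_lfunE scale_lfunE linearP.
have sC0 f : f \in C0 -> forall m, f m = \sum_x s f x m.
  move/C0P => hf m; rewrite -{1}[m](vact_sum (M := X)) linear_sum; apply: eq_bigr => x _.
  by rewrite [LHS]hf sE hf vactfK.
rewrite -(limg_dim_eq (f := linfun (mklin ls))); last first.
  apply/eqP; rewrite -subv0; apply/subvP => f /memv_capP[fC0]; rewrite memv_ker lfunE /= memv0.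
  move/eqP => sf; apply/eqP/lfunP => m; rewrite sC0 // zero_lfunE big1 // => x _.
  by rewrite sf ffunE zero_lfunE.
congr (\dim _); apply/vspaceP => g; apply/memv_imgP/idP => [[f fC0 ->]|/hU gU].
  by apply/hU => x m; rewrite lfunE /= !sE !vactfK.
have gx x y m : vactf Y y (g x m) = if x == y then g x m else 0.
  by rewrite -gU [LHS]vact_vact.
have gy x y m : g x (vactf X y m) = if x == y then g x m else 0.
  rewrite -gU [vactf X x (vactf X y m)]vact_vact eq_sym.
  by case: eqP => [<-|_]; [exact: gU | rewrite !linear0].
pose f : H := \sum_x g x.
have fE m : f m = \sum_x g x m by rewrite sum_lfunE.
exists f.
  apply/C0P => x m; rewrite !fE linear_sum; apply: eq_bigr => y _.
  by rewrite gx gy.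
apply/ffunP => x; apply/lfunP => m; rewrite lfunE /= sE fE (bigD1 x) //= big1 ?addr0.
  by rewrite gU.
by move=> y ny; rewrite gy (negbTE ny).
Qed.

Definition dfun (f : H) : {ffun arrow Q -> H} :=
  [ffun a => (f \o linfun (aactf X a))%VF - (linfun (aactf Y a) \o f)%VF].

Lemma dfunE f a m : dfun f a m = f (aactf X a m) - aactf Y a (f m).
Proof. by rewrite ffunE add_lfunE opp_lfunE !comp_lfunE !lfunE. Qed.

Lemma dfun_linear : linear dfun.
Proof.
move=> c f g; apply/ffunP => a; apply/lfunP => m.
rewrite ffun_lfunP !dfunE !add_lfunE !scale_lfunE linearP.
by rewrite scalerBr opprD addrACA.
Qed.
Definition dif := linfun (mklin dfun_linear).

Lemma difE f a m : dif f a m = f (aactf X a m) - aactf Y a (f m).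
Proof. by rewrite lfunE /= dfunE. Qed.

Definition homR : {vspace H} := (C0 :&: lker dif)%VS.

Lemma homR_linear (f : H) : f \in homR -> exists F : {linear X -> Y}, forall m, F m = f m.
Proof.
case/memv_capP => /C0P fv; rewrite memv_ker => /eqP/ffunP fa.
have lf : linear (f : X -> Y).
  apply: (@klinear_linear _ _ X Y f); [exact: homk_linear|exact: fv|].
  move=> a m; apply/eqP; rewrite -subr_eq0; apply/eqP.
  by rewrite -[LHS](difE f a m) fa ffunE zero_lfunE.
by exists (mklin lf).
Qed.

Lemma linear_homR (F : {linear X -> Y}) : linfun (linf F) \in homR.
Proof.
apply/memv_capP; split; first by apply/C0P => x m; rewrite !lfunE; apply: linear_vact.
rewrite memv_ker; apply/eqP/ffunP => a; apply/lfunP => m.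
rewrite difE ffunE zero_lfunE !lfunE; apply/eqP; rewrite subr_eq0; apply/eqP.
exact: linear_aact.
Qed.

(** Rank-nullity for [dif]. The quotient of [C1] by the coboundaries is never formed: [dif_C1] gives
    a lower bound on dim Hom, and vanishing Ext^1 gives equality. *)
Lemma hom_dim : (\dim homR + \dim (dif @: C0) = \dim C0)%N.
Proof. exact: limg_ker_dim. Qed.

Lemma dif_C1 : (dif @: C0 <= C1)%VS.
Proof.
apply/subvP => _ /memv_imgP[f /C0P fv ->]; apply/C1P => a m.
rewrite !difE linearB -fv [vactf X (tgt a) _]vact_aact eqxx.
rewrite [aactf X a (vactf X _ m)]aact_vact eqxx [f (vactf X (src a) m)]fv.
rewrite [vactf Y (tgt a) _]vact_aact eqxx.
by rewrite [aactf Y a (vactf Y _ _)]aact_vact eqxx.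
Qed.

Lemma C1_cochain g : g \in C1 -> cochain (fun a => homk (g a)).
Proof.
move/C1P => hg; split=> x a m; rewrite -[homk _ _]/(g a _).
  by rewrite -hg [LHS]vact_vact.
rewrite -hg [vactf X (src a) _]vact_vact; case: eqP => [->|_]; first by rewrite hg.
by rewrite !linear0.
Qed.

Lemma cochain_C1 (g : arrow Q -> {linear kv X -> kv Y}) : cochain g ->
  [ffun a => linfun (g a : {linear kF X -> kF Y})] \in C1.
Proof.
move=> [g1 g2]; apply/C1P => a m; rewrite ffunE !lfunE.
by rewrite [g a _]g2 eqxx [LHS]g1 eqxx.
Qed.

Lemma Ext1_zero_dif : Ext1_zero X Y -> (dif @: C0)%VS = C1.
Proof.
move=> /Ext1_zeroP ext; apply/eqP; rewrite eqEsubv dif_C1 /=; apply/subvP => g gC1.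
have [E0 [i [p [s pr]]]] := twist_ex (C1_cochain gC1); have [ses ps vs as_] := pr.
have [r ri] := ext (FGMod (fg_ses ses)) i p ses.
pose f : {linear kF X -> kF Y} := klin r \o s.
have fE m : f m = r (s m) by [].
(* Applying the retraction to a (s m) = i (g a m) + s (a m) gives a (f m) = g a m + f (a m), hence
   the sign. *)
apply/memv_imgP; exists (- linfun f).
  apply/C0P => x m; rewrite !opp_lfunE !lfunE linearN; congr (- _).
  by rewrite !fE -[s (vactf X x m)]vs; apply: linear_vact.
apply/ffunP => a; apply/lfunP => m; rewrite difE !opp_lfunE !lfunE linearN opprK !fE.
rewrite -[aactf Y a _](linear_aact r) as_ linearD -[X in r X + _]/(i (g a m)) ri.
by rewrite addrC addrK.
Qed.

Lemma dif_Ext1_zero : (dif @: C0)%VS = C1 -> Ext1_zero X Y.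
Proof.
move=> dC; apply/Ext1_zeroP => E i p ses; apply: (ses_retraction ses).
have [s [g [cg [_ ps vs as_]]]] := ses_presents fin ses.
have := cochain_C1 cg; rewrite -dC => /memv_imgP[f /C0P fv /ffunP gf].
have gE a m : g a m = f (aactf X a m) - aactf Y a (f m).
  by rewrite -difE -gf ffunE lfunE.
pose t : {linear kv X -> kv E} := s \+ (klin i \o homk f).
have tE m : t m = s m + i (f m) by [].
have lt : linear (t : X -> E).
  apply: (@klinear_linear _ _ X E t); first exact: linearP.
    move=> x m; rewrite !tE (linearD (vact E x)) vs [f (vact X x m)]fv.
    by rewrite -(linear_vact i).
  move=> a m; rewrite !tE (linearD (aact E a)) as_ gE (linearB i) addrAC.
  by rewrite -(linear_aact i) subrK addrC.
exists (mklin lt) => z; rewrite -[mklin lt z]/(t z) tE linearD ps (ses_pi ses) addr0 //.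
Qed.
End Complex.
End Euler.

(** * Indecomposable modules over a Dynkin quiver *)

(* The [s t] are the projections and the [r t] the inclusions. *)
Definition biproduct (R : pzRingType) (M : fgmod R) (T : finType) (F : T -> fgmod R)
    (s : forall t, {linear M -> F t}) (r : forall t, {linear F t -> M}) : Prop :=
  [/\ forall t x, s t (r t x) = x, forall t u x, t != u -> s u (r t x) = 0
    & forall x, \sum_t r t (s t x) = x].

Definition brick (R : pzRingType) (X : fgmod R) : Prop :=
  forall f : {linear X -> X}, (exists x, f x <> 0) -> bijective f.

Section Gabriel.
Variables (k : fieldType) (Q : quiver) (fin : findim_modules k Q).
Hypothesis tits : tits_bounded Q.
Local Notation R := (kQ k Q).
Local Notation modR := (fgmod R).
Local Notation kF := (kf fin).
Local Notation mdim := (mdim fin).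
Local Notation dimvec := (dimvec fin).
Implicit Types (X Y M N I : modR).
Let noeth := kQ_noetherian fin.
Let ext_extend := kQ_extensions_extend fin.

Lemma mdim_iso M N : mod_iso M N -> mdim M = mdim N.
Proof. by move=> h; rewrite !mdim_sum; apply: eq_bigr => x _; apply: dimvec_iso. Qed.

Lemma mdim_prod_gt M N : ~ zero_mod N -> (mdim M < mdim (prodm M N))%N.
Proof.
move=> nz; rewrite ltnNge; apply/negP => le; apply: nz => y.
pose i : {linear M -> prodm M N} := pairm idfun \0.
have inj : injective i by move=> x x' [].
by have [x []] := inj_mdim_surj inj le (0, y).
Qed.

Lemma mdim_prodC M N : mdim (prodm M N) = mdim (prodm N M).
Proof.
apply: mdim_iso; exists (pairm snd fst : {linear prodm M N -> prodm N M}).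
by exists (fun u => (u.2, u.1)) => -[].
Qed.

(** By induction on the dimension. Only existence is stated; summands are compared later, through
    bricks. *)
Lemma decomposition M : exists (T : finType) (F : T -> modR)
    (s : forall t, {linear M -> F t}) (r : forall t, {linear F t -> M}),
  biproduct s r /\ forall t, indecomposable (F t).
Proof.
have [n] := ubnP (mdim M); elim: n M => // n IH M; rewrite ltnS => leM.
case: (pselect (zero_mod M)) => [z|nz].
  exists void, (fun=> M), (fun=> \0), (fun=> \0); split=> [|[]].
  by split=> [[]|[]|x]; rewrite [RHS]z; apply: z.
case: (pselect (indecomposable M)) => [ind|nind].
  exists unit, (fun=> M), (fun=> idfun), (fun=> idfun); split=> //; split=> //.
  by move=> x; rewrite (big_pred1 tt) // => -[].
have [A [B [iso [nA nB]]]] : exists A B : modR, mod_iso M (A * B)%type /\ ~ zero_mod A /\ ~ zero_mod B.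
  apply: contrapT => h; apply: nind; split=> // A B iso.
  by apply: contrapT => /not_orP[? ?]; apply: h; exists A, B.
have dM : mdim M = mdim (prodm A B) by apply: mdim_iso.
have [|T1 [F1 [s1 [r1 [[sr1 sr1' rs1] ind1]]]]] := IH A.
  by apply: leq_trans leM; rewrite dM mdim_prod_gt.
have [|T2 [F2 [s2 [r2 [[sr2 sr2' rs2] ind2]]]]] := IH B.
  by apply: leq_trans leM; rewrite dM mdim_prodC mdim_prod_gt.
have /mod_isoE[f [g [fK gK]]] := iso.
pose F (t : T1 + T2) := match t with inl a => F1 a | inr b => F2 b end.
pose s (t : T1 + T2) : {linear M -> F t} := match t with
  | inl a => s1 a \o (fst \o f) | inr b => s2 b \o (snd \o f) end.
pose r (t : T1 + T2) : {linear F t -> M} := match t with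
  | inl a => g \o (pairm idfun \0 \o r1 a) | inr b => g \o (pairm \0 idfun \o r2 b) end.
exists (T1 + T2)%type, F, s, r; split; last by case.
split.
- by case=> t x /=; rewrite gK /= ?sr1 ?sr2.
- case=> t [] u x ne /=; rewrite gK /= ?linear0 //; [exact: sr1'|exact: sr2'].
- move=> x; rewrite big_sumType /= -(linear_sum g) -(linear_sum g) -linearD.
  rewrite -[RHS]fK; congr (g _); rewrite [RHS]surjective_pairing.
  rewrite -(linear_sum (pairm idfun \0)) -(linear_sum (pairm \0 idfun)) rs1 rs2 /=.
  by congr pair; rewrite /= ?addr0 ?add0r.
Qed.

Lemma retract_indecomposable X Y : ~ zero_mod Y -> indecomposable X -> retract Y X ->
  mod_iso X Y.
Proof.
move=> nY [nX ind] /retract_split[Z h]; case: (ind _ _ h) => // zZ.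
apply: mod_iso_trans h _; exists fst; exists (fun y => (y, 0)) => //= -[y z] /=.
by congr pair; rewrite [RHS]zZ.
Qed.

Lemma endo_bij X (f : {linear X -> X}) : injective f -> bijective f.
Proof. by move=> inj; apply: inj_surj_bij => //; apply: (inj_mdim_surj (fin := fin) inj). Qed.

Lemma homR_nonzero X Y : (0 < \dim (homR fin X Y))%N ->
  exists f : {linear X -> Y}, exists x, f x <> 0.
Proof.
rewrite lt0n dimv_eq0 => /eqP nz.
have [f fh fn] : exists2 f, f \in homR fin X Y & f != 0.
  apply: contrapT => h; apply: nz; apply/eqP; rewrite -subv0; apply/subvP => f fh.
  by rewrite memv0; apply: contrapT => /negP fn; apply: h; exists f.
have [F hF] := homR_linear fh; exists F; apply: contrapT => h.
case/eqP: fn; apply/lfunP => x; rewrite zero_lfunE -hF.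
by apply: contrapT => e; apply: h; exists x.
Qed.

Lemma nonzero_homR X Y (f : {linear X -> Y}) x : f x <> 0 -> (0 < \dim (homR fin X Y))%N.
Proof.
move=> fx; rewrite lt0n dimv_eq0; apply/eqP => e.
have := linear_homR fin f; rewrite e memv0 => /eqP/lfunP/(_ x).
by rewrite lfunE zero_lfunE.
Qed.

(** The difference of the two dimensions is q(dim X); were it nonpositive, the Tits bound would make
    every entry of the dimension vector vanish. *)
Lemma tits_pos X : ~ zero_mod X ->
  (\dim (C1 fin X X) < \dim (C0 fin X X))%N.
Proof.
move=> nz; rewrite dim_C1 dim_C0 ltnNge; apply/negP => le.
apply: nz; apply/(mdim0 fin); rewrite mdim_sum.
apply: big1 => x _; have [N hN] := tits; have := hN (dimvec X) x.
move: le; set a := (\sum_(a0 : arrow Q) _)%N.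
rewrite (eq_bigr (fun i => dimvec X i ^ 2)%N) //; set b := (\sum_(i : vertex Q) _)%N.
move=> ba h; have : (N * b <= N * a)%N by rewrite leq_mul2l ba orbT.
nia.
Qed.

(* A cocycle xi which is not a coboundary would span, under the division ring End X, a space of
   dimension dim End X meeting the coboundaries trivially, and q(dim X) would be at most 0. *)
Lemma brick_Ext1_zero X : ~ zero_mod X -> brick X -> Ext1_zero X X.
Proof.
move=> nz bX; apply: (dif_Ext1_zero (fin := fin)); apply: contrapT => ne.
have [xi xC1 xn] : exists2 xi, xi \in C1 fin X X & xi \notin (dif fin X X @: C0 fin X X)%VS.
  apply: contrapT => h; apply: ne; apply/eqP; rewrite eqEsubv dif_C1 /=; apply/subvP => g gC.
  by apply: contrapT => /negP gn; apply: h; exists g.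
pose comp_xi (f : 'Hom(kF X, kF X)) : {ffun arrow Q -> 'Hom(kF X, kF X)} :=
  [ffun a => (f \o xi a)%VF].
have cE f a m : comp_xi f a m = f (xi a m) by rewrite ffunE comp_lfunE.
have lc : linear comp_xi.
  move=> c f g; apply/ffunP => a; apply/lfunP => m.
  by rewrite ffun_lfunP !cE add_lfunE scale_lfunE.
pose P := linfun (mklin lc).
have PE f : P f = comp_xi f by rewrite lfunE.
have key f : f \in homR fin X X -> P f \in (dif fin X X @: C0 fin X X)%VS -> f = 0.
  move=> fh /memv_imgP[eta /C0P etaC /ffunP fe].
  have [F hF] := homR_linear fh; apply: contrapT => fn.
  have [|G [FK GK]] := bij_linear_inv (bX F _).
    apply: contrapT => h; apply: fn; apply/lfunP => m; rewrite zero_lfunE -hF.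
    by apply: contrapT => e; apply: h; exists m.
  (* Composing with the inverse [G] of [f] turns [eta] into a graded map whose coboundary is
     [xi]. *)
  case/negP: xn; apply/memv_imgP; exists (linfun (linf fin G) \o eta)%VF.
    apply/C0P => x m; rewrite !comp_lfunE !lfunE etaC; exact: linear_vact.
  apply/ffunP => a; apply/lfunP => m; rewrite [RHS]difE !comp_lfunE !lfunE.
  have -> : xi a m = G (f (xi a m)) by rewrite -hF FK.
  rewrite -cE -PE fe difE [LHS](linearB G); congr (_ - _).
  exact: linear_aact.
have sub : (P @: homR fin X X + dif fin X X @: C0 fin X X <= C1 fin X X)%VS.
  rewrite subv_add dif_C1 andbT; apply/subvP => _ /memv_imgP[f fh ->].
  have [F hF] := homR_linear fh; apply/C1P => a m; rewrite PE !cE -!hF.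
  have /C1P xiC := xC1; rewrite -[in RHS]xiC; exact/esym/(linear_vact F).
have := dimvS sub; rewrite dimv_disjoint_sum; last first.
  apply/eqP; rewrite -subv0; apply/subvP => _ /memv_capP[/memv_imgP[f fh ->] h].
  by rewrite (key f fh h) linear0 mem0v.
rewrite limg_dim_eq; last first.
  apply/eqP; rewrite -subv0; apply/subvP => f /memv_capP[fh]; rewrite memv_ker => /eqP f0.
  by rewrite memv0 (key f fh) // f0 mem0v.
by rewrite hom_dim leqNgt tits_pos.
Qed.

(* If X is not a brick, take a nonzero nonbijective endomorphism i p with image I of minimal
   dimension.  Then I lies in its kernel K and embeds in an indecomposable summand F of K.
   By induction Ext^1(F, F) = 0, so Ext^1(I, F) = 0, hence F is a summand of X. *)
Lemma indecomposable_brick_rigid X : indecomposable X -> brick X /\ Ext1_zero X X.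
Proof.
have [n] := ubnP (mdim X); elim: n X => // n IH X; rewrite ltnS => leX indX.
suff bX : brick X by split=> //; apply: brick_Ext1_zero bX; case: indX.
have [nX indX'] := indX.
apply: contrapT => nb.
pose bad d := `[< exists (I : modR) (i : {linear I -> X}) (p : {linear X -> I}),
  [/\ mdim I = d, injective i, forall z, exists x, p x = z, (exists x, i (p x) <> 0)
    & ~ bijective (i \o p)] >].
have mk_bad (f : {linear X -> X}) : (exists x, f x <> 0) -> ~ bijective f ->
    exists (I : modR) (i : {linear I -> X}) (p : {linear X -> I}),
    [/\ bad (mdim I), injective i, forall z, exists x, p x = z & forall x, i (p x) = f x].
  move=> [x0 fx0] nbf; have [I [i [p [[inj hi] ip sp]]]] := im_ex noeth f.
  exists I, i, p; split=> //; apply/asboolP; exists I, i, p; split=> //.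
    by exists x0; rewrite ip.
  by move=> b; apply: nbf; apply: eq_bij b _ _ => x /=.
have ex_bad : exists d, bad d.
  have [f [nzf nbf]] : exists f : {linear X -> X}, (exists x, f x <> 0) /\ ~ bijective f.
    apply: contrapT => h; apply: nb => f nzf; apply: contrapT => nbf.
    by apply: h; exists f.
  by have [I [_ [_ [? _ _ _]]]] := mk_bad f nzf nbf; exists (mdim I).
case: (ex_minnP ex_bad) => d /asboolP[I [i [p [dI inji sp [x0 nz0] nbij]]]] dmin.
have pninj : ~ injective p.
  by move=> injp; apply: nbij; apply: endo_bij; apply: inj_comp.
have nzI : ~ zero_mod I by move=> z; apply: nz0; rewrite [p x0]z linear0.
(* Otherwise [i p i p] is bad with image inside I, so by minimality its image is I. Then [p i] is
   bijective, I is a summand of X, hence isomorphic to X, and [p] would be injective. *)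
have pi0 z : p (i z) = 0.
  apply: contrapT => nz1.
  pose th2 : {linear X -> X} := i \o (p \o (i \o p)).
  have [|b|I2 [i2 [p2 [bad2 inj2 sp2 ip2]]]] := mk_bad th2.
  - have [x hx] := sp z; exists x; rewrite /= hx => e; apply: nz1.
    by apply: inji; rewrite e linear0.
  - by apply: pninj; apply: (inj_compr (f := i \o (p \o i))); apply: bij_inj b.
  have [|u hu] := @factor_mono _ _ _ _ i i2 inji.
    by move=> w; have [x <-] := sp2 w; exists (p (i (p x))); rewrite ip2.
  have injuu : injective u by move=> w w' e; apply: inj2; rewrite -!hu e.
  have su := inj_mdim_surj injuu (_ : (mdim I <= mdim I2)%N); rewrite dI dmin // in su.
  have spi w : exists v, (p \o i) v = w.
    have [v <-] := su isT w; have [x <-] := sp2 v.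
    by exists (p x); apply: inji; rewrite hu ip2.
  have [_ /(_ (leqnn _)) injpi] := mdim_surj fin spi.
  have [h [pih hpi]] := bij_linear_inv (inj_surj_bij injpi spi).
  have rI : retract I X by exists i, (h \o p) => w /=; apply: pih.
  have isoXI := retract_indecomposable nzI indX rI.
  have [_ inj] := mdim_surj fin sp; apply: pninj; apply: inj.
  by rewrite (mdim_iso isoXI).
have [K [ka [injk hk]]] := ker_ex noeth p.
have ses : short_exact ka p by split.
have [|j hj] := @factor_mono _ _ _ _ ka i injk.
  by move=> z; apply/hk.
have [T [F [s [r [[sr _ rs] indF]]]]] := decomposition K.
have ltK : (mdim K < mdim X)%N.
  rewrite ltnNge; apply/negP => le; apply: nz0.
  by have [w <-] := inj_mdim_surj injk le x0; rewrite (ses_pi ses) linear0.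
have [t [w nzt]] : exists t w, s t (j w) <> 0.
  apply: contrapT => h; apply: nz0; rewrite -hj -[j _]rs.
  have e t : s t (j (p x0)) = 0 by apply: contrapT => e; apply: h; exists t, (p x0).
  by under eq_bigr do rewrite e linear0; rewrite big1_eq linear0.
have ltF : (mdim (F t) < mdim X)%N.
  by apply: leq_ltn_trans ltK; apply: mdim_inj (can_inj (sr t)).
have [bF extF] := IH (F t) (leq_trans ltF leX) (indF t).
have injrt : injective (r t) by apply: can_inj (sr t).
(* This endomorphism is again bad, and its image is a quotient of I through F t. Minimality leaves
   no kernel, so I embeds in F t. *)
pose th' : {linear X -> X} := ka \o (r t \o (s t \o (j \o p))).
have [|b|I2 [i2 [p2 [bad2 inj2 sp2 ip2]]]] := mk_bad th'.
- have [x hx] := sp w; exists x; rewrite /= hx => e; apply: nzt; apply: injrt.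
  by apply: injk; rewrite e !linear0.
- by apply: pninj; apply: (inj_compr (f := ka \o (r t \o (s t \o j)))); apply: bij_inj b.
have [|v hv] := @factor_epi _ _ _ _ p p2 sp.
  by move=> x px; apply: inj2; rewrite ip2 /= px !linear0.
have sv z : exists y, v y = z.
  by have [x <-] := sp2 z; exists (p x); rewrite hv.
have [_ injv] := mdim_surj fin sv.
have {}injv : injective v by apply: injv; rewrite dI dmin.
have inja : injective (s t \o j).
  apply: linear_eq0_inj => z; have [x <-] := sp z => e.
  apply: injv; rewrite hv linear0; apply: inj2; rewrite ip2 /= linear0.
  by rewrite (e : s t (j (p x)) = 0) !linear0.
have extI : Ext1_zero I (F t) by apply: (Ext1_zero_mono ext_extend (m := s t \o j) inja extF).
(* The projection K -> F t extends to X, whose quotient by K is I. So F t is a summand of X of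
   smaller dimension, which is absurd. *)
have [h hh] := Ext1_extend (s t) extI ses.
have rF : retract (F t) X.
  by exists (ka \o r t), h => y /=; rewrite hh sr.
have := retract_indecomposable (indF t).1 indX rF.
by move/mdim_iso => e; move: ltF; rewrite e ltnn.
Qed.

Lemma indecomposable_brick X : indecomposable X -> brick X.
Proof. by case/indecomposable_brick_rigid. Qed.

Lemma hom_lower X Y : (\dim (C0 fin X Y) <= \dim (homR fin X Y) + \dim (C1 fin X Y))%N.
Proof. by rewrite -hom_dim leq_add2l dimvS // dif_C1. Qed.

(* For I the image of a nonzero f : X -> X', Ext^1(I, X') = 0 gives <I, X> = <I, X'> > 0, hence
   a nonzero map I -> X; its composite with X -> I is bijective. *)
Lemma indecomposable_dimvec X X' : indecomposable X -> indecomposable X' ->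
  dimvec X =1 dimvec X' -> mod_iso X X'.
Proof.
move=> iX iX' e; have [bX _] := indecomposable_brick_rigid iX; have [_ extX'] := indecomposable_brick_rigid iX'.
have dX : mdim X = mdim X' by rewrite !mdim_sum; apply: eq_bigr => x _; apply: e.
have eC0 Y : \dim (C0 fin Y X) = \dim (C0 fin Y X').
  by rewrite !dim_C0; apply: eq_bigr => x _; rewrite e.
have eC1 Y : \dim (C1 fin Y X) = \dim (C1 fin Y X').
  by rewrite !dim_C1; apply: eq_bigr => x _; rewrite e.
have [f [x fx]] : exists f : {linear X -> X'}, exists x, f x <> 0.
  apply: homR_nonzero; have := hom_lower X X'; rewrite -eC0 -eC1.
  have := tits_pos iX.1; lia.
have [I [i [p [[inji hi] ip sp]]]] := im_ex noeth f.
have extI : Ext1_zero I X' by apply: (Ext1_zero_mono ext_extend inji extX').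
have nI : (0 < \dim (homR fin I X'))%N.
  by apply: (@nonzero_homR _ _ i (p x)); rewrite ip.
have [g [z gz]] : exists g : {linear I -> X}, exists z, g z <> 0.
  apply: homR_nonzero; have := hom_lower I X; rewrite eC0 eC1.
  have := hom_dim fin I X'; rewrite (Ext1_zero_dif fin extI) => <-.
  by rewrite leq_add2r => /(leq_trans nI).
have injp : injective p.
  apply: (inj_compr (f := g)); apply/bij_inj/(bX (g \o p)).
  by have [y hy] := sp z; exists y; rewrite /= hy.
have si := inj_mdim_surj inji (_ : (mdim X' <= mdim I)%N).
exists f; apply: eq_bij (_ : bijective (i \o p)) _ _ => [|y]; last exact: ip.
apply: bij_comp; apply: inj_surj_bij => //.
by apply: si; rewrite -dX; apply: mdim_inj injp.
Qed.

(* Here q(dim X) = dim End X <= dimvec X x, because evaluation at a nonzero vector is injective on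
   the endomorphisms of a brick. *)
Lemma indecomposable_bounded : exists N : nat, forall X x, indecomposable X -> (dimvec X x <= N)%N.
Proof.
have [N hN] := tits; exists N => X x iX; have [bX extX] := indecomposable_brick_rigid iX.
have [/eqP x0|xpos] := posnP (dimvec X x); first by rewrite (eqP x0).
have := hN (dimvec X) x.
have hC := hom_dim fin X X; rewrite (Ext1_zero_dif fin extX) dim_C0 dim_C1 in hC.
have -> : (\sum_i dimvec X i ^ 2 = \sum_i dimvec X i * dimvec X i)%N by apply: eq_bigr.
rewrite -hC mulnDr leq_add2r.
(* With d = dimvec X x > 0, this gives d^2 <= N dim End X <= N d and hence d <= N. *)
suff : (\dim (homR fin X X) <= dimvec X x)%N by nia.
have [v vP vn] : exists2 v, v \in limg (linfun (vactf fin X x)) & v != 0.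
  apply: contrapT => h; move: xpos; rewrite lt0n dimv_eq0 => /eqP; apply.
  apply/eqP; rewrite -subv0; apply/subvP => v vP; rewrite memv0.
  by apply: contrapT => /negP vn; apply: h; exists v.
have lev : linear (fun f : 'Hom(kF X, kF X) => f v).
  by move=> c f g; rewrite add_lfunE scale_lfunE.
rewrite -(limg_dim_eq (f := linfun (mklin lev))).
  apply/dimvS/subvP => _ /memv_imgP[f /memv_capP[/C0P fC _] ->].
  rewrite lfunE /=; apply/memv_limg; first exact: vactfK.
  by rewrite -fC; congr (f _); apply/(memv_limg _ (vactfK x)).
apply/eqP; rewrite -subv0; apply/subvP => f /memv_capP[fh]; rewrite memv_ker lfunE /= memv0.
move=> /eqP fv; have [F hF] := homR_linear fh; apply: contrapT => /negP fn.
have /bij_inj inj : bijective F.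
  apply: bX; apply: contrapT => h; case/eqP: fn; apply/lfunP => m; rewrite zero_lfunE -hF.
  by apply: contrapT => e; apply: h; exists m.
by case/eqP: vn; apply: inj; rewrite hF fv linear0.
Qed.
End Gabriel.

(** * Existence and uniqueness of Ext-progenerators *)

Section DirectSums.
Variable R : pzRingType.
Local Notation modR := (fgmod R).
Implicit Types (M N X Y U : modR).

Lemma add_of_sum U M (T : finType) (F : T -> modR)
    (s : forall t, {linear M -> F t}) (r : forall t, {linear F t -> M}) :
  (forall x, \sum_t r t (s t x) = x) -> (forall t, add_of U (F t)) -> add_of U M.
Proof.
move=> rs aF.
have h t : {n & {a : 'I_n -> {linear F t -> U} & {b : 'I_n -> {linear U -> F t} |
    forall x, \sum_i b i (a i x) = x}}}.
  have /cid[n h] := (add_ofP U (F t)).1 (aF t); exists n.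
  by have /cid[a /cid[b hab]] := h; exists a, b.
pose n t := tag (h t); pose a t : 'I_(n t) -> {linear F t -> U} := tag (tagged (h t)).
pose b t : 'I_(n t) -> {linear U -> F t} := sval (tagged (tagged (h t))).
have ba t x : \sum_i b t i (a t i x) = x := svalP (tagged (tagged (h t))) x.
pose I : finType := {t : T & 'I_(n t)}.
apply/add_ofP; exists #|I|, (fun i => a _ (tagged (enum_val i : I)) \o s _),
  (fun i => r _ \o b _ (tagged (enum_val i : I))) => x /=.
rewrite -(big_enum_val (fun i : I => r _ (b _ (tagged i) (a _ (tagged i) (s _ x))))) /=.
rewrite -(@sig_big_dep _ _ _ _ _ xpredT (fun _ => xpredT)
  (fun t (j : 'I_(n t)) => r t (b t j (a t j (s t x))))) /=.
by rewrite -[RHS]rs; apply: eq_bigr => t _; rewrite -linear_sum ba.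
Qed.

Lemma direct_sum_biproduct M n (F : 'I_n -> modR) : direct_sum_of M F ->
  exists (s : forall t, {linear M -> F t}) (r : forall t, {linear F t -> M}), biproduct s r.
Proof.
move=> [r [gen ind]]; have /choice[y hy] := gen.
have uniq z z' : \sum_i r i (z i) = \sum_i r i (z' i) -> forall i, z i = z' i.
  move=> e i; apply/eqP; rewrite -subr_eq0; apply/eqP; apply: (ind (fun i => z i - z' i)).
  by under eq_bigr do rewrite linearB; rewrite sumrB e subrr.
have ls i : linear (fun x => y x i).
  move=> c u v; apply: (uniq (y (c *: u + v)) (fun i => c *: y u i + y v i)).
  rewrite -hy {1}(hy u) {1}(hy v) scaler_sumr -big_split; apply: eq_bigr => j _.
  by rewrite linearP.
have yr i x j : y (r i x) j = dfwith (fun j => 0 : F j) x j.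
  move: j; apply: uniq; rewrite -hy (bigD1 i) //= dfwith_in.
  rewrite big1 ?addr0 // => j nj; rewrite dfwith_out ?linear0 //; by rewrite eq_sym.
exists (fun i => mklin (ls i)), r; split=> [t x|t u x ne|x] /=.
- by rewrite yr dfwith_in.
- by rewrite yr dfwith_out.
- by rewrite -hy.
Qed.

Lemma direct_sum_iso M M' n (F : 'I_n -> modR) :
  mod_iso M M' -> direct_sum_of M F -> direct_sum_of M' F.
Proof.
move=> /mod_isoE[f [g [fK gK]]] [r [gen ind]].
exists (fun i => f \o r i); split=> [x|y e i].
  by have [y hy] := gen (g x); exists y; rewrite -[LHS]gK hy linear_sum.
apply: (ind y); apply: (can_inj fK); rewrite linear0 linear_sum; exact: e.
Qed.

Lemma basic_iso M M' : mod_iso M M' -> basic M -> basic M'.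
Proof.
move=> h [n [F [ds indF neF]]]; exists n, F; split=> //.
exact: direct_sum_iso h ds.
Qed.

Section List.
Variables (Z : modR) (hZ : zero_mod Z).

Fixpoint dsum (l : seq modR) : modR :=
  if l is X :: l' then prodm X (dsum l') else Z.

Lemma dsum_direct l : direct_sum_of (dsum l) (fun i : 'I_(size l) => nth Z l i).
Proof.
elim: l => [|X l [r [gen ind]]] /=.
  exists (fun=> \0); split=> [x|y _ []] //; exists (fun=> 0).
  by rewrite big_ord0; apply: hZ.
(* Matching on the number inside the ordinal lets [nth] reduce in the type, so no transport between
   summands is needed. *)
pose r' (i : 'I_(size l).+1) : {linear nth Z (X :: l) i -> prodm X (dsum l)} :=
  match i with Ordinal m h =>
    match m return forall h : (m < (size l).+1)%N,
      {linear nth Z (X :: l) m -> prodm X (dsum l)} with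
    | 0 => fun _ => pairm idfun \0
    | m'.+1 => fun h => pairm \0 idfun \o r (Ordinal (h : (m' < size l)%N))
    end h end.
have r'0 x : r' ord0 x = (x, 0) by [].
have r'Sm m (h1 : (m.+1 < (size l).+1)%N) (h2 : (m < size l)%N) x :
  r' (Ordinal h1) x = (0, r (Ordinal h2) x) by rewrite (bool_irrelevance h2 h1).
have r'S j x : r' (lift ord0 j) x = (0, r j x) by case: j x => m h x; apply: r'Sm.
have sumE (y : forall i : 'I_(size l).+1, nth Z (X :: l) i) :
    \sum_i r' i (y i) = (y ord0, \sum_(j < size l) r j (y (lift ord0 j))).
  rewrite big_ord_recl r'0; under eq_bigr do rewrite r'S.
  rewrite -(linear_sum (pairm \0 idfun : {linear dsum l -> prodm X (dsum l)})) /=.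
  by congr pair; rewrite /= ?addr0 ?add0r.
exists r'; split=> [[x u]|y].
  have [y ->] := gen u.
  pose y' (i : 'I_(size l).+1) : nth Z (X :: l) i :=
    match i with Ordinal m h =>
      match m return forall h : (m < (size l).+1)%N, nth Z (X :: l) m with
      | 0 => fun _ => x | m'.+1 => fun h => y (Ordinal (h : (m' < size l)%N)) end h end.
  have y'Sm m (h1 : (m.+1 < (size l).+1)%N) (h2 : (m < size l)%N) :
    y' (Ordinal h1) = y (Ordinal h2) by rewrite (bool_irrelevance h2 h1).
  exists y'; rewrite sumE; congr pair; apply: eq_bigr => j _; congr (r _ _).
  by case: j => m h; apply/esym/y'Sm.
rewrite sumE => -[y0 ys] i; case: (unliftP ord0 i) => [j|] ->; last exact: y0.
exact: (ind (fun j => y (lift ord0 j)) ys j).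
Qed.
End List.
End DirectSums.

Section Progenerators.
Variables (k : fieldType) (Q : quiver) (fin : findim_modules k Q).
Hypothesis tits : tits_bounded Q.
Local Notation R := (kQ k Q).
Local Notation modR := (fgmod R).
Local Notation kF := (kf fin).
Local Notation mdim := (mdim fin).
Local Notation dimvec := (dimvec fin).
Implicit Types (X Y M N I E K : modR).
Let noeth := kQ_noetherian fin.

(** Dimension vectors of indecomposables lie in a finite box and determine the module; [G] picks one
    indecomposable for each realised vector. *)
Lemma finite_type : exists (T : finType) (G : T -> modR),
  [/\ forall t, indecomposable (G t), forall t u, mod_iso (G t) (G u) -> t = u
    & forall X, indecomposable X -> exists t, mod_iso X (G t)].
Proof.
have [N hN] := indecomposable_bounded fin tits.
pose D : finType := {ffun vertex Q -> 'I_N.+1}.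
pose realized (d : D) := `[< exists X, indecomposable X /\ forall x, dimvec X x = d x >].
have /choice[G hG] : forall t : {d : D | realized d},
    exists X, indecomposable X /\ forall x, dimvec X x = val t x.
  by move=> t; apply/asboolP/(valP t).
exists {d : D | realized d}, G; split=> [t|t u h|X iX]; first by case: (hG t).
  apply: val_inj; apply/ffunP => x; apply: val_inj.
  by rewrite /= -(hG t).2 -(hG u).2; apply: dimvec_iso.
pose d : D := [ffun x => inord (dimvec X x)].
have dE x : dimvec X x = d x by rewrite ffunE inordK // ltnS hN.
have rd : realized d by apply/asboolP; exists X.
exists (exist _ d rd); have [iG dG] := hG (exist _ d rd).
apply: (indecomposable_dimvec (fin := fin) tits iX iG) => x.
by rewrite dE dG.
Qed.

(** * Enough Ext-projectives in an ICE-closed subcategory *)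

Section EnoughProjectives.
Variable C : modR -> Prop.
Hypothesis iceC : ice_closed C.
Let sC : subcategory C. Proof. by case: iceC. Qed.
Let imC : image_closed C. Proof. by case: iceC. Qed.
Let extC : extension_closed C. Proof. by case: iceC. Qed.

(** The admissible epimorphisms onto X of C as an exact category. *)
Definition deflation E X (e : {linear E -> X}) : Prop :=
  C E /\ exists K (i : {linear K -> E}), C K /\ short_exact i e.

(** The pullback is an extension of E by K', and its kernel over X is K (+) K'. *)
Lemma deflation_pullback (E E' X : modR) (e : {linear E -> X}) (e' : {linear E' -> X}) :
  deflation e -> deflation e' ->
  exists (Z : modR) (z : {linear Z -> X}) (a : {linear Z -> E}) (b : {linear Z -> E'}),
    [/\ deflation z, forall x, z x = e (a x) & forall x, z x = e' (b x)].
Proof.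
move=> [cE [K [i [cK ses]]]] [cE' [K' [i' [cK' ses']]]].
have [inj h se] := ses; have [inj' h' se'] := ses'.
have [Z [j [injj hj]]] := noeth (submodule_ker (copairm e (\- e') : {linear prodm E E' -> X})).
have hj' x y : e x = e' y -> exists w, j w = (x, y).
  by move=> exy; apply/hj; rewrite /= exy subrr.
have jZ w : e (j w).1 = e' (j w).2.
  by apply/eqP; rewrite -subr_eq0; apply/eqP/(hj (j w)); exists w.
pose a : {linear Z -> E} := fst \o j; pose b : {linear Z -> E'} := snd \o j.
have [|k' hk'] := @factor_mono _ _ _ _ j (pairm \0 i' : {linear K' -> prodm E E'}) injj.
  by move=> y; apply: hj'; rewrite linear0 (ses_pi ses').
have sesZ : short_exact k' a.
  split=> [y y' ey|w|x].
  - by apply: inj'; have := congr1 (snd \o j) ey; rewrite /= !hk'.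
  - split=> [aw|[y <-]]; last by rewrite /a /= hk'.
    have /h'[y hy] : e' (j w).2 = 0 by rewrite -jZ [(j w).1]aw linear0.
    exists y; apply: injj; rewrite hk' /= hy [RHS]surjective_pairing.
    by rewrite (aw : (j w).1 = 0).
  - by have [y hy] := se' (e x); have [w hw] := hj' x y (esym hy); exists w; rewrite /a /= hw.
have cZ : C Z by apply: extC sesZ cK' cE.
have [|kk hkk] := @factor_mono _ _ _ _ j
    (pairm (i \o fst) (i' \o snd) : {linear prodm K K' -> prodm E E'}) injj.
  by move=> [y y']; apply: hj'; rewrite /= (ses_pi ses) (ses_pi ses').
exists Z, (e \o a), a, b; split=> //.
split=> //; exists (prodm K K'), kk; split.
  exact: (@extC K (prodm K K') K' _ _ (@ses_prod _ K K') cK cK').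
split=> [[y1 y2] [y1' y2'] ey|w|x].
- have := congr1 j ey; rewrite !hkk /= => -[/inj-> /inj'->] //.
- split=> [/= ew|[[y y'] <-]]; last by rewrite /= /a /= hkk /= (ses_pi ses).
  have /h[y hy] := ew.
  have /h'[y' hy'] : e' (j w).2 = 0 by rewrite -jZ.
  by exists (y, y'); apply: injj; rewrite hkk /= hy hy' -surjective_pairing.
- have [y hy] := se x; have [y' hy'] := se' x.
  have [|w hw] := hj' y y'; first by rewrite hy hy'.
  by exists w; rewrite /= /a /= hw.
Qed.

Lemma deflation_id X : C X -> deflation (idfun : {linear X -> X}).
Proof.
move=> cX; split=> //; have [Z z] := zero_mod_ex R.
exists Z, \0; split; first by case: sC => _ c0 _ _; apply: c0.
split=> [y y' _|y|y]; [by rewrite [y]z [y']z| |by exists y].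
by split=> [e|[_ <-] //]; exists 0; apply: esym e.
Qed.

(** The kernel of the composite is an extension of K by Y. *)
Lemma deflation_comp (E F X Y : modR) (e : {linear E -> X}) (p : {linear F -> E}) (i : {linear Y -> F}) :
  deflation e -> C Y -> short_exact i p -> deflation (e \o p).
Proof.
move=> [cE [K [j [cK ses]]]] cY ses'; have [inj h se] := ses; have [inj' h' se'] := ses'.
have sep z : exists x, (e \o p) x = z.
  by have [y <-] := se z; have [x <-] := se' y; exists x.
split; first exact: extC ses' cY cE.
have [L [l sesL]] := epi_ses noeth sep; have [injl hl _] := sesL.
exists L, l; split=> //.
have [|u hu] := @factor_mono _ _ _ _ l i injl.
  by move=> y; apply/hl; rewrite /= (ses_pi ses') linear0.
have [|v hv] := @factor_mono _ _ _ _ j (p \o l) inj.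
  by move=> w; apply/h; apply: (ses_pi sesL).
apply: (extC (f := u) (g := v)) cY cK; split=> [y y' e'|w|z].
- by apply: inj'; rewrite -!hu e'.
- split=> [vw|[y <-]]; last by apply: inj; rewrite hv /= hu (ses_pi ses') linear0.
  have /h'[y hy] : p (l w) = 0 by rewrite -[LHS]hv vw linear0.
  by exists y; apply: injl; rewrite hu.
- have [x hx] := se' (j z).
  have /hl[w hw] : (e \o p) x = 0 by rewrite /= hx (ses_pi ses).
  by exists w; apply: inj; rewrite hv /= hw.
Qed.

Lemma factor_space_ex (G E X : modR) (e : {linear E -> X}) :
  exists U : {vspace 'Hom(kF G, kF X)}, forall f,
    f \in U <-> exists h : {linear G -> E}, forall x, f x = e (h x).
Proof.
apply: submodule_vspace; split=> [|c f1 f2 [h1 hh1] [h2 hh2]].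
  by exists \0 => x; rewrite zero_lfunE linear0.
have lh : linear (fun x => (c *: (h1 x : kv E) + (h2 x : kv E)) : E).
  apply: (@klinear_linear _ _ G E (c \*: klin h1 \+ klin h2)); first exact: linearP.
    by move=> x m; rewrite [RHS]linearD [X in _ = X + _]linearZ /= !linear_vact.
  by move=> a m; rewrite [RHS]linearD [X in _ = X + _]linearZ /= !linear_aact.
exists (mklin lh) => x; rewrite add_lfunE scale_lfunE hh1 hh2.
by rewrite [RHS](linearD (klin e)) [X in _ = X + _]linearZ.
Qed.
Definition factor_space (G E X : modR) (e : {linear E -> X}) := sval (cid (factor_space_ex G e)).
Lemma factor_spaceP (G E X : modR) (e : {linear E -> X}) f :
  f \in factor_space G e <-> exists h : {linear G -> E}, forall x, f x = e (h x).
Proof. exact: svalP (cid (factor_space_ex G e)) f. Qed.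

(** Weakly initial among the deflations onto X: a factorisation through each of them exists, and
    uniqueness is not asked. *)
Definition final_deflation E X (e : {linear E -> X}) : Prop := deflation e /\
  forall E' (e' : {linear E' -> X}), deflation e' ->
    exists g : {linear E -> E'}, forall x, e x = e' (g x).

(** Take [e] with [mu] minimal, where [mu] measures the maps from indecomposables to X that factor
    through a deflation. Pulling back along any [e'] can then lose no such map, so each one factors
    through [e'] as well; for the restrictions of [e] to the indecomposable summands of E this gives
    [g]. *)
Lemma final_deflation_ex X : C X -> exists E (e : {linear E -> X}), final_deflation e.
Proof.
move=> cX; have [T [G [indG neG allG]]] := finite_type.
pose mu E (e : {linear E -> X}) := (\sum_t \dim (factor_space (G t) e))%N.
pose good n := `[< exists E (e : {linear E -> X}), deflation e /\ mu E e = n >].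
have ex_good : exists n, good n.
  by exists (mu X idfun); apply/asboolP; exists X, idfun; split=> //; apply: deflation_id.
case: (ex_minnP ex_good) => n /asboolP[E [e [de en]]] nmin.
exists E, e; split=> // E' e' de'.
have [Z [z [a [b [dz za zb]]]]] := deflation_pullback de de'.
have sub t : (factor_space (G t) z <= factor_space (G t) e)%VS.
  apply/subvP => f /factor_spaceP[h hh]; apply/factor_spaceP.
  by exists (a \o h) => x; rewrite hh za.
have sub' t : (factor_space (G t) e <= factor_space (G t) e')%VS.
  (* All spaces for [z] are contained in those for [e], so one strict inclusion would lower [mu]. *)
  have /eqP <- : factor_space (G t) z == factor_space (G t) e.
    rewrite eqEdim sub /= leqNgt; apply/negP => lt.
    have gz : good (mu Z z) by apply/asboolP; exists Z, z.
    have := nmin _ gz; rewrite -en leqNgt => /negP; apply.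
    rewrite /mu (bigD1 t) //= [X in (_ < X)%N](bigD1 t) //= -addSn leq_add //.
    by apply: leq_sum => u _; apply: dimvS.
  apply/subvP => f /factor_spaceP[h hh]; apply/factor_spaceP.
  by exists (b \o h) => x; rewrite hh zb.
have [S [F [s [r [[_ _ rs] indF]]]]] := decomposition fin E.
have /choice[g hg] u : exists g : {linear E -> E'}, forall x, e (r u (s u x)) = e' (g x).
  have [t /mod_isoE[f [f' [fK f'K]]]] := allG _ (indF u).
  have : linfun (linf fin (e \o (r u \o f'))) \in factor_space (G t) e.
    by apply/factor_spaceP; exists (r u \o f') => x; rewrite lfunE.
  move/(subvP (sub' t))/factor_spaceP=> [h hh].
  by exists (h \o (f \o s u)) => x; rewrite /= -hh lfunE /= fK.
have lg : linear (fun x => \sum_u g u x).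
  move=> c x y; rewrite scaler_sumr -big_split; apply: eq_bigr => u _.
  by rewrite linearP.
exists (mklin lg) => x; rewrite /= linear_sum -[in LHS](rs x) linear_sum.
exact: eq_bigr.
Qed.

(** For an extension F of E by Y, the deflation F -> E -> X yields [h : E -> F] with e p h = e. The
    image of p h carries a final deflation too, so minimality of dim E makes p h bijective, and [p]
    splits. *)
Lemma ice_enough_projectives : enough_ext_projectives C.
Proof.
move=> X cX.
pose good n := `[< exists E (e : {linear E -> X}), final_deflation e /\ mdim E = n >].
have ex_good : exists n, good n.
  by have [E [e he]] := final_deflation_ex cX; exists (mdim E); apply/asboolP; exists E, e.
case: (ex_minnP ex_good) => n /asboolP[E [e [[de fe] En]]] nmin.
have [cE [K [ka [cK ses]]]] := de; have [injk hk se] := ses.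
suff pE : ext_projective C E by exists K, E, ka, e.
split=> // Y cY; apply/Ext1_zeroP => F i p sesF; apply: (ses_retraction sesF).
have [h hh] := fe _ _ (deflation_comp de cY sesF).
pose phi : {linear E -> E} := p \o h.
have ephi x : e (phi x) = e x by rewrite [RHS]hh.
have [I [i0 [q [im0 iq sq]]]] := im_ex noeth phi.
have cI : C I by apply: imC im0.
have sei z : exists w, (e \o i0) w = z.
  by have [x <-] := se z; exists (q x); rewrite /= iq.
have [L [l sesL]] := epi_ses noeth sei; have [injl hl _] := sesL.
have [inj0 h0] := im0.
(* The kernel of I -> X is the image of K under [phi], because [phi] preserves [e]. *)
have cL : C L.
  apply: (imC (f := phi \o ka) (i := i0 \o l)) cK cE _.
  split; first exact: inj_comp.
  move=> y; split=> [[x <-]|[w <-]].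
    have /hl[w hw] : (e \o i0) (q (ka x)) = 0 by rewrite /= iq ephi (ses_pi ses).
    by exists w; rewrite /= hw iq.
  have [x hx] := sq (l w).
  have /hk[v hv] : e x = 0 by rewrite -ephi -iq hx; apply: (ses_pi sesL).
  by exists v; rewrite -[RHS]/(i0 (l w)) -hx iq -hv.
have fei : final_deflation (e \o i0).
  split=> [|E' e' de']; first by split=> //; exists L, l.
  by have [g hg] := fe _ _ de'; exists (g \o i0) => x /=; rewrite hg.
have s0 := inj_mdim_surj inj0 (_ : (mdim E <= mdim I)%N).
have sphi y : exists x, phi x = y.
  have [|w <-] := s0 _ y; last by have [x <-] := sq w; exists x; rewrite iq.
  by rewrite En nmin //; apply/asboolP; exists I, (e \o i0).
have [_ /(_ (leqnn _)) iphi] := mdim_surj fin sphi.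
have [psi [_ psiK]] := bij_linear_inv (inj_surj_bij iphi sphi).
by exists (h \o psi) => x; apply: psiK.
Qed.

(** Finite type allows the direct sum of all Ext-projective indecomposables, one from each
    isomorphism class. *)
Lemma progenerator_ex : exists P, basic P /\ ext_progenerator C P.
Proof.
have [T [G [indG neG allG]]] := finite_type.
have [Z hZ] := zero_mod_ex R.
pose l := [seq t <- enum T | `[< ext_projective C (G t) >]].
pose P := dsum Z [seq G t | t <- l].
have ds := dsum_direct hZ [seq G t | t <- l].
have nthG (i : 'I_(size [seq G t | t <- l])) :
    exists2 j : 'I_(size l), val j = val i
      & nth Z [seq G t | t <- l] i = G (tnth (in_tuple l) j).
  have it : (i < size l)%N by rewrite -(size_map G) ltn_ord.
  exists (Ordinal it) => //; pose t0 := tnth (in_tuple l) (Ordinal it).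
  by rewrite (nth_map t0) // (tnth_nth t0).
have projG (i : 'I_(size [seq G t | t <- l])) : ext_projective C (nth Z [seq G t | t <- l] i).
  have [j _ ->] := nthG i; have := mem_tnth j (in_tuple l).
  by rewrite /= mem_filter => /andP[/asboolP].
have [s [r [sr sr' rs]]] := direct_sum_biproduct ds.
have cP : C P.
  rewrite /P; have : all (fun t => `[< ext_projective C (G t) >]) l by apply: filter_all.
  elim: (l) => [|t m IH] /=; first by move=> _; case: sC => _ c0 _ _; apply: c0.
  by case/andP=> /asboolP[cG _] /IH cm; exact: (@extC _ (prodm _ _) _ _ _ (@ses_prod _ _ _) cG cm).
have extP Y : C Y -> Ext1_zero P Y.
  by move=> cY; apply: (Ext1_zero_suml noeth rs) => i; apply: (projG i).2.
exists P; split.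
  exists (size [seq G t | t <- l]), (fun i => nth Z [seq G t | t <- l] i); split=> //.
    by move=> i; have [t _ ->] := nthG i.
  move=> i i'; have [j ji ->] := nthG i; have [j' ji' ->] := nthG i' => /neG e.
  apply: val_inj; rewrite -ji -ji'; congr val; apply: (tuple_uniqP _) e.
  by rewrite filter_uniq // enum_uniq.
split=> [|M|]; [exact: cP| |exact: ice_enough_projectives].
split=> [aM|[cM extM]].
  split; first exact: add_of_subcategory sC cP aM.
  by move=> Y cY; apply: (Ext1_zero_add noeth (extP _ cY) aM (add_of_self Y)).
have [S [F [a [b [[ab _ ba] indF]]]]] := decomposition fin M.
apply: (add_of_sum ba) => u.
have rF : retract (F u) M by exists (b u), (a u).
have [t iso] := allG _ (indF u).
have rG : retract (G t) M by apply: retract_trans (iso_retract (mod_iso_sym iso)) rF.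
have pG : ext_projective C (G t).
  split=> [|Y cY]; first by apply: (add_of_subcategory sC cM); apply: add_of_retract rG (add_of_self M).
  exact: Ext1_zero_retractl rG (extM _ cY).
have tl : t \in l by rewrite mem_filter mem_enum andbT; apply/asboolP.
have : add_of P (G t).
  have lt : (index t l < size [seq G t | t <- l])%N by rewrite size_map index_mem.
  have := @add_of_retract _ P P _ (ex_intro _ (r (Ordinal lt)) (ex_intro _ (s (Ordinal lt)) (sr _))) (add_of_self P).
  by rewrite /= (nth_map t) ?index_mem // nth_index.
exact: add_of_retract (iso_retract iso).
Qed.
End EnoughProjectives.

(** In place of Krull-Schmidt: the identity of F i is a sum of composites through the G j. Some
    composite is nonzero, hence bijective on the brick F i, and F i is isomorphic to that G j. As P
    is basic, different i use different j. *)
Lemma basic_injection (P P' : modR) : basic P -> basic P' -> add_of P' P ->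
  exists f : {linear P -> P'}, injective f.
Proof.
move=> [n [F [ds indF neF]]] [m [G [ds' indG neG]]] /add_ofP[l [a [b ba]]].
have [s [r [sr sr' rs]]] := direct_sum_biproduct ds.
have [s' [r' [sr1 sr1' rs1]]] := direct_sum_biproduct ds'.
have /choice[sigma hsigma] : forall i, exists j, mod_iso (F i) (G j).
  move=> i; have bF := indecomposable_brick fin tits (indF i).
  have [x nx] : exists x : F i, x <> 0.
    by apply: contrapT => h; apply: (indF i).1 => x; apply: contrapT => e; apply: h; exists x.
  have [c [j nz]] : exists c j, s i (b c (r' j (s' j (a c (r i x))))) <> 0.
    apply: contrapT => h; apply: nx; rewrite -(sr i x) -(ba (r i x)) linear_sum.
    apply: big1 => c _; rewrite -(rs1 (a c _)) !linear_sum; apply: big1 => j _.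
    by apply: contrapT => e; apply: h; exists c, j.
  exists j; pose u : {linear F i -> G j} := s' j \o (a c \o r i).
  pose v : {linear G j -> F i} := s i \o (b c \o r' j).
  have rF : retract (F i) (G j).
    have [w' [wK' _]] : exists w' : {linear F i -> F i}, cancel (v \o u) w' /\ cancel w' (v \o u).
      by apply: bij_linear_inv; apply: bF; exists x.
    by exists u, (w' \o v) => y; apply: wK'.
  exact/mod_iso_sym/(retract_indecomposable (indF i).1 (indG j) rF).
have inj_sigma : injective sigma.
  move=> i i' e; apply: neF; apply: mod_iso_trans (hsigma i) _; rewrite e.
  exact: mod_iso_sym.
have ex_th i : {th : {linear F i -> G (sigma i)} | bijective th} := cid (hsigma i).
pose th i := sval (ex_th i); have hth i : bijective (th i) := svalP (ex_th i).
have lf : linear (fun x => \sum_i r' (sigma i) (th i (s i x))).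
  move=> c x y; rewrite scaler_sumr -big_split; apply: eq_bigr => i _.
  by rewrite !linearP.
exists (mklin lf); apply: linear_eq0_inj => x /= fx.
rewrite -(rs x) big1 // => i _.
have := congr1 (s' (sigma i)) fx; rewrite linear0 linear_sum (bigD1 i) //= sr1 big1 ?addr0.
  by rewrite -[RHS](linear0 (th i)) => /(bij_inj (hth i)) ->; rewrite linear0.
by move=> j nj; apply: sr1'; apply: contra_neq nj => /inj_sigma.
Qed.

Lemma progenerator_unique (C : modR -> Prop) (P P' : modR) :
  basic P -> ext_progenerator C P -> basic P' -> ext_progenerator C P' -> mod_iso P P'.
Proof.
move=> bP [_ h _] bP' [_ h' _].
have aP : add_of P' P by apply/h'/h/add_of_self.
have aP' : add_of P P' by apply/h/h'/add_of_self.
have [f injf] := basic_injection bP bP' aP.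
have [g injg] := basic_injection bP' bP aP'.
exists f; apply: inj_surj_bij => //.
exact: (inj_mdim_surj (fin := fin) injf (mdim_inj fin injg)).
Qed.
End Progenerators.

Section IsoInvariance.
Variable R : pzRingType.
Local Notation modR := (fgmod R).

Lemma add_of_iso_iff (U U' : modR) : mod_iso U U' -> forall M, add_of U M <-> add_of U' M.
Proof. by move=> h M; split; apply: add_of_iso => //; apply: mod_iso_sym. Qed.

Lemma cok_iso_class (U : modR) : cok_class (iso_class U) = cok U.
Proof.
apply: funext => L; apply: propext; split=> [[U' [h]]|cL]; last first.
  by exists U; split=> //; apply: mod_iso_refl.
move=> [M [N [f [p [aM aN cp]]]]]; exists M, N, f, p.
by split=> //; apply/(add_of_iso_iff h).
Qed.

Lemma progenerator_iso (C : modR -> Prop) (P P' : modR) : subcategory C ->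
  mod_iso P P' -> ext_progenerator C P -> ext_progenerator C P'.
Proof.
move=> [ciso _ _ _] h [cP hP enough]; split=> //; first exact: ciso cP.
by move=> M; rewrite -(add_of_iso_iff h M); apply: hP.
Qed.
End IsoInvariance.

Theorem theorem1 (k : fieldType) (Q : quiver) (hQ : dynkin_quiver Q) :
  [/\ forall C : fgmod (path_algebra k Q) -> Prop, ice_closed C ->
        exists P : fgmod (path_algebra k Q),
          [/\ basic P, ext_progenerator C P
            & forall P' : fgmod (path_algebra k Q),
                basic P' -> ext_progenerator C P' -> mod_iso P' P],
      forall U : fgmod (path_algebra k Q), basic U -> rigid U ->
        cok_class (iso_class U) = cok U,
      mutually_inverse (@ice_closed (path_algebra k Q))
        (@basic_rigid_class (path_algebra k Q))
        (@progen_class (path_algebra k Q)) (@cok_class (path_algebra k Q))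
    & forall T : fgmod (path_algebra k Q) -> Prop, subcategory T ->
        (ice_closed T <->
         exists W : fgmod (path_algebra k Q) -> Prop,
           wide W /\ torsion_class_in W T)].
Proof.
have tits := dynkin_tits_bounded hQ.
have [ps hps] := finite_paths tits.
have fin : findim_modules k Q := finite_paths_findim hps.
have noeth := kQ_noetherian fin.
have ext_lift := kQ_extensions_lift fin.
have ext_extend := kQ_extensions_extend fin.
(* Isomorphism classes are predicates, so uniqueness up to isomorphism becomes an equality of
   predicates. *)
have progen_iso (C : fgmod (kQ k Q) -> Prop) P : subcategory C -> basic P ->
    ext_progenerator C P -> progen_class C = iso_class P.
  move=> sC bP gP; apply: funext => M; apply: propext; split=> [[bM gM]|h].
    exact: (progenerator_unique fin tits bM gM bP gP).
  have h' := mod_iso_sym h.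
  by split; [apply: basic_iso h' bP | apply: progenerator_iso sC h' gP].
split.
- move=> C iceC; have [P [bP gP]] := progenerator_ex fin tits iceC.
  by exists P; split=> // P' bP' gP'; apply: (progenerator_unique fin tits bP' gP' bP gP).
- by move=> U _ _; apply: cok_iso_class.
- split.
  + move=> C iceC; have [P [bP gP]] := progenerator_ex fin tits iceC.
    exists P; split=> //; first exact: (progenerator_rigid gP).
    by apply: progen_iso => //; case: iceC.
  + move=> _ [U [bU rU ->]]; rewrite cok_iso_class.
    exact: (cok_ice_closed noeth ext_lift rU).
  + move=> C iceC; have [P [bP gP]] := progenerator_ex fin tits iceC.
    rewrite (progen_iso C P) //; last by case: iceC.
    rewrite cok_iso_class; apply: funext => X; apply: propext.
    exact: iff_sym (progenerator_cok iceC gP X).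
  + move=> _ [U [bU rU ->]]; rewrite cok_iso_class.
    have iceU := cok_ice_closed noeth ext_lift rU.
    apply: progen_iso => //; first by case: iceU.
    exact: (cok_progenerator noeth ext_lift rU).
- move=> T sT; split=> [iceT|[W [wW tW]]].
    exists (wide_hull T); split; first exact: (wide_hull_wide noeth ext_extend iceT).
    exact: (ice_closed_torsion_class noeth ext_extend iceT).
  exact: (torsion_class_ice_closed wW tW).
Qed.
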